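(* Let $\varphi$ be a good completely random measure on $(Z,\mathcal Z)$ with non-atomic control measure $\nu$, and suppose that $\varphi$ is also multiplicative. Let $k\ge 1$, $n_1,\dots,n_k\geq 1$, write $n=n_1+\cdots+n_k$, and let $\pi^*\in\mathcal P([n])$ be the partition $$\pi^*=\{\{1,\dots,n_1\},\{n_1+1,\dots,n_1+n_2\},\dots,\{n_1+\cdots+n_{k-1}+1,\dots,n\}\}.$$ Then, for every collection of kernels $f_1,\dots,f_k$ such that $f_j\in\mathcal E_{s,0}(\nu^{n_j})$ for $j=1,\dots,k$, $$\mathbb E\left[I^\varphi_{n_1}(f_1)\cdots I^\varphi_{n_k}(f_k)\right]=\sum_{\sigma\in\mathcal P([n]):\ \sigma\wedge\pi^*=\hat 0}\ \bigotimes_{b\in\sigma}\left\langle \mathrm{St}_{\hat 1}^{\varphi,[|b|]}\right\rangle\left(f_1\otimes_0 f_2\otimes_0\cdots\otimes_0 f_k\right),$$ and $$\chi\left(I^\varphi_{n_1}(f_1),\dots,I^\varphi_{n_k}(f_k)\right)=\sum_{\substack{\sigma\in\mathcal P([n]):\ \sigma\wedge\pi^*=\hat 0\\ \sigma\vee\pi^*=\hat 1}}\ \bigotimes_{b\in\sigma}\left\langle \mathrm{St}_{\hat 1}^{\varphi,[|b|]}\right\rangle\left(f_1\otimes_0 f_2\otimes_0\cdots\otimes_0 f_k\right).$$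
   Context: Partitions. $[n]=\{1,\dots,n\}$ and $\mathcal P([n])$ is the lattice of partitions of $[n]$, ordered by $\sigma\le\pi$ iff each block of $\sigma$ is contained in a block of $\pi$; $\wedge$ and $\vee$ are meet and join, $\hat 0$ is the partition into singletons, $\hat 1=\{[n]\}$. $|b|$ is the cardinality of a block $b$; $i\sim_\pi j$ means $i,j$ lie in the same block of $\pi$. Completely random measures. $(Z,\mathcal Z)$ is a Polish space with its Borel $\sigma$-field, $\nu$ is a positive, $\sigma$-finite, non-atomic measure on it, $\mathcal Z_\nu=\{B\in\mathcal Z:\nu(B)<\infty\}$, and $\mathcal Z^n_\nu=\{C\in\mathcal Z^{\otimes n}:\nu^n(C)<\infty\}$, where $\nu^n$ is the product measure. A (centered) completely random measure with control $\nu$ is a family $\varphi=\{\varphi(B):B\in\mathcal Z_\nu\}$ of centered real random variables on a common probability space $(\Omega,\mathcal F,\mathbb P)$, belonging to $\bigcap_{p\ge1}L^p(\mathbb P)$, such that $\varphi(\varnothing)=0$, $\varphi(B_1),\dots,\varphi(B_m)$ are independent whenever $B_1,\dots,B_m\in\mathcal Z_\nu$ are disjoint, and $\mathbb E[\varphi(B)\varphi(C)]=\nu(B\cap C)$ for $B,C\in\mathcal Z_\nu$. $\varphi$ is good if for every $n\ge2$ there is a unique family of square-integrable random variables $\varphi^{[n]}=\{\varphi^{[n]}(C):C\in\mathcal Z_\nu^n\}$ such that $\varphi^{[n]}(C_1\times\cdots\times C_n)=\varphi(C_1)\cdots\varphi(C_n)$ for all $C_j\in\mathcal Z_\nu$,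 and $\varphi^{[n]}$ is $\sigma$-additive: if $C\in\mathcal Z^n_\nu$ is the disjoint union of $C_j$, $j\ge1$, then $\varphi^{[n]}(C)=\sum_j\varphi^{[n]}(C_j)$ with convergence in $L^1(\mathbb P)$. Set $\varphi^{[1]}=\varphi$. Diagonal measures. For $\pi\in\mathcal P([n])$ let $Z^n_\pi=\{(z_1,\dots,z_n)\in Z^n: z_i=z_j \text{ iff } i\sim_\pi j\}$ and $\mathrm{St}^{\varphi,[n]}_\pi(C)=\varphi^{[n]}(C\cap Z^n_\pi)$ for $C\in\mathcal Z^n_\nu$ (for $n=1$, $\mathrm{St}^{\varphi,[1]}_{\hat 0}=\mathrm{St}^{\varphi,[1]}_{\hat 1}=\varphi$). Write $\langle \mathrm{St}^{\varphi,[n]}_\pi\rangle(C)=\mathbb E[\mathrm{St}^{\varphi,[n]}_\pi(C)]$. $\varphi$ is multiplicative if for every $n\ge2$ the deterministic measure $A\mapsto\mathbb E[\mathrm{St}^{\varphi,[n]}_{\hat1}(A\times\cdots\times A)]$, $A\in\mathcal Z_\nu$, is non-atomic. Functions and integrals. $\mathcal E(\nu^n)$ is the set of finite real linear combinations of indicators $\mathbf 1_{C^1\times\cdots\times C^n}$ with $C^\ell\in\mathcal Z_\nu$; $\mathrm{St}^{\varphi,[n]}_\pi$ extends to it by linearity. $\mathcal E_{s,0}(\nu^n)$ is the set of finite real linear combinations of indicators of sets $\widetilde C=\bigcup_{w\in\mathfrak S_n}C_{w(1)}\times\cdots\times C_{w(n)}$ with $C_1,\dots,C_n\in\mathcal Z_\nu$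 pairwise disjoint ($\mathfrak S_n$ the permutation group of $[n]$). For $f\in\mathcal E_{s,0}(\nu^n)$, the multiple Wiener-Itô integral is $I_n^\varphi(f)=\mathrm{St}^{\varphi,[n]}_{\hat 0}(f)$; thus $I_n^\varphi(\mathbf 1_{\widetilde C})=n!\,\varphi(C_1)\cdots\varphi(C_n)$. Tensor product: $f_1\otimes_0\cdots\otimes_0f_k(x_1,\dots,x_n)=\prod_{j=1}^kf_j(x_{n_1+\cdots+n_{j-1}+1},\dots,x_{n_1+\cdots+n_j})$, an element of $\mathcal E(\nu^n)$. For $\sigma\in\mathcal P([n])$, $\bigotimes_{b\in\sigma}\langle\mathrm{St}^{\varphi,[|b|]}_{\hat1}\rangle(\cdot)$ is the linear functional on $\mathcal E(\nu^n)$ (integral against the product set function) determined by $$\bigotimes_{b\in\sigma}\langle\mathrm{St}^{\varphi,[|b|]}_{\hat1}\rangle(\mathbf 1_{A_1\times\cdots\times A_n})=\prod_{b=\{j_1,\dots,j_m\}\in\sigma}\langle\mathrm{St}^{\varphi,[m]}_{\hat1}\rangle(A_{j_1}\times\cdots\times A_{j_m}),\qquad A_i\in\mathcal Z_\nu.$$ Cumulants: $\chi(X_1,\dots,X_k)=(-i)^k\frac{\partial^k}{\partial z_1\cdots\partial z_k}\log\mathbb E[\exp(i\sum_{\ell}z_\ell X_\ell)]\big|_{z=0}$. *)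

(* Defs.v *)
From HB Require Import structures.
From mathcomp Require Import all_boot all_order all_algebra all_fingroup.
From mathcomp Require Import all_classical all_reals all_analysis.
From mathcomp Require Import complex ring lra.

Set Implicit Arguments.
Unset Strict Implicit.
Unset Printing Implicit Defensive.

Import Order.TTheory GRing.Theory Num.Theory.
Import numFieldNormedType.Exports.

Local Open Scope classical_set_scope.
Local Open Scope ring_scope.

Section partitions.
Variable n : nat.
Implicit Types (s t p q : {set {set 'I_n}}).

Definition is_part s : bool := finset.partition s [set: 'I_n].

Definition same_block s (i j : 'I_n) : bool := j \in finset.pblock s i.

Definition refines s t : bool :=
  [forall b in s, exists c in t, b \subset c].

Definition pbot : {set {set 'I_n}} := [set [set i] | i in [set: 'I_n]]%SET.
(* Only a partition for [0 < n]. *)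
Definition ptop : {set {set 'I_n}} := [set [set: 'I_n]]%SET.

(* The blocks of the meet are the nonempty intersections of blocks; see [pmeetP]
   for the lattice property, and [pjoinP] for that of the join. *)
Definition pmeet s t : {set {set 'I_n}} :=
  ([set b :&: c | b in s, c in t] :\ finset.set0)%SET.

Definition pjoin s t : {set {set 'I_n}} :=
  finset.equivalence_partition
    (connect (fun i j => same_block s i j || same_block t i j)) [set: 'I_n]%SET.

Lemma part_cover s i : is_part s -> i \in finset.cover s.
Proof. by move=> /andP[/eqP -> _]; rewrite finset.in_setT. Qed.

Lemma same_blockE s i j : is_part s ->
  same_block s i j = (finset.pblock s i == finset.pblock s j).
Proof.
move=> ps; rewrite /same_block finset.eq_pblock //; last exact: part_cover.
by case/and3P: ps.
Qed.

Lemma in_part s b i j : is_part s -> b \in s -> i \in b ->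
  (j \in b) = same_block s i j.
Proof.
move=> /and3P[_ tI _] bs ib.
by rewrite /same_block (finset.def_pblock tI bs ib).
Qed.

(* The order is inclusion of the associated equivalence relations. *)
Lemma refinesP s t : is_part s -> is_part t ->
  reflect (forall i j, same_block s i j -> same_block t i j) (refines s t).
Proof.
move=> ps pt; apply: (iffP idP).
  move=> /forall_inP st i j ij.
  have bs : finset.pblock s i \in s.
    by apply: finset.pblock_mem; exact: part_cover.
  have ib : i \in finset.pblock s i by rewrite finset.mem_pblock part_cover.
  have /exists_inP[c ct /fintype.subsetP bc] := st _ bs.
  by rewrite -(in_part j pt ct (bc _ ib)); exact: bc.
move=> st; apply/forall_inP => b bs.
have b0 : b != finset.set0.
  by apply: contraTneq bs => ->; case/and3P: ps.
have /finset.set0Pn[i ib] := b0.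
apply/exists_inP; exists (finset.pblock t i).
  by apply: finset.pblock_mem; exact: part_cover.
apply/fintype.subsetP => j; rewrite (in_part j ps bs ib) => /st.
by [].
Qed.

Lemma pmeet_part s t : is_part s -> is_part t -> is_part (pmeet s t).
Proof.
move=> ps pt; apply/and3P; split.
- rewrite finset.eqEsubset finset.subsetT; apply/fintype.subsetP => i _.
  apply/finset.bigcupP; exists (finset.pblock s i :&: finset.pblock t i)%SET.
    rewrite !inE; apply/andP; split.
      by apply/finset.set0Pn; exists i; rewrite inE !finset.mem_pblock !part_cover.
    by apply/imset2P; exists (finset.pblock s i) (finset.pblock t i) => //;
      apply: finset.pblock_mem; exact: part_cover.
  by rewrite inE !finset.mem_pblock !part_cover.
- apply/finset.trivIsetP => A B.
  rewrite !inE => /andP[_ /imset2P[b c bs ct ->]].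
  move=> /andP[_ /imset2P[b' c' bs' ct' ->]]; apply: contraR => ndis.
  have /pred0Pn[i /=] := ndis.
  rewrite !inE => /andP[/andP[ib ic] /andP[ib' ic']].
  apply/eqP; congr (_ :&: _)%SET; apply/finset.setP => j.
    by rewrite (in_part j ps bs ib) (in_part j ps bs' ib').
  by rewrite (in_part j pt ct ic) (in_part j pt ct' ic').
- by rewrite !inE eqxx.
Qed.

Lemma same_block_pmeet s t i j : is_part s -> is_part t ->
  same_block (pmeet s t) i j = same_block s i j && same_block t i j.
Proof.
move=> ps pt; have pm := pmeet_part ps pt.
have : finset.pblock (pmeet s t) i \in pmeet s t.
  by apply: finset.pblock_mem; exact: part_cover.
have : i \in finset.pblock (pmeet s t) i by rewrite finset.mem_pblock part_cover.
rewrite {2}/pmeet !inE => ib /andP[_ /imset2P[b c bs ct e]].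
rewrite {1}/same_block; move: ib; rewrite e !inE => /andP[ib ic].
by rewrite (in_part j ps bs ib) (in_part j pt ct ic).
Qed.

Lemma pmeetP s t p : is_part s -> is_part t -> is_part p ->
  refines p (pmeet s t) = refines p s && refines p t.
Proof.
move=> ps pt pp; have pm := pmeet_part ps pt.
apply/(refinesP pp pm)/andP.
  move=> h; split; apply/refinesP => // i j /h.
    by rewrite same_block_pmeet// => /andP[].
  by rewrite same_block_pmeet// => /andP[].
move=> [/(refinesP pp ps) h1 /(refinesP pp pt) h2] i j ij.
by rewrite same_block_pmeet// h1// h2.
Qed.

Lemma join_equiv s t : is_part s -> is_part t ->
  {in [set: 'I_n]%SET & &, equivalence_rel
    (connect (fun i j => same_block s i j || same_block t i j))}.
Proof.
move=> ps pt; have cs : connect_sym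
    (fun i j => same_block s i j || same_block t i j).
  apply: sym_connect_sym => i j /=.
  rewrite !(same_blockE _ _ ps) !(same_blockE _ _ pt).
  by rewrite (eq_sym (finset.pblock s i)) (eq_sym (finset.pblock t i)).
move=> i j k _ _ _; split; first exact: connect0.
by move=> ij; apply/(same_connect cs).
Qed.

Lemma pjoin_part s t : is_part s -> is_part t -> is_part (pjoin s t).
Proof. by move=> ps pt; apply/finset.equivalence_partitionP/join_equiv. Qed.

Lemma same_block_pjoin s t i j : is_part s -> is_part t ->
  same_block (pjoin s t) i j =
  connect (fun i j => same_block s i j || same_block t i j) i j.
Proof.
move=> ps pt; rewrite /same_block /pjoin.
by rewrite finset.pblock_equivalence_partition ?finset.in_setT//; exact: join_equiv.
Qed.

Lemma pjoinP s t p : is_part s -> is_part t -> is_part p ->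
  refines (pjoin s t) p = refines s p && refines t p.
Proof.
move=> ps pt pp; have pj := pjoin_part ps pt.
apply/(refinesP pj pp)/andP.
  move=> h; split; apply/refinesP => // i j ij; apply: h;
    by rewrite same_block_pjoin//; apply: connect1; rewrite ij ?orbT.
move=> [/(refinesP ps pp) h1 /(refinesP pt pp) h2] i j.
rewrite same_block_pjoin// => /connectP[w].
elim: w i => [|k w IH] i /=.
  by move=> _ ->; rewrite same_blockE.
move=> /andP[ik kw] jE; have := IH _ kw jE.
rewrite !same_blockE// => /eqP <-; rewrite -same_blockE//.
by case/orP: ik => [/h1|/h2].
Qed.

End partitions.

Arguments pbot : clear implicits.
Arguments ptop : clear implicits.

Section topology.
Variable R : realType.

Definition separable (T : topologicalType) : Prop :=
  exists D : set T, countable D /\ dense D.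

Definition completely_metrizable (T : topologicalType) : Prop :=
  exists dist : T -> T -> R,
  [/\ [/\ forall x y, 0 <= dist x y,
          forall x y, dist x y = 0 <-> x = y,
          forall x y, dist x y = dist y x &
          forall x y z, dist x z <= dist x y + dist y z],
      forall (x : T) (A : set T),
        nbhs x A <-> exists2 e : R, 0 < e & [set y | dist x y < e] `<=` A &
      forall u : nat -> T,
        (forall e : R, 0 < e -> exists N : nat, forall p q : nat,
           (N <= p)%N -> (N <= q)%N -> dist (u p) (u q) < e) ->
        exists l : T, u @ \oo --> l].

Definition polish (T : topologicalType) : Prop :=
  separable T /\ completely_metrizable T.

End topology.

Notation borel T := (g_sigma_algebraType (@open T)).

Section product.
Context {R : realType} {d : measure_display} {Z : measurableType d}.
Variable nu : {measure set Z -> \bar R}.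
Implicit Types (n : nat).

(* [D] is the class of sets on which [mu] is considered and [mu] may be signed:
   a set [A] with [mu A <> 0] is an atom when [mu B] is [0] or [mu A] for every
   [B `<=` A]. For a sigma-finite positive measure this is the usual notion. *)
Definition nonatomic (D : set (set Z)) (mu : set Z -> \bar R) : Prop :=
  forall A, D A -> mu A <> 0%E ->
  exists B, [/\ D B, B `<=` A, mu B <> 0%E & mu B <> mu A].

Definition fin_sets : set (set Z) :=
  [set B | measurable B /\ (nu B < +oo)%E].

Definition rect n (A : 'I_n -> set Z) : set (n.-tuple Z) :=
  [set z | forall i, A i (tnth z i)].

(* The n-fold product measure, defined by iterated integration
   [nu^(m+1)(C) = \int nu^m(C_z) nu(dz)]; see [nu_pow_rect]. *)
Fixpoint nu_pow n : set (n.-tuple Z) -> \bar R :=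
  match n return set (n.-tuple Z) -> \bar R with
  | 0 => fun C => \d_([tuple] : 0.-tuple Z) C
  | m.+1 => fun C => (\int[nu]_z nu_pow [set t : m.-tuple Z | C [tuple of z :: t]])%E
  end.

Lemma nu_pow_rect n (A : 'I_n -> set Z) : (forall i, measurable (A i)) ->
  nu_pow (rect A) = (\prod_(i < n) nu (A i))%E.
Proof.
elim: n A => [A _|n IH A mA] /=.
  rewrite big_ord0 diracE.
  rewrite (_ : _ \in _ = true)//; apply/mem_set => -[].
  by [].
rewrite big_ord_recl.
rewrite -(IH (fun i => A (lift ord0 i)))//.
have -> : (fun z => nu_pow [set t : n.-tuple Z | rect A [tuple of z :: t]]) =
  (fun z => if z \in A ord0 then nu_pow (rect (fun i => A (lift ord0 i))) else 0%E).
  apply/funext => z; case: ifPn => [/set_mem zA|zA].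
    congr (nu_pow _); apply/seteqP; split => t /= h i.
      by have := h (lift ord0 i); rewrite tnthS.
    by case: (unliftP ord0 i) => [j|] ->; rewrite ?tnthS//; exact: h.
  have -> : [set t : n.-tuple Z | rect A [tuple of z :: t]] = set0.
    apply/seteqP; split => t //= /(_ ord0).
    by move/mem_set; rewrite (negbTE zA).
  elim: (n) => [|m IHm] /=; first by rewrite dirac0.
  by rewrite integral0_eq// => x _; rewrite -[RHS]IHm; congr (nu_pow _).
rewrite -integral_mkcond/= integral_cst//.
by rewrite muleC.
Qed.

Definition fin_setsn n : set (set (n.-tuple Z)) :=
  [set C | measurable C /\ (nu_pow C < +oo)%E].

Definition diag n (p : {set {set 'I_n}}) : set (n.-tuple Z) :=
  [set z | forall i j, tnth z i = tnth z j <-> same_block p i j].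

Definition elementary n (f : n.-tuple Z -> R) (m : nat) (c : 'I_m -> R)
    (A : 'I_m -> 'I_n -> set Z) : Prop :=
  (forall l i, fin_sets (A l i)) /\
  f = (fun z => \sum_(l < m) c l * \1_(rect (A l)) z).

(* The linear extension to linear combinations of indicators of rectangles of a
   set function [M] given on tuples [(A_1,...,A_n)]. The value is read off on
   some decomposition of [f], the same for the whole random variable when [V] is
   a space of random variables; it is [0] on functions with no decomposition. *)
Definition linear_ext (V : lmodType R) n (M : ('I_n -> set Z) -> V)
    (f : n.-tuple Z -> R) : V :=
  xget 0 [set v | exists (m : nat) (c : 'I_m -> R) (A : 'I_m -> 'I_n -> set Z),
    elementary f c A /\ v = \sum_(l < m) c l *: M (A l)].

Definition sym_rect n (C : 'I_n -> set Z) : set (n.-tuple Z) :=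
  \bigcup_(w in [set: 'S_n]) rect (fun i => C (w i)).

Definition sym_elementary n : set (n.-tuple Z -> R) :=
  [set f | exists (m : nat) (c : 'I_m -> R) (C : 'I_m -> 'I_n -> set Z),
    [/\ forall l i, fin_sets (C l i),
        forall l i j, i != j -> C l i `&` C l j = set0 &
        f = (fun z => \sum_(l < m) c l * \1_(sym_rect (C l)) z)]].

(* [tagnat.Rank j i] is the index [n_ 0 + ... + n_ (j - 1) + i] of the
   concatenation ([tagnat.RankEsum]). *)
Definition tensor k (n_ : 'I_k -> nat) (f : forall j, (n_ j).-tuple Z -> R)
    (x : (\sum_j n_ j).-tuple Z) : R :=
  \prod_(j < k) f j [tuple tnth x (tagnat.Rank j i) | i < n_ j].

End product.

Definition pistar k (n_ : 'I_k -> nat) : {set {set 'I_(\sum_j n_ j)}} :=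
  [set [set tagnat.Rank j i | i in [set: 'I_(n_ j)]] | j in [set: 'I_k]]%SET.

Section crm.
Context {R : realType} {d : measure_display} {Z : measurableType d}
  {d' : measure_display} {Omega : measurableType d'}.
Variables (nu : {measure set Z -> \bar R}) (P : probability Omega R).

Definition independent_RVs m (X : 'I_m -> Omega -> R) : Prop :=
  forall A : 'I_m -> set R, (forall i, measurable (A i)) ->
  P (\bigcap_(i in [set: 'I_m]) X i @^-1` A i) =
  (\prod_(i < m) P (X i @^-1` A i))%E.

Record is_crm (phi : set Z -> Omega -> R) : Prop := {
  crm_Lp : forall B, fin_sets nu B ->
    forall p : R, 1 <= p -> phi B \in Lfun P p%:E ;
  crm_centered : forall B, fin_sets nu B -> ('E_P[phi B] = 0)%E ;
  crm_set0 : {ae P, forall w, phi set0 w = 0} ;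
  crm_indep : forall m (B : 'I_m -> set Z),
    (forall i, fin_sets nu (B i)) ->
    (forall i j, i != j -> B i `&` B j = set0) ->
    independent_RVs (fun i => phi (B i)) ;
  crm_cov : forall B C, fin_sets nu B -> fin_sets nu C ->
    ('E_P[phi B \* phi C] = nu (B `&` C))%E }.

Variable phi : set Z -> Omega -> R.

(* Identities between random variables are almost sure, and [phi], [Phi] are only
   constrained on sets of finite measure. *)
Record is_power n (Phi : set (n.-tuple Z) -> Omega -> R) : Prop := {
  power_L2 : forall C, fin_setsn nu C -> Phi C \in Lfun P 2%:E ;
  power_rect : forall A : 'I_n -> set Z, (forall i, fin_sets nu (A i)) ->
    {ae P, forall w, Phi (rect A) w = \prod_(i < n) phi (A i) w} ;
  power_sigma : forall F : nat -> set (n.-tuple Z),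
    (forall j, fin_setsn nu (F j)) -> trivIset setT F ->
    fin_setsn nu (\bigcup_j F j) ->
    (fun N => 'E_P[fun w =>
       `|Phi (\bigcup_j F j) w - \sum_(j < N) Phi (F j) w|%R])%E @ \oo --> 0%E }.

Definition good_crm : Prop := forall n, (2 <= n)%N ->
  (exists Phi : set (n.-tuple Z) -> Omega -> R, is_power Phi) /\
  (forall Phi Psi : set (n.-tuple Z) -> Omega -> R,
     is_power Phi -> is_power Psi -> forall C, fin_setsn nu C ->
     {ae P, forall w, Phi C w = Psi C w}).

(* Under [good_crm] the family chosen for [2 <= n] is determined almost surely; the
   case [n = 0] is never used. *)
Definition power n : set (n.-tuple Z) -> Omega -> R :=
  match n return set (n.-tuple Z) -> Omega -> R with
  | 1 => fun C => phi [set z | C [tuple z]]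
  | m => xget (fun _ _ => 0) (@is_power m)
  end.

Definition St n (p : {set {set 'I_n}}) (C : set (n.-tuple Z)) : Omega -> R :=
  power (C `&` diag p).

Definition mean_St n (p : {set {set 'I_n}}) (C : set (n.-tuple Z)) : R :=
  fine 'E_P[St p C].

Definition multiplicative_crm : Prop := forall n, (2 <= n)%N ->
  nonatomic (fin_sets nu)
    (fun A => (mean_St (ptop n) (rect (fun=> A)))%:E).

Definition wiener_ito n (f : n.-tuple Z -> R) : Omega -> R :=
  linear_ext nu (V := Omega -> R^o) (fun A => St (pbot n) (rect A)) f.

(* [enum_val] lists the elements of the block [b] in increasing order. *)
Definition diag_tensor n (s : {set {set 'I_n}}) (f : n.-tuple Z -> R) : R :=
  linear_ext nu (V := R^o)
    (fun A => \prod_(b in s)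
       mean_St (ptop #|b|) (rect (fun i : 'I_#|b| => A (enum_val i)))) f.

End crm.

Section cumulant.
Context {R : realType}.

Definition expi (t : R) : R[i] := Complex (cos t) (sin t).

Definition cmod (w : R[i]) : R := Num.sqrt (complex.Re w ^+ 2 + complex.Im w ^+ 2).

(* Principal argument in ]-pi, pi] by the half-angle formula, see [cargP]. *)
Definition carg (w : R[i]) : R :=
  if (complex.Im w == 0) && (complex.Re w <= 0) then pi
  else 2 * atan (complex.Im w / (cmod w + complex.Re w)).

Lemma cargP (w : R[i]) : w != 0 ->
  [/\ - pi < carg w <= pi, cmod w * cos (carg w) = complex.Re w
    & cmod w * sin (carg w) = complex.Im w].
Proof.
case: w => x y; rewrite eq_complex /= => w0.
rewrite /carg /cmod /=; set r := Num.sqrt _.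
have r2 : r ^+ 2 = x ^+ 2 + y ^+ 2 by rewrite sqr_sqrtr// addr_ge0// sqr_ge0.
have r0 : 0 < r.
  rewrite sqrtr_gt0 lt_neqAle addr_ge0 ?sqr_ge0// andbT eq_sym.
  by rewrite paddr_eq0 ?sqr_ge0// !sqrf_eq0.
case: ifPn => [/andP[/eqP y0 x0]|].
  rewrite cospi sinpi lexx mulr0 mulrN1 y0; split => //.
    by rewrite andbT (@lt_trans _ _ 0)// ?oppr_lt0 pi_gt0.
  by rewrite /r y0 expr0n addr0 sqrtr_sqr ler0_norm// opprK.
rewrite negb_and -ltNge => h.
have s0 : 0 < r + x.
  have : - x < r \/ 0 < x.
    case/orP: h => [y0|]; last by right.
    left; case: (ltP 0 x) => x0; first lra.
    rewrite -ltr_sqr ?nnegrE; [|lra|exact: ltW].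
    by rewrite sqrrN r2 ltrDl lt_neqAle sqr_ge0 eq_sym sqrf_eq0 y0.
  by case; lra.
set u := y / (r + x).
have e : 1 + u ^+ 2 = 2 * r / (r + x).
  rewrite /u expr_div_n; have -> : y ^+ 2 = r ^+ 2 - x ^+ 2 by rewrite r2; ring.
  by field; rewrite gt_eqF.
have c0 : cos (atan u) != 0.
  by rewrite gt_eqF// cos_gt0_pihalf// atan_gtNpi2 atan_ltpi2.
have c2 : cos (atan u) ^+ 2 = (r + x) / (2 * r).
  have := cos2_tan2 c0; rewrite atanK e => cE.
  by rewrite -[LHS]invrK cE invf_div.
have sE : sin (atan u) = u * cos (atan u).
  by rewrite -[X in X * _]atanK /tan divfK.
split.
- have := atan_gtNpi2 u; have := atan_ltpi2 u; lra.
- rewrite mulrC mulr_natl cos_mulr2n c2.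
  by field; rewrite gt_eqF.
- rewrite mulr_natl sin_mulr2n sE mulrCA -expr2 c2 /u -mulr_natl.
  by field; rewrite !gt_eqF.
Qed.

Definition clog (w : R[i]) : R[i] := Complex (ln (cmod w)) (carg w).

(* Partial derivative, in the [l]-th coordinate, of a complex-valued function of
   real variables. *)
Definition partialC k (l : 'I_k) (F : 'rV[R]_k -> R[i]) : 'rV[R]_k -> R[i] :=
  fun z => Complex ('D_(delta_mx 0 l) (fun y => complex.Re (F y)) z)
                   ('D_(delta_mx 0 l) (fun y => complex.Im (F y)) z).

Definition mixed_partial k (F : 'rV[R]_k -> R[i]) : 'rV[R]_k -> R[i] :=
  foldr (@partialC k) F (enum 'I_k).

Context {d : measure_display} {Omega : measurableType d}.
Variable P : probability Omega R.

Definition expectationC (X : Omega -> R[i]) : R[i] :=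
  Complex (fine 'E_P[fun w => complex.Re (X w)])
          (fine 'E_P[fun w => complex.Im (X w)]).

Definition charfun k (X : 'I_k -> Omega -> R) (z : 'rV[R]_k) : R[i] :=
  expectationC (fun w => expi (\sum_(l < k) z 0 l * X l w)).

(* [Complex 0 (-1)] is [-i]. *)
Definition cumulant k (X : 'I_k -> Omega -> R) : R[i] :=
  (Complex 0 (-1)) ^+ k * mixed_partial (fun z => clog (charfun X z)) 0.

End cumulant.

(* Main.v *)
(* Let [K b] be the mean of the diagonal measure of a block [b] on given disjoint
   sets [C_i] (repetitions allowed). The diagonal is the decreasing limit of the unions of the
   cubes over finer and finer partitions of [Z], so [K b] is the limit of the sums over the
   pieces [B] of [E prod_(i in b) phi (C_i n B)]. Since [phi] is independently scattered and
   [nu] has no atoms, this gives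
     [E prod_(i in D) phi C_i = sum_(i0 in b, b in D) K b * E prod_(i in D - b) phi C_i]
   for each fixed [i0] in [D], hence [E prod_(i in D) phi C_i] is the sum over the partitions
   of [D] of the products of the [K b]. By linearity this is the moment formula, in which
   partitions joining two arguments of one kernel vanish. Grouping the partitions by the
   component of a fixed kernel turns the moment formula into the recursion that Leibniz' rule
   gives for the derivatives at [0] of the logarithm of the characteristic function, and the
   contribution of the partitions with a single component is the joint cumulant. *)

(* The passage to the limit in the recursion on blocks needs two uniform estimates. The sum over the
   atoms of the absolute inner means has to stay bounded: sums of even moments of a single set
   converge, hence are bounded, and they dominate the mixed products. The outer mean has to approach
   its limit uniformly over the atoms of a given length: within a set of finite measure all of them
   become small together, and removing a small set changes a product bounded in mean square by
   little. Since [linear_ext] reads its value off an arbitrary decomposition, nothing can be said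
   about integrals before different decompositions are compared. They are refined to the disjoint
   cells cut out by finitely many sets, on which only the values of the kernel matter. One family of
   cells serves all the kernels, so that both formulas become sums over maps from the [n] arguments
   to cells. The principal logarithm is used only where the characteristic function has positive
   real part. [mixed_partial] differentiates in the last variable first, which is why the fixed
   kernel in the cumulant formula is the last one. *)
Require Import Defs.
From mathcomp Require Import all_boot all_order all_algebra all_fingroup.
From mathcomp Require Import all_classical all_reals all_analysis.
From mathcomp Require Import measurable_realfun complex ring lra.

Set Implicit Arguments.
Unset Strict Implicit.
Unset Printing Implicit Defensive.

Import Order.TTheory GRing.Theory Num.Theory.
Import numFieldNormedType.Exports.

Local Open Scope classical_set_scope.
Local Open Scope ring_scope.

(** * Moments and independence *)

Section moments.
Context {R : realType} {d : measure_display} {Omega : measurableType d}.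
Variable P : probability Omega R.
Implicit Types X Y : Omega -> R.

Definition mean X : R := fine ('E_P[X])%E.

(** Such variables form an algebra, so that means of polynomials in the [phi B] can be manipulated
    linearly without separate integrability arguments. *)
Definition has_moments X : Prop := measurable_fun setT X /\
  forall p : nat, P.-integrable setT (EFin \o (fun w => `|X w| ^+ p)).

Lemma meanE X : mean X = \int[P]_w X w.
Proof. by rewrite /mean unlock. Qed.

Lemma has_moments_bounded X C : measurable_fun setT X -> (forall w, `|X w| <= C) ->
  has_moments X.
Proof.
move=> mX XC; split => // p.
apply: (@le_integrable _ _ _ _ _ _ _ (EFin \o cst (C ^+ p))) => //.
- by apply/measurable_EFinP; apply: measurable_funX; exact: measurableT_comp.
- move=> w _ /=; rewrite lee_fin normrX normr_id.
  by rewrite (le_trans _ (ler_norm _))// lerXn2r// ?nnegrE// (le_trans _ (XC w)).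
- exact: finite_measure_integrable_cst.
Qed.

Lemma has_moments_cst c : has_moments (fun=> c).
Proof. by apply: (@has_moments_bounded _ `|c|) => // w. Qed.

Lemma has_moments_integrable X : has_moments X -> P.-integrable setT (EFin \o X).
Proof.
move=> [mX /(_ 1%N) iX]; apply: le_integrable iX => //.
  exact/measurable_EFinP.
by move=> w _ /=; rewrite lee_fin expr1 normr_id.
Qed.

Lemma has_moments_measurable X : has_moments X -> measurable_fun setT X.
Proof. by case. Qed.

Lemma integrable_EFinD X Y : P.-integrable setT (EFin \o X) ->
  P.-integrable setT (EFin \o Y) -> P.-integrable setT (EFin \o (fun w => X w + Y w)).
Proof.
move=> iX iY; rewrite (_ : EFin \o _ = (EFin \o X) \+ (EFin \o Y))%E.
  exact: integrableD.
by apply/funext => w /=.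
Qed.

Lemma integrable_EFinB X Y : P.-integrable setT (EFin \o X) ->
  P.-integrable setT (EFin \o Y) -> P.-integrable setT (EFin \o (fun w => X w - Y w)).
Proof.
move=> iX iY; rewrite (_ : EFin \o _ = (EFin \o X) \- (EFin \o Y))%E.
  exact: integrableB.
by apply/funext => w /=.
Qed.

Lemma integrable_EFinZ c X : P.-integrable setT (EFin \o X) ->
  P.-integrable setT (EFin \o (fun w => c * X w)).
Proof.
move=> iX; rewrite (_ : EFin \o _ = (fun w => c%:E * (EFin \o X) w))%E.
  exact: integrableZl.
by apply/funext => w /=.
Qed.

(** By [|X Y|^p <= |X|^(2p) + |Y|^(2p)]. *)
Lemma has_momentsM X Y : has_moments X -> has_moments Y ->
  has_moments (fun w => X w * Y w).
Proof.
move=> [mX iX] [mY iY]; split; first exact: measurable_funM.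
move=> p; have := integrable_EFinD (iX (p * 2)%N) (iY (p * 2)%N).
apply: le_integrable => //.
  apply/measurable_EFinP; apply: measurable_funX; apply: measurableT_comp => //.
  exact: measurable_funM.
move=> w _ /=; rewrite lee_fin normrX normr_id normrM exprMn.
set x := `|X w| ^+ p; set y := `|Y w| ^+ p.
have x0 : 0 <= x by rewrite exprn_ge0.
have y0 : 0 <= y by rewrite exprn_ge0.
rewrite !exprM -/x -/y ger0_norm ?addr_ge0 ?sqr_ge0//; nra.
Qed.

Lemma has_momentsD X Y : has_moments X -> has_moments Y ->
  has_moments (fun w => X w + Y w).
Proof.
move=> [mX iX] [mY iY]; split; first exact: measurable_funD.
move=> p; have := integrable_EFinZ (2 ^+ p) (integrable_EFinD (iX p) (iY p)).
apply: le_integrable => //.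
  apply/measurable_EFinP; apply: measurable_funX; apply: measurableT_comp => //.
  exact: measurable_funD.
move=> w _ /=; rewrite lee_fin normrX normr_id.
rewrite (le_trans _ (ler_norm _))//.
wlog : X Y mX mY iX iY / `|X w| <= `|Y w|.
  move=> h; have [/h|/ltW /h] := leP `|X w| `|Y w|; first exact.
  by rewrite addrC [in leRHS](addrC (_ ^+ p)); exact.
move=> XY; rewrite (@le_trans _ _ ((2 * `|Y w|) ^+ p))//.
  by rewrite lerXn2r ?nnegrE ?mulr_ge0// (le_trans (ler_normD _ _))//; lra.
by rewrite exprMn ler_wpM2l ?exprn_ge0// lerDr exprn_ge0.
Qed.

Lemma has_momentsZ c X : has_moments X -> has_moments (fun w => c * X w).
Proof. by apply: has_momentsM; exact: has_moments_cst. Qed.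

Lemma has_momentsN X : has_moments X -> has_moments (fun w => - X w).
Proof.
move=> /(has_momentsZ (-1)); congr has_moments.
by apply/funext => w; rewrite mulN1r.
Qed.

Lemma has_momentsB X Y : has_moments X -> has_moments Y ->
  has_moments (fun w => X w - Y w).
Proof. by move=> mX /has_momentsN; exact: has_momentsD. Qed.

Lemma has_moments_sum I (s : seq I) (Q : pred I) (F : I -> Omega -> R) :
  (forall i, Q i -> has_moments (F i)) ->
  has_moments (fun w => \sum_(i <- s | Q i) F i w).
Proof.
move=> h; elim: s => [|i s IH].
  have := has_moments_cst 0; congr has_moments.
  by apply/funext => w; rewrite big_nil.
have := IH; case: (boolP (Q i)) => Qi => [{}IH|].
  have := has_momentsD (h _ Qi) IH; congr has_moments.
  by apply/funext => w; rewrite big_cons Qi.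
congr has_moments.
by apply/funext => w; rewrite big_cons (negbTE Qi).
Qed.

Lemma has_moments_prod I (s : seq I) (Q : pred I) (F : I -> Omega -> R) :
  (forall i, Q i -> has_moments (F i)) ->
  has_moments (fun w => \prod_(i <- s | Q i) F i w).
Proof.
move=> h; elim: s => [|i s IH].
  have := has_moments_cst 1; congr has_moments.
  by apply/funext => w; rewrite big_nil.
have := IH; case: (boolP (Q i)) => Qi => [{}IH|].
  have := has_momentsM (h _ Qi) IH; congr has_moments.
  by apply/funext => w; rewrite big_cons Qi.
congr has_moments.
by apply/funext => w; rewrite big_cons (negbTE Qi).
Qed.

Lemma has_momentsX X n : has_moments X -> has_moments (fun w => X w ^+ n).
Proof.
move=> h; elim: n => [|n IH]; first by under eq_fun do rewrite expr0; exact: has_moments_cst.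
by under eq_fun do rewrite exprS; exact: has_momentsM.
Qed.

Lemma mean_cst c : mean (fun=> c) = c.
Proof. by rewrite /mean expectation_cst. Qed.

Lemma meanD_int X Y : P.-integrable setT (EFin \o X) ->
  P.-integrable setT (EFin \o Y) -> mean (fun w => X w + Y w) = mean X + mean Y.
Proof. by move=> iX iY; rewrite !meanE RintegralD. Qed.

Lemma meanD X Y : has_moments X -> has_moments Y ->
  mean (fun w => X w + Y w) = mean X + mean Y.
Proof. by move=> /has_moments_integrable iX /has_moments_integrable iY; exact: meanD_int. Qed.

Lemma meanZ c X : has_moments X -> mean (fun w => c * X w) = c * mean X.
Proof. by move=> /has_moments_integrable iX; rewrite !meanE RintegralZl. Qed.

Lemma meanB X Y : has_moments X -> has_moments Y ->
  mean (fun w => X w - Y w) = mean X - mean Y.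
Proof. by move=> /has_moments_integrable iX /has_moments_integrable iY; rewrite !meanE RintegralB. Qed.

Lemma mean_sum I (s : seq I) (Q : pred I) (F : I -> Omega -> R) :
  (forall i, Q i -> has_moments (F i)) ->
  mean (fun w => \sum_(i <- s | Q i) F i w) = \sum_(i <- s | Q i) mean (F i).
Proof.
move=> h; elim: s => [|i s IH].
  by under eq_fun do rewrite big_nil; rewrite mean_cst big_nil.
rewrite big_cons; under eq_fun do rewrite big_cons.
case: (boolP (Q i)) => Qi //.
by rewrite meanD ?IH//; [exact: h|exact: has_moments_sum].
Qed.

Lemma le_mean X Y : has_moments X -> has_moments Y -> (forall w, X w <= Y w) ->
  mean X <= mean Y.
Proof.
move=> /has_moments_integrable iX /has_moments_integrable iY XY.
by rewrite !meanE le_Rintegral.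
Qed.

Lemma mean_ge0 X : (forall w, 0 <= X w) -> 0 <= mean X.
Proof. by move=> X0; rewrite meanE Rintegral_ge0. Qed.

Lemma le_norm_mean X : has_moments X -> `|mean X| <= mean (fun w => `|X w|).
Proof. by move=> /has_moments_integrable iX; rewrite !meanE le_normr_Rintegral. Qed.

Lemma has_moments_norm X : has_moments X -> has_moments (fun w => `|X w|).
Proof.
move=> [mX iX]; split; first exact: measurableT_comp.
by move=> p; under eq_fun do rewrite normr_id.
Qed.

Lemma expectation_ae_eq X Y : measurable_fun setT X -> measurable_fun setT Y ->
  {ae P, forall w, X w = Y w} -> ('E_P[X] = 'E_P[Y])%E.
Proof.
move=> mX mY XY; rewrite unlock; apply: ae_eq_integral => //.
- exact/measurable_EFinP.
- exact/measurable_EFinP.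
- by apply: filterS XY => w /= -> _.
Qed.

Lemma mean_ae_eq X Y : measurable_fun setT X -> measurable_fun setT Y ->
  {ae P, forall w, X w = Y w} -> mean X = mean Y.
Proof. by move=> mX mY XY; rewrite /mean (expectation_ae_eq mX mY XY). Qed.

Lemma mean_fineK X : has_moments X -> ('E_P[X] = (mean X)%:E)%E.
Proof.
move=> /has_moments_integrable iX; rewrite /mean fineK// expectation_fin_num//.
exact/Lfun1_integrable.
Qed.

(* AM-GM in the form [x y <= (x^2/t + t y^2)/2]. *)
Lemma mean_mul_le X Y (t : R) : 0 < t -> has_moments X -> has_moments Y ->
  `|mean (fun w => X w * Y w)| <=
  (mean (fun w => X w ^+ 2) / t + t * mean (fun w => Y w ^+ 2)) / 2.
Proof.
move=> t0 mX mY.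
have mX2 := has_momentsX 2 mX; have mY2 := has_momentsX 2 mY.
have mXY := has_momentsM mX mY.
rewrite (le_trans (le_norm_mean mXY))//.
rewrite (_ : _ / 2 = mean (fun w => (2 * t)^-1 * X w ^+ 2 + (t / 2) * Y w ^+ 2)); last first.
  rewrite meanD ?meanZ//; [|exact: has_momentsZ..].
  by field; rewrite gt_eqF.
apply: le_mean; [exact: has_moments_norm| |].
  by apply: has_momentsD; exact: has_momentsZ.
move=> w; rewrite normrM -(real_normK (num_real (X w))) -(real_normK (num_real (Y w))).
move: (normr_ge0 (X w)) (normr_ge0 (Y w)); set x := `|_|; set y := `|_| => x0 y0.
rewrite -subr_ge0.
have -> : (2 * t)^-1 * x ^+ 2 + t / 2 * y ^+ 2 - x * y = (x - t * y) ^+ 2 / (2 * t).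
  by field; rewrite gt_eqF.
by rewrite divr_ge0 ?sqr_ge0// mulr_ge0// ltW.
Qed.

Lemma mean_eq0_ae X : measurable_fun setT X -> P.-integrable setT (EFin \o (fun w => X w ^+ 2)) ->
  mean (fun w => X w ^+ 2) = 0 -> {ae P, forall w, X w = 0}.
Proof.
move=> mX iX; rewrite meanE /Rintegral => h.
have : (\int[P]_w `|(X w ^+ 2)%:E| = 0)%E.
  under eq_integral do rewrite gee0_abs ?lee_fin ?sqr_ge0//.
  rewrite -[LHS]fineK ?h//; exact: integrable_fin_num.
move/ae_eq_integral_abs => /= H.
have mX2 : measurable_fun setT (fun w => (X w ^+ 2)%:E).
  by apply/measurable_EFinP; exact: measurable_funX.
have := H measurableT mX2.
apply: filterS => w /(_ I) /eqP; rewrite eqe sqrf_eq0 => /eqP.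
by [].
Qed.

End moments.

Section limits.
Context {R : realType} {I T : Type}.

Lemma cvg_sumr (F : set_system T) (r : seq I) (Q : pred I)
    (f : I -> T -> R) (l : I -> R) : Filter F ->
  (forall i, Q i -> f i x @[x --> F] --> l i) ->
  \sum_(i <- r | Q i) f i x @[x --> F] --> \sum_(i <- r | Q i) l i.
Proof. by move=> FF; apply: cvg_big; exact: add_continuous. Qed.

Lemma cvg_prodr (F : set_system T) (r : seq I) (Q : pred I)
    (f : I -> T -> R) (l : I -> R) : Filter F ->
  (forall i, Q i -> f i x @[x --> F] --> l i) ->
  \prod_(i <- r | Q i) f i x @[x --> F] --> \prod_(i <- r | Q i) l i.
Proof. by move=> FF; apply: cvg_big; exact: mul_continuous. Qed.

End limits.

Section independence.
Context {R : realType} {d : measure_display} {Omega : measurableType d}.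
Variable P : probability Omega R.

Lemma mean_indic (A : set Omega) : measurable A -> mean P (\1_A : Omega -> R) = fine (P A).
Proof. by move=> mA; rewrite /mean expectation_indic. Qed.

(** Powers of [h] are combinations of the indicators of its finitely many level sets. Expanding both
    sides over the choices of one level per variable reduces the claim to [independent_RVs] on these
    level sets. *)
Lemma mean_prod_finite_range m (X : 'I_m -> Omega -> R) (p : 'I_m -> nat) (h : R -> R) :
  independent_RVs P X -> (forall i, measurable_fun setT (X i)) ->
  measurable_fun setT h -> finite_set (range h) ->
  mean P (fun w => \prod_(i < m) h (X i w) ^+ p i) =
  \prod_(i < m) mean P (fun w => h (X i w) ^+ p i).
Proof.
move=> indep mX mh finh.
pose r : seq R := finmap.enum_fset (fset_set (range h)).
have rh x : h x \in r.
  by have := in_fset_set finh (h x); rewrite mem_set//=; exists x.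
have ur : uniq r by exact: finmap.fset_uniq.
pose A (k : 'I_(size r)) : set R := h @^-1` [set r`_k].
have mA k : measurable (A k).
  by rewrite /A -[_ @^-1` _]setTI; apply: mh => //; exact: measurable_set1.
have hE x q : h x ^+ q = \sum_(k < size r) r`_k ^+ q * \1_(A k) x.
  have hx : (index (h x) r < size r)%N by rewrite index_mem.
  rewrite (bigD1 (Ordinal hx))//= big1 ?addr0.
    by rewrite indicE mem_set ?mulr1 ?nth_index//= /A/= nth_index.
  move=> k kh; rewrite indicE memNset ?mulr0// /A/= => hk.
  move/eqP: kh; apply; apply: val_inj => /=.
  by rewrite hk index_uniq.
have mXA i k : measurable (X i @^-1` A k).
  by rewrite -[_ @^-1` _]setTI; apply: mX.
have bnd (S : set Omega) : measurable S -> has_moments P (\1_S : Omega -> R).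
  move=> mS; apply: (@has_moments_bounded _ _ _ _ _ 1).
    exact: measurable_indic.
  by move=> w; rewrite indicE; case: (_ \in _); rewrite ?normr1 ?normr0.
have E1 i : mean P (fun w => h (X i w) ^+ p i) =
    \sum_(k < size r) r`_k ^+ p i * fine (P (X i @^-1` A k)).
  under eq_fun do rewrite hE.
  rewrite mean_sum; last first.
    by move=> k _; apply: has_momentsZ; exact: (bnd _ (mXA i k)).
  apply: eq_bigr => k _; rewrite meanZ; last exact: (bnd _ (mXA i k)).
  by rewrite -mean_indic.
under [RHS]eq_bigr do rewrite E1.
rewrite bigA_distr_bigA/=.
under eq_fun => w.
  under eq_bigr do rewrite hE.
  rewrite bigA_distr_bigA/=.
  under eq_bigr => g _.
    rewrite big_split/=.
    have -> : \prod_(i < m) \1_(A (g i)) (X i w) =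
        \1_(\bigcap_(i in [set: 'I_m]) X i @^-1` A (g i)) w :> R.
      rewrite indicE; have [|] := boolP (w \in _).
        rewrite inE => wA; rewrite big1// => i _.
        by rewrite indicE mem_set//; exact: wA.
      move=> wA; have [i wi] : exists i, ~ A (g i) (X i w).
        apply: contrapT => /forallNP wi; move/negP: wA; apply; rewrite inE => i _ /=.
        exact: contrapT.
      by rewrite (bigD1 i)//= indicE memNset ?mul0r.
    over.
  over.
have mcap (g : {ffun 'I_m -> 'I_(size r)}) :
    measurable (\bigcap_(i in [set: 'I_m]) X i @^-1` A (g i)).
  by apply: fin_bigcap_measurable => //; exact: finite_finset.
rewrite mean_sum; last by move=> g _; apply: has_momentsZ; exact: bnd.
apply: eq_bigr => g _; rewrite meanZ ?mean_indic//; last exact: bnd.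
rewrite big_split/=; congr (_ * _); rewrite indep//.
rewrite -[RHS]/(fine (\prod_(i < m) fine (P (X i @^-1` A (g i))))%:E); congr fine.
rewrite -prodEFin; apply: eq_bigr => i _.
by rewrite fineK// fin_num_measure.
Qed.

Import HBNNSimple.

(** Simple approximations of the positive part and of the negative part are subtracted. The bound by
    [|x|] is the domination that lets means pass to the limit. *)
Lemma simple_approx_id : exists h : (R -> R)^nat,
  [/\ forall n, measurable_fun setT (h n), forall n, finite_set (range (h n)),
      forall n x, `|h n x| <= `|x| & forall x, h n x @[n --> \oo] --> x].
Proof.
pose f (x : R) := (Num.max x 0)%:E.
have mf : measurable_fun setT f.
  by apply/measurable_EFinP; exact: measurable_maxr.
pose u := nnsfun_approx measurableT mf.
have f0 x : [set: R] x -> (0 <= f x)%E by rewrite /f lee_fin le_max lexx orbT.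
have u0 n x : 0 <= u n x by [].
have uf n x : u n x <= Num.max x 0.
  by have := le_approx (D := setT) (f := f) n f0 (x := x) I; rewrite -nnsfun_approxE lee_fin.
have maxp (y : R) : 0 <= y -> Num.max y 0 = y by move=> y0; apply/max_idPl.
have maxn (y : R) : y <= 0 -> Num.max y 0 = 0 by move=> y0; apply/max_idPr.
have uc x : u n x @[n --> \oo] --> Num.max x 0.
  have := cvg_nnsfun_approx measurableT mf f0 (x := x) I.
  by move/fine_cvg.
have mN : measurable_fun setT (-%R : R -> R) by exact: oppr_measurable.
exists (fun n x => u n x - u n (- x)); split.
- move=> n; apply: measurable_funB; first exact: measurable_funPT.
  by apply: measurableT_comp => //; exact: measurable_funPT.
- move=> n; have fu : finite_set (range (u n)) by exact: fimfunP.
  apply: (@sub_finite_set _ _ ((fun p : R * R => p.1 - p.2) @` (range (u n) `*` range (u n)))).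
    by move=> _ [x _ <-]; exists (u n x, u n (- x)) => //=; split; [exists x|exists (- x)].
  by apply: finite_image; exact: finite_setX.
- move=> n x; have := uf n x; have := uf n (- x).
  have := u0 n x; have := u0 n (- x).
  set a := u n x; set b := u n (- x) => a0 b0.
  have [x0|] := boolP (0 <= x); last rewrite -ltNge => /ltW x0.
    rewrite (maxp x)// (maxn (- x)) ?oppr_le0// (ger0_norm x0) ler_norml; lra.
  rewrite (maxn x)// (maxp (- x)) ?oppr_ge0// (ler0_norm x0) ler_norml; lra.
- move=> x; have e : Num.max x 0 - Num.max (- x) 0 = x.
    have [x0|] := boolP (0 <= x); last rewrite -ltNge => x0.
      by rewrite (maxn (- x)) ?oppr_le0// subr0 maxp.
    by rewrite (maxp (- x)) ?oppr_ge0 ?(ltW x0)// (maxn x (ltW x0)) sub0r opprK.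
  by rewrite -[X in _ --> X]e; apply: cvgB; exact: uc.
Qed.

Lemma mean_dominated (Y : (Omega -> R)^nat) (X G : Omega -> R) :
  (forall n, measurable_fun setT (Y n)) -> measurable_fun setT X -> has_moments P G ->
  (forall n w, `|Y n w| <= G w) -> (forall w, Y n w @[n --> \oo] --> X w) ->
  mean P (Y n) @[n --> \oo] --> mean P X.
Proof.
move=> mY mX mG YG YX; rewrite meanE; under eq_fun do rewrite meanE.
have YX' w : setT w -> ((Y n w)%:E @[n --> \oo] --> (X w)%:E)%E.
  by move=> _; apply: cvg_EFin; [exact: nearW|exact: YX].
have [iX _ H] := @dominated_convergence _ _ _ P setT measurableT (fun n w => (Y n w)%:E)
  (fun w => (X w)%:E) (EFin \o G) (fun n => (measurable_EFinP _ _).2 (mY n))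
  ((measurable_EFinP _ _).2 mX)
  (aeW _ YX') (has_moments_integrable mG)
  (aeW _ (fun w n _ => YG n w)).
apply: fine_cvg; rewrite fineK; last exact: integrable_fin_num.
exact: H.
Qed.

(** Independence is given on events, so the finite range case is extended by dominated convergence,
    with one approximation [h n] for all the variables. The exponents allow for products in which
    the same variable occurs several times. *)
Lemma mean_prod_indep m (X : 'I_m -> Omega -> R) (p : 'I_m -> nat) :
  independent_RVs P X -> (forall i, has_moments P (X i)) ->
  mean P (fun w => \prod_(i < m) X i w ^+ p i) =
  \prod_(i < m) mean P (fun w => X i w ^+ p i).
Proof.
move=> indep mX; have [h [mh finh hle hc]] := simple_approx_id.
have mXi i : measurable_fun setT (X i) by case: (mX i).
have mhX n i : measurable_fun setT (fun w => h n (X i w) ^+ p i).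
  by apply: measurable_funX; exact: measurableT_comp.
have L : mean P (fun w => \prod_(i < m) h n (X i w) ^+ p i) @[n --> \oo] -->
    mean P (fun w => \prod_(i < m) X i w ^+ p i).
  apply: (@mean_dominated _ _ (fun w => \prod_(i < m) `|X i w| ^+ p i)).
  - by move=> n; exact: measurable_prod.
  - by apply: measurable_prod => i _; exact: measurable_funX.
  - by apply: has_moments_prod => i _; apply: has_momentsX; exact: has_moments_norm.
  - move=> n w; rewrite normr_prod; apply: ler_prod => i _.
    by rewrite normr_ge0/= normrX lerXn2r ?nnegrE.
  - move=> w; apply: cvg_prodr => i _.
    by apply: (@continuous_cvg _ _ _ _ _ _ (fun y : R => y ^+ p i));
      [exact: exprn_continuous|exact: hc].
have L2 : \prod_(i < m) mean P (fun w => h n (X i w) ^+ p i) @[n --> \oo] -->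
    \prod_(i < m) mean P (fun w => X i w ^+ p i).
  apply: cvg_prodr => i _; apply: (@mean_dominated _ _ (fun w => `|X i w| ^+ p i)) => //.
  - exact: measurable_funX.
  - by apply: has_momentsX; exact: has_moments_norm.
  - by move=> n w; rewrite normrX lerXn2r ?nnegrE.
  - by move=> w; apply: (@continuous_cvg _ _ _ _ _ _ (fun y : R => y ^+ p i));
      [exact: exprn_continuous|exact: hc].
move: L; under eq_fun do rewrite mean_prod_finite_range//.
by move=> L; exact: (cvg_unique _ L L2).
Qed.

End independence.

Section integrable_mean.
Context {R : realType} {d : measure_display} {Omega : measurableType d}.
Variable P : probability Omega R.
Implicit Types X Y : Omega -> R.

Lemma integrable_EFin_sum I (s : seq I) (F : I -> Omega -> R) :
  (forall i, P.-integrable setT (EFin \o F i)) ->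
  P.-integrable setT (EFin \o (fun w => \sum_(i <- s) F i w)).
Proof.
move=> h; rewrite (_ : EFin \o _ = (fun w => (\sum_(i <- s) (EFin \o F i) w)%E)).
  by apply: integrable_sum => // i _; exact: h.
by apply/funext => w /=; rewrite -sumEFin.
Qed.

Lemma mean_sum_int I (s : seq I) (F : I -> Omega -> R) :
  (forall i, P.-integrable setT (EFin \o F i)) ->
  mean P (fun w => \sum_(i <- s) F i w) = \sum_(i <- s) mean P (F i).
Proof.
move=> h; elim: s => [|i s IH].
  by under eq_fun do rewrite big_nil; rewrite mean_cst big_nil.
rewrite big_cons; under eq_fun do rewrite big_cons.
by rewrite meanD_int// ?IH//; exact: integrable_EFin_sum.
Qed.

Lemma ae_eq0_expectation X : measurable_fun setT X ->
  ('E_P[fun w => `|X w|%R] = 0)%E -> {ae P, forall w, X w = 0}.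
Proof.
move=> mX; rewrite unlock => h.
have mX2 : measurable_fun setT (fun w => (X w)%:E) by exact/measurable_EFinP.
have := (ae_eq_integral_abs P measurableT mX2).1 h.
by apply: filterS => w /(_ I) [].
Qed.

End integrable_mean.

Section random_measure.
Context {R : realType} {d : measure_display} {Z : measurableType d}
  {d' : measure_display} {Omega : measurableType d'}.
Variables (nu : {measure set Z -> \bar R}) (P : probability Omega R).
Variable phi : set Z -> Omega -> R.
Hypothesis crm : is_crm nu P phi.

Local Notation fin := (fin_sets nu).

Lemma fin_sets_sub A B : fin A -> measurable B -> B `<=` A -> fin B.
Proof.
move=> [mA fA] mB BA; split => //.
by apply: le_lt_trans fA; rewrite le_measure// inE.
Qed.

Lemma fin_sets0 : fin set0.
Proof. by split; [exact: measurable0|rewrite measure0 ltry]. Qed.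

Lemma fin_setsI A B : fin A -> measurable B -> fin (A `&` B).
Proof. by move=> fA mB; apply: (fin_sets_sub fA) => //; apply: measurableI => //; case: fA. Qed.

Lemma fin_setsD A B : fin A -> measurable B -> fin (A `\` B).
Proof. by move=> fA mB; apply: (fin_sets_sub fA) => //; apply: measurableD => //; case: fA. Qed.

Lemma fin_setsU A B : fin A -> fin B -> fin (A `|` B).
Proof.
move=> [mA fA] [mB fB]; split; first exact: measurableU.
by rewrite (le_lt_trans (measureU2 _ _ _))//= lte_add_pinfty.
Qed.

Lemma fin_sets_bigcup (I : finType) (Q : pred I) (A : I -> set Z) : (forall i, Q i -> fin (A i)) ->
  fin (\big[setU/set0]_(i | Q i) A i).
Proof. by move=> h; apply: big_ind => //; [exact: fin_sets0|exact: fin_setsU]. Qed.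

Lemma phi_moments B : fin B -> has_moments P (phi B).
Proof.
move=> fB; have mB : measurable_fun setT (phi B).
  by have := crm_Lp crm fB (lexx 1); rewrite inE => /andP[/[!inE]].
split => // -[|p].
  by have [_ /(_ 0%N)] := has_moments_cst P (0 : R); under eq_fun do rewrite expr0.
have p1 : 1 <= p.+1%:R :> R by rewrite ler1n.
have := Lfun_integrable p1 (crm_Lp crm fB p1).
by under eq_fun do rewrite powR_mulrn//.
Qed.

Lemma phi_measurable B : fin B -> measurable_fun setT (phi B).
Proof. by move=> /phi_moments[]. Qed.

Lemma mean_phi B : fin B -> mean P (phi B) = 0.
Proof. by move=> fB; rewrite /mean (crm_centered crm fB). Qed.

Lemma mean_phiM B C : fin B -> fin C ->
  mean P (fun w => phi B w * phi C w) = fine (nu (B `&` C)).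
Proof. by move=> fB fC; rewrite /mean; congr fine; exact: (crm_cov crm fB fC). Qed.

Lemma mean_phi2 B : fin B -> mean P (fun w => phi B w ^+ 2) = fine (nu B).
Proof.
move=> fB; under eq_fun do rewrite expr2.
by rewrite mean_phiM// setIid.
Qed.

(** The covariances suffice: expanding the mean square of [phi (A U B) - phi A - phi B] gives a
    combination of values of [nu] that cancels. *)
Lemma phiU A B : fin A -> fin B -> A `&` B = set0 ->
  {ae P, forall w, phi (A `|` B) w = phi A w + phi B w}.
Proof.
move=> fA fB AB0; have fAB := fin_setsU fA fB.
have mA := phi_moments fA; have mB := phi_moments fB; have mAB := phi_moments fAB.
pose X w := phi (A `|` B) w - (phi A w + phi B w).
have mX : has_moments P X by apply: has_momentsB => //; exact: has_momentsD.
suff : {ae P, forall w, X w = 0}.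
  by apply: filterS => w /eqP; rewrite subr_eq0 => /eqP.
apply: mean_eq0_ae; first by case: mX.
  by apply: has_moments_integrable; exact: has_momentsX.
pose M (S T : set Z) := mean P (fun w => phi S w * phi T w).
have hm S T : fin S -> fin T -> has_moments P (fun w => phi S w * phi T w).
  by move=> fS fT; apply: has_momentsM; exact: phi_moments.
transitivity (M (A `|` B) (A `|` B) + (M A A + M B B + 2 * M A B)
   - 2 * (M (A `|` B) A + M (A `|` B) B)).
  rewrite /M -!meanD -?meanZ -?meanD -?meanB; do ?
    [exact: hm|apply: has_momentsB|apply: has_momentsD|apply: has_momentsZ].
  by congr mean; apply/funext => w; rewrite /X; ring.
have fE S : fin S -> nu S \is a fin_num by move=> [? ?]; rewrite ge0_fin_numE.
rewrite /M !mean_phiM// !setIid AB0 measure0 !setIUl !setIid [B `&` A]setIC AB0 setU0 set0U.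
rewrite measureU//; [|by case: fA|by case: fB].
by rewrite fineD ?fE//=; ring.
Qed.

Lemma phi_set0 : {ae P, forall w, phi set0 w = 0}.
Proof. exact: crm_set0 crm. Qed.

(** The pieces [B i] may have infinite measure; [phi] is only evaluated on their traces on [A]. *)
Lemma phi_bigcup (I : choiceType) (s : seq I) (Q : pred I) (B : I -> set Z) (A : set Z) :
  fin A -> (forall i, measurable (B i)) ->
  pairwise (fun i j => `[< B i `&` B j = set0 >]) s ->
  {ae P, forall w, phi (A `&` \big[setU/set0]_(i <- s | Q i) B i) w =
    \sum_(i <- s | Q i) phi (A `&` B i) w}.
Proof.
move=> fA mB; elim: s => [_|i s IH /= /andP[iall ps]].
  by rewrite big_nil setI0; apply: filterS phi_set0 => w ->; rewrite big_nil.
have mU : measurable (\big[setU/set0]_(i <- s | Q i) B i).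
  by apply: bigsetU_measurable.
have := IH ps; rewrite big_cons; case: (boolP (Q i)) => Qi; last first.
  by apply: filterS => w ->; rewrite big_cons (negbTE Qi).
have dis : (A `&` B i) `&` (A `&` \big[setU/set0]_(i <- s | Q i) B i) = set0.
  apply/seteqP; split => // x [[_ xi] [_]].
  rewrite -bigcup_seq_cond => -[j /= /andP[js _] xj].
  have /asboolP e := allP iall _ js.
  by have : (B i `&` B j) x by []; rewrite e.
move: (phiU (fin_setsI fA (mB i)) (fin_setsI fA mU) dis) => h1 h2.
rewrite setIUr; apply: filterS2 h1 h2 => w -> ->.
by rewrite big_cons Qi.
Qed.

(** Several indices may carry the same set, so the factors are first grouped by set into powers of
    independent variables. *)
Lemma mean_prod_disjoint (U I : finType) (E : U -> set Z) (D : {pred I}) (h : I -> U) :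
  (forall u, fin (E u)) -> (forall u v, u != v -> E u `&` E v = set0) ->
  mean P (fun w => \prod_(i in D) phi (E (h i)) w) =
  \prod_u mean P (fun w => phi (E u) w ^+ #|[pred i in D | h i == u]|).
Proof.
move=> fE dE.
have eU : forall w, \prod_(i in D) phi (E (h i)) w =
    \prod_(u < #|U|) phi (E (enum_val u)) w ^+ #|[pred i in D | h i == enum_val u]|.
  move=> w; rewrite (partition_big h predT)//=.
  rewrite (reindex (@enum_val _ (mem U)))/=; last exact/onW_bij/enum_val_bij.
  by apply: eq_bigr => u _; rewrite -prodr_const; apply: eq_big => i //= /andP[_ /eqP ->].
under eq_fun do rewrite eU.
rewrite (mean_prod_indep (X := fun u => phi (E (enum_val u)))).
- by rewrite [RHS](reindex (@enum_val _ (mem U)))//; exact/onW_bij/enum_val_bij.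
- apply: (crm_indep crm) => // u v uv; apply: dE.
  by apply: contra uv => /eqP/enum_val_inj ->.
- by move=> u; exact: phi_moments.
Qed.

End random_measure.

(** * Diagonal measures as limits along refining partitions *)

(** [nu_pow] integrates functions of sections whose measurability is not established, so
    monotonicity is taken from the definition of the integral as a supremum over simple
    functions. *)
Lemma ge0_le_integral_nomeas {d : measure_display} {T : measurableType d} {R : realType}
  (mu : {measure set T -> \bar R}) (f g : T -> \bar R) :
  (forall x, (0 <= f x)%E) -> (forall x, (f x <= g x)%E) ->
  (\int[mu]_x f x <= \int[mu]_x g x)%E.
Proof.
move=> f0 fg; have g0 x : (0 <= g x)%E by rewrite (le_trans (f0 x)).
rewrite !ge0_integralTE//; apply: le_ereal_sup => _ [h hf <-].
by exists h => // x; rewrite (le_trans (hf x)).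
Qed.

Section power.
Context {R : realType} {d : measure_display} {Z : measurableType d}
  {d' : measure_display} {Omega : measurableType d'}.
Variables (nu : {measure set Z -> \bar R}) (P : probability Omega R).
Variable phi : set Z -> Omega -> R.
Hypothesis crm : is_crm nu P phi.
Hypothesis good : good_crm nu P phi.

Local Notation fin := (fin_sets nu).

Lemma nu_pow_ge0 n (C : set (n.-tuple Z)) : (0 <= nu_pow nu C)%E.
Proof.
elim: n C => [C|n IH C] /=; first by rewrite diracE lee_fin.
by apply: integral_ge0 => z _; exact: IH.
Qed.

Lemma nu_pow_le n (C C' : set (n.-tuple Z)) : C `<=` C' -> (nu_pow nu C <= nu_pow nu C')%E.
Proof.
elim: n C C' => [C C' CC|n IH C C' CC] /=.
  rewrite !diracE lee_fin ler_nat; case: (boolP (_ \in C)) => // /set_mem /CC /mem_set -> //.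
apply: ge0_le_integral_nomeas => z; first exact: nu_pow_ge0.
by apply: IH => t /= /CC.
Qed.

Lemma measurable_rect n (A : 'I_n -> set Z) : (forall i, measurable (A i)) ->
  measurable (rect A).
Proof.
move=> mA; have -> : rect A = \bigcap_(i in [set: 'I_n]) (@tnth n Z ^~ i @^-1` A i).
  by apply/seteqP; split => [z h i _|z h i]; exact: h.
apply: fin_bigcap_measurable => // i _.
by rewrite -[_ @^-1` _]setTI; apply: measurable_tnth.
Qed.

Lemma nu_prod_fin n (A : 'I_n -> set Z) : (forall i, fin (A i)) ->
  (\prod_(i < n) nu (A i) < +oo)%E.
Proof.
move=> fA; rewrite -ge0_fin_numE; last by apply: prode_ge0 => i _.
apply: (big_ind (fun x => x \is a fin_num)) => //.
  by move=> x y; exact: fin_numM.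
by move=> i _; case: (fA i) => ? ?; rewrite ge0_fin_numE.
Qed.

(** A class stable under measurable subsets on which [nu_pow] is finite by comparison with a box;
    every set to which [power] is applied in the proof belongs to it. *)
Definition bounded_sets n : set (set (n.-tuple Z)) :=
  [set C | measurable C /\ exists A, (forall i, fin (A i)) /\ C `<=` rect A].

Lemma bounded_fin n (C : set (n.-tuple Z)) : bounded_sets C -> fin_setsn nu C.
Proof.
move=> [mC [A [fA CA]]]; split => //; apply: (le_lt_trans (nu_pow_le CA)).
by rewrite nu_pow_rect ?nu_prod_fin// => i; case: (fA i).
Qed.

Lemma bounded_rect n (A : 'I_n -> set Z) : (forall i, fin (A i)) -> bounded_sets (rect A).
Proof.
move=> fA; split; last by exists A; split.
by apply: measurable_rect => i; case: (fA i).
Qed.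

Lemma bounded_sub n (C C' : set (n.-tuple Z)) : bounded_sets C -> measurable C' ->
  C' `<=` C -> bounded_sets C'.
Proof. by move=> [_ [A [fA CA]]] mC' CC; split => //; exists A; split => // z /CC/CA. Qed.

Lemma bounded_set0 n : bounded_sets (set0 : set (n.-tuple Z)).
Proof. by split => //; exists (fun=> set0); split => // i; exact: fin_sets0. Qed.

Lemma powerP n : (2 <= n)%N -> is_power nu P phi (@power R d Z d' Omega nu P phi n).
Proof.
move=> n2; have [ex _] := good n2; case: n n2 ex => [|[|n]]// _.
exact: xgetPex.
Qed.

Lemma rect_set0 n (A : 'I_n -> set Z) i : A i = set0 -> rect A = set0.
Proof. by move=> A0; apply/seteqP; split => // z /(_ i); rewrite A0. Qed.

Lemma power1_fin (C : set (1.-tuple Z)) : bounded_sets C -> fin [set z | C [tuple z]].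
Proof.
move=> [mC [A [fA CA]]]; apply: (fin_sets_sub (fA ord0)).
  rewrite (_ : [set z | _] = (fun z => [tuple z]) @^-1` C)//.
  rewrite -[_ @^-1` _]setTI; suff : measurable_fun setT (fun z : Z => [tuple z]) by exact.
  apply/measurable_fun_tnthP => i; rewrite (ord1 i).
  by rewrite (_ : _ \o _ = id)//; apply/funext.
by move=> z /= /CA /(_ ord0).
Qed.

Lemma power_integrable n (C : set (n.-tuple Z)) : (0 < n)%N -> bounded_sets C ->
  P.-integrable setT (EFin \o power nu P phi C).
Proof.
case: n C => [|[|n]]// C _ bC.
  by apply: has_moments_integrable; apply: (phi_moments crm); exact: power1_fin.
apply/Lfun1_integrable; apply: Lfun_subset12 => //.
  by rewrite fin_num_measure.
by apply: power_L2; [exact: powerP|exact: bounded_fin].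
Qed.

Lemma power_measurable n (C : set (n.-tuple Z)) : (0 < n)%N -> bounded_sets C ->
  measurable_fun setT (power nu P phi C).
Proof. by move=> n0 bC; have /measurable_int/measurable_EFinP := power_integrable n0 bC. Qed.

Lemma power_rectE n (A : 'I_n -> set Z) : (0 < n)%N -> (forall i, fin (A i)) ->
  {ae P, forall w, power nu P phi (rect A) w = \prod_(i < n) phi (A i) w}.
Proof.
case: n A => [|[|n]]// A _ fA; last exact: (power_rect (powerP _)).
apply: aeW => w; rewrite big_ord1 /=; congr (phi _ w).
by apply/seteqP; split => z /=; [move=> /(_ ord0)|move=> zA i; rewrite (ord1 i)].
Qed.

Lemma power_set0 n : (0 < n)%N ->
  {ae P, forall w, power nu P phi (set0 : set (n.-tuple Z)) w = 0}.
Proof.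
move=> n0; have := power_rectE n0 (fun=> fin_sets0 nu); rewrite (rect_set0 (i := Ordinal n0))//.
apply: filterS2 (phi_set0 crm) => w h ->.
by rewrite (bigD1 (Ordinal n0))//= h mul0r.
Qed.

Lemma cvg0_eventually_cst (u : nat -> \bar R) (c : \bar R) (N : nat) :
  (forall k, (N <= k)%N -> u k = c) -> (u @ \oo --> 0)%E -> c = 0%E.
Proof.
move=> uc u0; have : u @ \oo --> c.
  by apply: cvg_near_cst; exists N => // k /= /uc.
by move=> /cvg_lim <-//; exact: cvg_lim.
Qed.

(** This is sigma-additivity along the sequence [C], [C'], empty, empty, and so on: the [L^1] errors
    are constant from rank 2 on and tend to 0, hence vanish. *)
Lemma powerU n (C C' : set (n.-tuple Z)) : (0 < n)%N -> bounded_sets (C `|` C') ->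
  measurable C -> measurable C' -> C `&` C' = set0 ->
  {ae P, forall w, power nu P phi (C `|` C') w =
     power nu P phi C w + power nu P phi C' w}.
Proof.
move=> n0 bU mC mC' CC'.
have bC : bounded_sets C := bounded_sub bU mC (@subsetUl _ _ _).
have bC' : bounded_sets C' := bounded_sub bU mC' (@subsetUr _ _ _).
have [n2|n1] := leqP 2 n; last first.
  have {n1} e1 : n = 1%N by apply/eqP; rewrite eqn_leq n0 -ltnS n1.
  subst n; rewrite /= (_ : [set z | _] = [set z | C [tuple z]] `|` [set z | C' [tuple z]])//.
  apply: (phiU crm); [exact: power1_fin|exact: power1_fin|].
  by apply/seteqP; split => // z [zC zC']; have : (C `&` C') [tuple z] by []; rewrite CC'.
pose F j : set (n.-tuple Z) := if j is 0 then C else if j is 1 then C' else set0.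
have FU : \bigcup_j F j = C `|` C'.
  apply/seteqP; split => [z [[|[|j]] _]|z [zC|zC']] //=; [by left|by right|by exists 0%N|by exists 1%N].
have tF : trivIset setT F.
  apply/trivIsetP => -[|[|i]] [|[|j]] _ _ //= _; rewrite ?set0I ?setI0//.
  by rewrite setIC.
have bF j : bounded_sets (F j).
  by case: j => [|[|j]] //=; exact: bounded_set0.
have := power_sigma (powerP n2) (fun j => bounded_fin (bF j)) tF.
rewrite FU => /(_ (bounded_fin bU)).
pose D w := power nu P phi (C `|` C') w - (power nu P phi C w + power nu P phi C' w).
have mD : measurable_fun setT D.
  apply: measurable_funB; first exact: power_measurable.
  by apply: measurable_funD; exact: power_measurable.
move/(@cvg0_eventually_cst _ ('E_P[fun w => `|D w|%R])%E 2%N) => H.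
suff : {ae P, forall w, D w = 0}.
  by apply: filterS => w /eqP; rewrite subr_eq0 => /eqP.
apply: ae_eq0_expectation => //; apply: H => -[|[|k]]// _.
apply: expectation_ae_eq.
- apply: measurableT_comp => //; apply: measurable_funB; first exact: power_measurable.
  by apply: measurable_sum => j; exact: power_measurable.
- exact: measurableT_comp.
- apply: filterS (power_set0 n0) => w h.
  rewrite /D !big_ord_recl/= big1 ?addr0//.
Qed.

Definition mean_power n (C : set (n.-tuple Z)) : R := mean P (power nu P phi C).

Lemma mean_powerU n (C C' : set (n.-tuple Z)) : (0 < n)%N -> bounded_sets (C `|` C') ->
  measurable C -> measurable C' -> C `&` C' = set0 ->
  mean_power (C `|` C') = mean_power C + mean_power C'.
Proof.
move=> n0 bU mC mC' CC'.
have bC : bounded_sets C := bounded_sub bU mC (@subsetUl _ _ _).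
have bC' : bounded_sets C' := bounded_sub bU mC' (@subsetUr _ _ _).
rewrite /mean_power -meanD_int; [|exact: power_integrable..].
apply: mean_ae_eq; last exact: powerU.
  exact: power_measurable.
by apply: measurable_funD; exact: power_measurable.
Qed.

Lemma mean_power_set0 n : (0 < n)%N -> mean_power (set0 : set (n.-tuple Z)) = 0.
Proof.
move=> n0; rewrite -[RHS](mean_cst P 0); apply: mean_ae_eq => //.
  by apply: power_measurable => //; exact: bounded_set0.
exact: power_set0.
Qed.

Lemma mean_power_rect n (A : 'I_n -> set Z) : (0 < n)%N -> (forall i, fin (A i)) ->
  mean_power (rect A) = mean P (fun w => \prod_(i < n) phi (A i) w).
Proof.
move=> n0 fA; apply: mean_ae_eq; last exact: power_rectE.
  by apply: power_measurable => //; exact: bounded_rect.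
by apply: measurable_prod => i _; exact: (phi_measurable crm).
Qed.

Lemma mean_power_bigcup n (I : choiceType) (s : seq I) (B : I -> set (n.-tuple Z))
    (C : set (n.-tuple Z)) : (0 < n)%N ->
  bounded_sets C -> (forall i, measurable (B i)) ->
  pairwise (fun i j => `[< B i `&` B j = set0 >]) s ->
  mean_power (C `&` \big[setU/set0]_(i <- s) B i) = \sum_(i <- s) mean_power (C `&` B i).
Proof.
move=> n0 bC mB; have mC : measurable C by case: bC.
elim: s => [_|i s IH /= /andP[iall ps]].
  by rewrite !big_nil setI0 mean_power_set0.
have mU : measurable (\big[setU/set0]_(i <- s) B i) by apply: bigsetU_measurable.
rewrite !big_cons setIUr mean_powerU ?IH//.
- by apply: (bounded_sub bC); [apply: measurableU; exact: measurableI|rewrite subUset; split; exact: subIsetl].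
- exact: measurableI.
- exact: measurableI.
- apply/seteqP; split => // x [[_ xi] [_]].
  rewrite -bigcup_seq => -[j /= js xj].
  have /asboolP e := allP iall _ js.
  by have : (B i `&` B j) x by []; rewrite e.
Qed.

(** Continuity from above, by sigma-additivity on the splitting of [C 0] into the intersection and
    the successive differences: the error in mean after [k + 1] terms is [mean_power (C k)] minus
    the mean of the intersection. *)
Lemma mean_power_decr n (C : nat -> set (n.-tuple Z)) : (2 <= n)%N ->
  bounded_sets (C 0%N) -> (forall k, measurable (C k)) -> (forall k, C k.+1 `<=` C k) ->
  mean_power (C k) @[k --> \oo] --> mean_power (\bigcap_k C k).
Proof.
move=> n2 b0 mC dC; have n0 : (0 < n)%N by exact: leq_trans n2.
have dCle k l : (k <= l)%N -> C l `<=` C k.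
  move=> /subnK <-; elim: (l - k)%N => [|m IH]; first by rewrite add0n.
  by move=> x; rewrite addSn => /dC; exact: IH.
have mI : measurable (\bigcap_k C k) by exact: bigcap_measurable.
(* The limit set comes first, so that it belongs to every nonempty partial sum. *)
pose F j := if j is k.+1 then C k `\` C k.+1 else \bigcap_k C k.
have FC j : F j `<=` C 0%N.
  by case: j => [|j] x /=; [move=> /(_ 0%N); exact|move=> [xj _]; exact: (dCle 0%N j)].
have mF j : measurable (F j) by case: j => [|j] //=; exact: measurableD.
have bF j : bounded_sets (F j) := bounded_sub b0 (mF j) (FC j).
have bC k : bounded_sets (C k) := bounded_sub b0 (mC k) (dCle 0%N k (leq0n k)).
have FU : \bigcup_j F j = C 0%N.
  apply/seteqP; split => [x [j _ /FC]//|x x0].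
  have [xI|] := pselect ((\bigcap_k C k) x); first by exists 0%N.
  move=> /existsNP[k /not_implyP[_ xk]].
  have : exists k, ~~ `[< C k x >] by exists k; exact/asboolPn.
  case/ex_minnP => -[/asboolPn//|m /asboolPn xm mmin].
  exists m.+1 => //=; split => //; apply/asboolP/negPn/negP => /mmin.
  by rewrite ltnn.
have tF : trivIset setT F.
  apply/trivIsetP => i j _ _.
  wlog ij : i j / (i < j)%N.
    move=> h; rewrite neq_ltn => /orP[ij|ji]; first by rewrite h// ltn_eqF.
    by rewrite setIC h// ltn_eqF.
  move=> _; case: i ij => [|i]; case: j => [|j]//=.
    by move=> _; apply/seteqP; split => // x [/(_ j.+1 I) xj [_]].
  rewrite ltnS => ij; apply/seteqP; split => // x [[_ xi] [xj _]].
  by apply: xi; exact: (dCle i.+1 j).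
have := power_sigma (powerP n2) (fun j => bounded_fin (bF j)) tF.
rewrite FU => /(_ (bounded_fin b0)) S.
have E k : mean_power (C 0%N) = mean_power (C k) + \sum_(j < k) mean_power (F j.+1).
  elim: k => [|k IH]; first by rewrite big_ord0 addr0.
  rewrite IH big_ord_recr/= addrCA addrC; congr (_ + _).
  rewrite -mean_powerU ?setDUK//; first exact: (mF k.+1).
  by apply/seteqP; split => // x [xk [_]].
have {}S : mean P (fun w => `|power nu P phi (C 0%N) w - \sum_(j < k) power nu P phi (F j) w|)
    @[k --> \oo] --> (0 : R) by exact: fine_cvg.
apply/cvgrPdist_le => e e0.
have [N _ NS] := (cvgrPdist_le _ _).1 S e e0; exists N => // k /= Nk.
have := NS k.+1 (leq_trans Nk (leqnSn k)); rewrite /= sub0r normrN => h.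
apply: le_trans h; rewrite -/(mean _ _).
have iX j : P.-integrable setT (EFin \o power nu P phi (F j)) by exact: power_integrable.
have iD : P.-integrable setT (EFin \o (fun w => power nu P phi (C 0%N) w -
    \sum_(j < k.+1) power nu P phi (F j) w)).
  by apply: integrable_EFinB; [exact: power_integrable|exact: integrable_EFin_sum].
rewrite (le_trans _ (ler_norm _))// [X in `|X| <= _](_ : _ = - mean P (fun w => power nu P phi (C 0%N) w -
    \sum_(j < k.+1) power nu P phi (F j) w)); last first.
  rewrite meanE RintegralB//; last 2 first.
  - exact: power_integrable.
  - exact: integrable_EFin_sum.
  rewrite -!meanE mean_sum_int// -/(mean_power _) (E k) big_ord_recl/= /mean_power.
  by ring.
by rewrite normrN !meanE (le_trans (le_normr_Rintegral _ iD))// ler_norm.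
Qed.

End power.

(** * Partitions generated by a separating sequence *)

Section atoms.
Context {R : realType} {d : measure_display} {Z : measurableType d}.
Variables (nu : {measure set Z -> \bar R}).
Variable U : nat -> set Z.
Hypothesis mU : forall k, measurable (U k).
Hypothesis sepU : forall x y, (forall k, U k x <-> U k y) -> x = y.
Hypothesis nat_nu : nonatomic measurable nu.

Local Notation fin := (fin_sets nu).

(* The lists of length [N] index a partition of [Z] into measurable, possibly empty, sets,
   which is refined as [N] grows. *)
Definition bit_atom (s : seq bool) : set Z :=
  [set x | forall k, (k < size s)%N -> (U k x <-> nth false s k)].

Lemma bit_atom_measurable s : measurable (bit_atom s).
Proof.
have -> : bit_atom s = \bigcap_(k in [set k | (k < size s)%N])
    (if nth false s k then U k else ~` U k).
  apply/seteqP; split => x h k /= ks; move: (h k ks); case: (nth false s k) => /=.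
  - by move=> [_]; exact.
  - by move=> [h1 _] /h1.
  - by move=> Ux; split.
  - by move=> nUx; split.
apply: bigcap_measurableType.
by move=> k _; case: ifP => // _; exact: measurableC.
Qed.

Lemma bit_atom_disjoint s t : size s = size t -> s != t -> bit_atom s `&` bit_atom t = set0.
Proof.
move=> st /eqP nst; apply/seteqP; split => // x [xs xt]; apply: nst.
apply: (eq_from_nth (x0 := false)) => // k ks.
have h1 := xs k ks; rewrite st in ks; have h2 := xt k ks.
by apply/idP/idP => [/h1/h2|/h2/h1].
Qed.

Lemma bit_atom_take s m : bit_atom s `<=` bit_atom (take m s).
Proof.
move=> x xs k; rewrite size_take_min leq_min => /andP[km ks].
by rewrite nth_take//; exact: xs.
Qed.

Lemma bit_atom_cover N x : exists s : N.-tuple bool, bit_atom s x.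
Proof.
exists [tuple of mkseq (fun k => `[< U k x >]) N] => k /=; rewrite size_mkseq => kN.
by rewrite nth_mkseq//; split => [/asboolP|/asboolP].
Qed.

Lemma bigsetU_bit_atom N : \big[setU/set0]_(s : N.-tuple bool) bit_atom s = setT.
Proof.
apply/seteqP; split => // x _; have [s xs] := bit_atom_cover N x.
by rewrite -bigcup_seq; exists s => //=; rewrite mem_index_enum.
Qed.

(* Otherwise Koenig's lemma yields a decreasing sequence of sets [A `&` bit_atom s] of
   measure above [e], whose intersection is a point of positive mass. *)
Lemma nonatomic_small A (e : R) : fin A -> 0 < e -> exists N0, forall N, (N0 <= N)%N ->
  forall s, size s = N -> fine (nu (A `&` bit_atom s)) <= e.
Proof.
move=> fA e0; apply: contrapT => /forallNP H.
have [mA nuA] := fA.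
have mAs s : measurable (A `&` bit_atom s).
  by apply: measurableI => //; exact: bit_atom_measurable.
have fAs s : nu (A `&` bit_atom s) \is a fin_num.
  by have [_ h] := fin_setsI fA (bit_atom_measurable s); rewrite ge0_fin_numE.
pose bad s := e < fine (nu (A `&` bit_atom s)).
have bad_take s m : bad s -> bad (take m s).
  rewrite /bad => /lt_le_trans; apply; apply: fine_le => //.
  by rewrite le_measure ?inE//; apply: setIS; exact: bit_atom_take.
(* A word is kept if it has bad extensions by words of every length, which is a property that passes
   to one of the two longer words. *)
pose tall s := forall m, exists2 t, size t = m & bad (s ++ t).
have tall0 : tall [::].
  move=> m; have /existsNP[N /not_implyP[mN /existsNP[s /not_implyP[sN /negP]]]] := H m.
  rewrite -ltNge => bs; exists (take m s); first by rewrite size_take_min sN; exact/minn_idPl.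
  exact: bad_take.
have tallS s : tall s -> exists b, tall (rcons s b).
  move=> ts; apply: contrapT => /forallNP nt.
  have /existsNP[m1 /forall2NP h1] := nt true.
  have /existsNP[m2 /forall2NP h2] := nt false.
  (* If both letters failed, at the lengths [m1] and [m2], a bad extension of length one more than
     their maximum would still begin with one of the letters, and truncating what follows it
     contradicts that failure. *)
  have [[|b t]// [tm] bt] := ts (maxn m1 m2).+1.
  have key m : (m <= size t)%N -> bad (rcons s b ++ take m t).
    move=> mt; have := bad_take _ (size s + m.+1)%N bt.
    by rewrite take_cat ltnNge leq_addr/= addKn /= -cat_rcons.
  case: b bt key => bt key.
    have [] := h1 (take m1 t); first by apply; rewrite size_takel// tm leq_maxl.
    by apply; apply: key; rewrite tm leq_maxl.
  have [] := h2 (take m2 t); first by apply; rewrite size_takel// tm leq_maxr.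
  by apply; apply: key; rewrite tm leq_maxr.
have /choice[nxt nxtP] : forall s, exists b, tall s -> tall (rcons s b).
  by move=> s; have [/tallS[b tb]|ns] := pselect (tall s); [exists b|exists true].
pose path := fix path k := if k is k'.+1 then rcons (path k') (nxt (path k')) else [::].
have pathT k : tall (path k) by elim: k => [//|k IH] /=; exact: nxtP.
have pathS k : size (path k) = k by elim: k => [//|k IH] /=; rewrite size_rcons IH.
have pathB k : bad (path k).
  by have [t /size0nil -> ] := pathT k 0%N; rewrite cats0.
pose F k := A `&` bit_atom (path k).
have dF : nonincreasing_seq F.
  apply/nonincreasing_seqP => k; apply/subsetPset; apply: setIS => x xk.
  have := @bit_atom_take (path k.+1) k x xk.
  by rewrite /= -cats1 takel_cat ?pathS// take_oversize ?pathS.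
have mI : measurable (\bigcap_k F k) by apply: bigcap_measurableType => k _; exact: mAs.
have cvF := nonincreasing_cvg_mu (mu := nu) (F := F) _ (fun k => mAs (path k)) mI dF.
have finI0 : (nu (F 0%N) < +oo)%E by have [_] := fin_setsI fA (bit_atom_measurable (path 0%N)).
have I0 : nu (\bigcap_k F k) <> 0%E.
  move=> h; have h0 : fine (nu (F k)) @[k --> \oo] --> (0 : R).
    by have := cvF finI0; rewrite h; exact: fine_cvg.
  have [N _ /(_ N (leqnn N))] := (cvgrPdist_lt _ _).1 h0 e e0.
  rewrite /= sub0r normrN ger0_norm ?fine_ge0// => /lt_trans/(_ (pathB N)).
  by rewrite ltxx.
(* Two points of the intersection agree on every [U k], so it has at most one point, and a nonempty
   subset of it is all of it. *)
have [B [mB BI B0 BE]] := nat_nu mI I0.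
have [[x Bx]|/forallNP nB] := pselect (exists x, B x); last first.
  by apply: B0; rewrite (_ : B = set0) ?measure0//; apply/seteqP; split => // x /nB.
apply: BE; congr (nu _); apply/seteqP; split => // y Iy.
have -> // : y = x.
apply: sepU => k; have [_ yk] := Iy k.+1 I; have [_ xk] := BI _ Bx k.+1 I.
have kk : (k < size (path k.+1))%N by rewrite pathS.
by have h1 := yk k kk; have h2 := xk k kk; rewrite h1 h2.
Qed.

End atoms.

Section inequalities.
Context {R : realDomainType}.

(** Each factor is at most the largest one, whose power is one of the terms on the right. *)
Lemma prodr_norm_le_sum (I : eqType) (x : I -> R) (r : seq I) : (0 < size r)%N ->
  \prod_(i <- r) `|x i| <= \sum_(i <- r) `|x i| ^+ size r.
Proof.
move=> r0; have [j jr jmax] : exists2 j, j \in r & forall i, i \in r -> `|x i| <= `|x j|.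
  elim: r r0 => [//|a [|b r] IH] _.
    by exists a; rewrite ?inE// => i; rewrite inE => /eqP ->.
  have [j jr jmax] := IH isT.
  have [aj|/ltW ja] := leP `|x a| `|x j|.
    exists j; first by rewrite inE jr orbT.
    by move=> i; rewrite inE => /predU1P[->//|/jmax].
  exists a; first by rewrite inE eqxx.
  by move=> i; rewrite inE => /predU1P[->//|/jmax/le_trans]; apply.
apply: (@le_trans _ _ (`|x j| ^+ size r)).
  elim: (r) jmax => [|a s IH] jmax.
    by rewrite big_nil.
  rewrite big_cons exprS ler_pM ?prodr_ge0//; first by apply: jmax; rewrite inE eqxx.
  by apply: IH => i si; apply: jmax; rewrite inE si orbT.
rewrite (big_rem j)//= lerDl; apply: sumr_ge0 => i _; exact: exprn_ge0.
Qed.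

(** Compare [|x|] with 1. Even powers carry no absolute value, so their means are moments of [phi]
    to which the limit over the atoms applies. *)
Lemma expr_le_sqr_double (x : R) n : (2 <= n)%N -> `|x| ^+ n <= x ^+ 2 + x ^+ n.*2.
Proof.
move=> n2; have x2 : x ^+ 2 = `|x| ^+ 2 by rewrite real_normK// num_real.
have -> : x ^+ n.*2 = `|x| ^+ n.*2 by rewrite -mul2n !exprM x2.
rewrite x2; have [x1|/ltW x1] := leP `|x| 1.
  by rewrite (@le_trans _ _ (`|x| ^+ 2))// ?lerDl ?exprn_ge0// ler_wiXn2l.
by rewrite (@le_trans _ _ (`|x| ^+ n.*2))// ?lerDr ?exprn_ge0// ler_weXn2l// -addnn leq_addr.
Qed.

End inequalities.

(** Bernoulli's inequality for every real [t]: below -1 the left side is at most 0 unless [m = 0],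
    and the right side is nonnegative because the exponent is even. *)
Lemma bernoulli_even {R : realFieldType} (t : R) m :
  1 + (m.*2)%:R * t <= (1 + t) ^+ m.*2.
Proof.
have [t1|t1] := leP (-1) t.
  elim: (m.*2) => [|k IH]; first by rewrite mul0r addr0 expr0.
  rewrite exprS (@le_trans _ _ ((1 + t) * (1 + k%:R * t)))//; last first.
    by rewrite ler_wpM2l//; lra.
  rewrite -natr1; have : 0 <= k%:R * t ^+ 2 by rewrite mulr_ge0 ?sqr_ge0.
  by move=> h; rewrite -subr_ge0; apply: le_trans h _; rewrite le_eqVlt; apply/orP; left; apply/eqP; ring.
case: m => [|m]; first by rewrite mul0r addr0 expr0.
apply: (@le_trans _ _ 0); last by rewrite -mul2n exprM exprn_ge0// sqr_ge0.
have : 1 <= (m.+1.*2)%:R :> R by rewrite ler1n doubleS.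
move: (_%:R) => a a1; nra.
Qed.

(** The graph of the even power lies above its tangent at [x]. For nonzero [x] this is Bernoulli's
    inequality at [y / x], scaled by the power of [x]. *)
Lemma expr_even_convex {R : realFieldType} (x y : R) m : (0 < m)%N ->
  x ^+ m.*2 + (m.*2)%:R * (x ^+ m.*2.-1 * y) <= (x + y) ^+ m.*2.
Proof.
move=> m0; have [->|x0] := eqVneq x 0.
  rewrite add0r; case: m m0 => // m _; rewrite doubleS /= !expr0n/= mul0r mulr0 addr0.
  by rewrite -doubleS -mul2n exprM exprn_ge0// sqr_ge0.
have := bernoulli_even (y / x) m; rewrite -(ler_pM2l (x := x ^+ m.*2)); last first.
  by rewrite -mul2n exprM exprn_gt0// lt_neqAle sqr_ge0 andbT eq_sym sqrf_eq0.
rewrite -exprMn mulrDr mulr1 (mulrDr x) mulr1 (mulrCA x) divff// mulr1.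
congr (_ <= _); congr (_ + _); case: m m0 => // m _; rewrite doubleS /=.
by rewrite exprS; field.
Qed.

(** * Means of diagonal measures as limits of sums over atoms *)

Section diagonal_limit.
Context {R : realType} {d : measure_display} {Z : measurableType d}
  {d' : measure_display} {Omega : measurableType d'}.
Variables (nu : {measure set Z -> \bar R}) (P : probability Omega R).
Variable phi : set Z -> Omega -> R.
Hypothesis crm : is_crm nu P phi.
Hypothesis good : good_crm nu P phi.
Variable U : nat -> set Z.
Hypothesis mU : forall k, measurable (U k).
Hypothesis sepU : forall x y, (forall k, U k x <-> U k y) -> x = y.
Hypothesis nat_nu : nonatomic measurable nu.

Local Notation fin := (fin_sets nu).
Local Notation atom := (bit_atom U).
Let matom s := bit_atom_measurable mU s.

Lemma mean_mul_disjoint A B p q : fin A -> fin B -> A `&` B = set0 ->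
  mean P (fun w => phi A w ^+ p * phi B w ^+ q) =
  mean P (fun w => phi A w ^+ p) * mean P (fun w => phi B w ^+ q).
Proof.
move=> fA fB AB.
pose E (i : 'I_2) := if i == ord0 then A else B.
pose r (i : 'I_2) := if i == ord0 then p else q.
have fE i : fin (E i) by rewrite /E; case: ifP.
have h : independent_RVs P (fun i => phi (E i)).
  apply: (crm_indep crm) => // i j; rewrite /E.
  by case: i => [[|[|?]]//= ?]; case: j => [[|[|?]]//= ?]//; rewrite setIC.
have := mean_prod_indep r h (fun i => phi_moments crm (fE i)).
by rewrite !big_ord_recl big_ord0 mulr1; under eq_fun do rewrite !big_ord_recl big_ord0 mulr1.
Qed.

(* [x^(2m)] is convex, and the first order term has mean [0] by independence. *)
Lemma moment_setD_le A S m : (0 < m)%N -> fin A -> measurable S ->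
  mean P (fun w => phi (A `\` S) w ^+ m.*2) <= mean P (fun w => phi A w ^+ m.*2).
Proof.
move=> m0 fA mS; have f1 := fin_setsD fA mS; have f2 := fin_setsI fA mS.
have m1 := phi_moments crm f1; have m2 := phi_moments crm f2.
have dis : (A `\` S) `&` (A `&` S) = set0 by apply/seteqP; split => // x [[_ nS] [_ xS]].
have ae := phiU crm f1 f2 dis.
have eA : (A `\` S) `|` (A `&` S) = A by rewrite -setDDr setDv setD0.
rewrite eA in ae.
rewrite [leRHS](@mean_ae_eq _ _ _ _ _ (fun w => (phi (A `\` S) w + phi (A `&` S) w) ^+ m.*2)); last first.
- by apply: filterS ae => w ->.
- by apply: measurable_funX; apply: measurable_funD; [case: m1|case: m2].
- by apply: measurable_funX; exact: (phi_measurable crm).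
rewrite (@le_trans _ _ (mean P (fun w => phi (A `\` S) w ^+ m.*2 + (m.*2)%:R *
   (phi (A `\` S) w ^+ m.*2.-1 * phi (A `&` S) w ^+ 1))))//.
  rewrite meanD ?meanZ; [|by do ? [exact: has_momentsX|apply: has_momentsZ|apply: has_momentsM] ..].
  by rewrite mean_mul_disjoint// [X in _ * (_ * X)](mean_phi crm f2) !mulr0 addr0.
apply: le_mean.
- by do ? [exact: has_momentsX|apply: has_momentsZ|apply: has_momentsM|apply: has_momentsD].
- by apply: has_momentsX; exact: has_momentsD.
- by move=> w; rewrite expr1; exact: expr_even_convex.
Qed.

(** Coordinates lying in a common atom at every length belong to the same [U k], hence are equal
    since the [U k] separate points. *)
Lemma diag_ptop_cap n (A : 'I_n -> set Z) : (0 < n)%N ->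
  \bigcap_N (rect A `&` \big[setU/set0]_(s : N.-tuple bool) rect (fun _ : 'I_n => atom s)) =
  rect A `&` diag (ptop n).
Proof.
move=> n0.
have sb i j : same_block (ptop n) i j.
  have tI : finset.trivIset (ptop n).
    by apply/finset.trivIsetP => B C; rewrite !inE => /eqP -> /eqP ->; rewrite eqxx.
  by rewrite /same_block (finset.def_pblock tI (B := [set: 'I_n]%SET)) ?inE.
apply/seteqP; split => z.
  move=> h; split; first by have [] := h 0%N I.
  move=> i j; split => // _; apply: sepU => k.
  (* Words of length [k + 1] are the first to decide membership in [U k]. *)
  have [_] := h k.+1 I; rewrite -bigcup_seq => -[s _ zs].
  have ks : (k < size s)%N by rewrite size_tuple.
  by have h1 := zs i k ks; have h2 := zs j k ks; rewrite h1 h2.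
move=> [zA dz] N _; split => //; rewrite -bigcup_seq.
have [s xs] := bit_atom_cover U N (tnth z (Ordinal n0)).
exists s => /=; first by rewrite mem_index_enum.
by move=> i; have -> // : tnth z i = tnth z (Ordinal n0) by apply/dz.
Qed.

Lemma mean_St_lim n (A : 'I_n -> set Z) : (0 < n)%N -> (forall i, fin (A i)) ->
  \sum_(s : N.-tuple bool) mean P (fun w => \prod_(i < n) phi (A i `&` atom s) w)
    @[N --> \oo] --> mean_St nu P phi (ptop n) (rect A).
Proof.
move=> n0 fA; have fAs i s : fin (A i `&` atom s) by apply: fin_setsI.
have mr N : forall s : N.-tuple bool, measurable (rect (fun _ : 'I_n => atom s)).
  by move=> s; exact: measurable_rect.
have mC N : measurable (rect A `&` \big[setU/set0]_(s : N.-tuple bool) rect (fun _ : 'I_n => atom s)).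
  apply: measurableI; first by apply: measurable_rect => i; case: (fA i).
  by apply: bigsetU_measurable => s _; exact: mr.
have bC N := bounded_sub (bounded_rect fA) (mC N) (@subIsetl _ _ _).
have rE N (s : N.-tuple bool) : rect A `&` rect (fun _ : 'I_n => atom s) = rect (fun i => A i `&` atom s).
  apply/seteqP; split => z; first by move=> [h1 h2] i; split.
  by move=> h; split => i; have [] := h i.
have [n2|n1] := leqP 2 n.
  rewrite -[X in _ --> X]/(mean_power nu P phi (rect A `&` diag (ptop n))) -diag_ptop_cap//.
  have E N : \sum_(s : N.-tuple bool) mean P (fun w => \prod_(i < n) phi (A i `&` atom s) w) =
    mean_power nu P phi (rect A `&` \big[setU/set0]_(s : N.-tuple bool) rect (fun _ : 'I_n => atom s)).
    rewrite (mean_power_bigcup crm good)//.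
    - by apply: eq_bigr => s _; rewrite rE (mean_power_rect crm good).
    - exact: bounded_rect.
    - have := index_enum_uniq (N.-tuple bool); rewrite uniq_pairwise.
      apply: sub_pairwise => s t /= st; apply/asboolP.
      apply/seteqP; split => // z [/(_ (Ordinal n0)) zs /(_ (Ordinal n0)) zt].
      have : (atom s `&` atom t) (tnth z (Ordinal n0)) by [].
      by rewrite bit_atom_disjoint// !size_tuple.
  under eq_fun do rewrite E.
  apply: (mean_power_decr crm good (C := fun N => rect A `&`
    \big[setU/set0]_(s : N.-tuple bool) rect (fun _ : 'I_n => atom s))) => // N; apply: setIS => z.
  rewrite -!bigcup_seq => -[s _ zs].
  have hs : size (take N s) == N by rewrite size_takel// size_tuple.
  exists (Tuple hs); first by rewrite /= mem_index_enum.
  by move=> i; apply: bit_atom_take; exact: zs.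
have e1 : n = 1%N by apply/eqP; rewrite eqn_leq n0 -ltnS n1.
have -> : mean_St nu P phi (ptop n) (rect A) = 0.
  have mD : measurable (rect A `&` diag (ptop n)).
    by rewrite -diag_ptop_cap//; apply: bigcap_measurableType => N _; exact: mC.
  have bD := bounded_sub (bounded_rect fA) mD (@subIsetl _ _ _).
  move: bD; rewrite /mean_St /St; move: (rect A `&` _) => C bC'.
  by subst n; apply: (mean_phi crm); exact: power1_fin.
have -> : (fun N => \sum_(s : N.-tuple bool) mean P (fun w => \prod_(i < n) phi (A i `&` atom s) w)) = fun=> 0.
  apply/funext => N; apply: big1 => s _; subst n.
  by under eq_fun do rewrite big_ord1; rewrite (mean_phi crm).
exact: cvg_cst.
Qed.

End diagonal_limit.

Lemma prodrD_subset {R : comRingType} (I : finType) (D : {set I}) (x y : I -> R) :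
  \prod_(i in D) (x i + y i) =
  \sum_(b : {set I} | b \subset D) (\prod_(i in b) x i) * \prod_(i in D :\: b) y i.
Proof.
(* Outside [D] the summands are replaced by 0 and 1, so that in the expansion over all subsets of
   [I] only those of [D] survive. *)
rewrite big_mkcond/= (eq_bigr (fun i => (if i \in D then x i else 0) + (if i \in D then y i else 1))); last first.
  by move=> i _; case: ifP; rewrite ?add0r.
rewrite bigA_distr/= [RHS]big_mkcond/=; apply: eq_bigr => b _.
case: ifPn => [bD|/subsetPn[i ib iD]]; last first.
  by rewrite (bigD1 i)//= ib (negbTE iD) mul0r.
rewrite (bigID (mem b))/=; congr (_ * _).
  by apply: eq_bigr => i ib; rewrite ib (fintype.subsetP bD).
rewrite big_mkcond [RHS]big_mkcond/=; apply: eq_bigr => i _.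
by rewrite inE; case: (i \in b).
Qed.

(** Replacing each [e N s] by [l] costs at most the uniform distance between them times the bound on
    the sum of the [|c N s|]. *)
Lemma cvg_sum_mul_near_cst {R : realType} (T : nat -> finType) (c : forall N, T N -> R)
    (e : forall N, T N -> R) (K l C : R) :
  \sum_(s : T N) c N s @[N --> \oo] --> K ->
  (forall N, \sum_(s : T N) `|c N s| <= C) ->
  (forall eps : R, 0 < eps -> exists N0, forall N, (N0 <= N)%N ->
    forall s : T N, `|e N s - l| <= eps) ->
  \sum_(s : T N) c N s * e N s @[N --> \oo] --> K * l.
Proof.
move=> cK cC el.
have C0 : 0 <= C by apply: le_trans (cC 0%N); exact: sumr_ge0.
have cKl : (\sum_(s : T N) c N s) * l @[N --> \oo] --> K * l.
  by apply: cvgM => //; exact: cvg_cst.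
have z : \sum_(s : T N) c N s * e N s - (\sum_(s : T N) c N s) * l @[N --> \oo] --> (0 : R).
  apply/cvgrPdist_le => eps eps0.
  (* [C] itself may be 0, hence the divisor [C + 1]. *)
  have C1 : 0 < C + 1 by rewrite ltr_wpDl.
  have [N0 hN0] := el _ (divr_gt0 eps0 C1).
  exists N0 => // N /= N0N; rewrite sub0r normrN.
  rewrite big_distrl/= -sumrB (le_trans (ler_norm_sum _ _ _))//.
  apply: (@le_trans _ _ (\sum_(s : T N) `|c N s| * (eps / (C + 1)))).
    by apply: ler_sum => s _; rewrite -mulrBr normrM ler_wpM2l// hN0.
  rewrite -big_distrl/= (@le_trans _ _ (C * (eps / (C + 1))))//.
    by rewrite ler_wpM2r// divr_ge0// ltW.
  by rewrite mulrA ler_pdivrMr// mulrC ler_wpM2l ?ltW//; lra.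
rewrite -[X in _ --> X]add0r.
rewrite (_ : (fun N => _) = (fun N => \sum_(s : T N) c N s * e N s - (\sum_(s : T N) c N s) * l +
  (\sum_(s : T N) c N s) * l)); first exact: cvgD.
by apply/funext => N /=; rewrite subrK.
Qed.

Section perturbation.
Context {R : realType} {d : measure_display} {Z : measurableType d}
  {d' : measure_display} {Omega : measurableType d'}.
Variables (nu : {measure set Z -> \bar R}) (P : probability Omega R).
Variable phi : set Z -> Omega -> R.
Hypothesis crm : is_crm nu P phi.
Hypothesis good : good_crm nu P phi.
Variable U : nat -> set Z.
Hypothesis mU : forall k, measurable (U k).
Hypothesis sepU : forall x y, (forall k, U k x <-> U k y) -> x = y.
Hypothesis nat_nu : nonatomic measurable nu.

Local Notation fin := (fin_sets nu).
Local Notation atom := (bit_atom U).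
Let matom s := bit_atom_measurable mU s.

(** A mixed product is dominated by the squares and the [2n]-th powers of its factors, and the sums
    over the atoms of the corresponding moments converge to means of diagonal measures. *)
Lemma sum_moment_bounded n (A : 'I_n -> set Z) : (0 < n)%N -> (forall i, fin (A i)) ->
  exists C : R, forall N, \sum_(s : N.-tuple bool)
    `|mean P (fun w => \prod_(i < n) phi (A i `&` atom s) w)| <= C.
Proof.
move=> n0 fA; have fAs i s : fin (A i `&` atom s) by apply: fin_setsI.
have mAs i s : has_moments P (phi (A i `&` atom s)) by exact: (phi_moments crm).
have [n2|n1] := leqP 2 n; last first.
  exists 0 => N; have e1 : n = 1%N by apply/eqP; rewrite eqn_leq n0 -ltnS n1.
  subst n; rewrite big1// => s _; under eq_fun do rewrite big_ord1.
  by rewrite (mean_phi crm)// normr0.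
(* The [r]-th moments of one set are the terms of [mean_St_lim] for [r] copies of that set, so their
   sums form a convergent sequence. *)
have even (i : 'I_n) r : (0 < r)%N -> exists C : R, forall N, \sum_(s : N.-tuple bool)
    mean P (fun w => phi (A i `&` atom s) w ^+ r) <= C.
  move=> r0; have := mean_St_lim crm good mU sepU r0 (fun _ : 'I_r => fA i).
  move=> /cvgP/cvg_seq_bounded [M [Mr HM]].
  (* [cvg_seq_bounded] bounds the sequence by every number strictly above [M]. *)
  exists (M + 1) => N.
  apply: (le_trans (ler_norm _)); have /= := HM (M + 1) _ N I.
  rewrite ltrDl ltr01 => /(_ isT); apply: le_trans.
  rewrite le_eqVlt; apply/orP; left; apply/eqP; congr (`| _ |).
  apply: eq_bigr => s _; congr mean; apply/funext => w.
  by rewrite prodr_const card_ord.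
have n2' : (0 < n.*2)%N by rewrite double_gt0.
have /choice[C1 hC1] : forall i : 'I_n, exists C : R, forall N, \sum_(s : N.-tuple bool)
    mean P (fun w => phi (A i `&` atom s) w ^+ 2) <= C by move=> i; exact: even.
have /choice[C2 hC2] : forall i : 'I_n, exists C : R, forall N, \sum_(s : N.-tuple bool)
    mean P (fun w => phi (A i `&` atom s) w ^+ n.*2) <= C by move=> i; exact: even.
exists (\sum_(i < n) (C1 i + C2 i)) => N.
apply: (@le_trans _ _ (\sum_(s : N.-tuple bool) \sum_(i < n)
   (mean P (fun w => phi (A i `&` atom s) w ^+ 2) +
    mean P (fun w => phi (A i `&` atom s) w ^+ n.*2)))); last first.
  rewrite exchange_big/=; apply: ler_sum => i _; rewrite big_split/=.
  by apply: lerD; [exact: hC1|exact: hC2].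
apply: ler_sum => s _.
have mp : has_moments P (fun w => \prod_(i < n) phi (A i `&` atom s) w) by exact: has_moments_prod.
rewrite (le_trans (le_norm_mean mp))//.
rewrite [leRHS](_ : _ = mean P (fun w => \sum_(i < n) (phi (A i `&` atom s) w ^+ 2 +
    phi (A i `&` atom s) w ^+ n.*2))); last first.
  rewrite mean_sum; last by move=> i _; apply: has_momentsD; exact: has_momentsX.
  by apply: eq_bigr => i _; rewrite meanD//; exact: has_momentsX.
apply: le_mean; first exact: has_moments_norm.
  by apply: has_moments_sum => i _; apply: has_momentsD; exact: has_momentsX.
move=> w; rewrite normr_prod.
have sn : size (index_enum 'I_n) = n by rewrite /index_enum -enumT size_enum_ord.
apply: (le_trans (prodr_norm_le_sum (fun i => phi (A i `&` atom s) w) _)); rewrite sn//.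
by apply: ler_sum => i _; exact: expr_le_sqr_double.
Qed.

(* The set differences are removed one factor at a time, each at the price of
   [mean_mul_le] with a second factor bounded in mean square uniformly in [s]. *)
Lemma prod_setD_near (I : eqType) (A : I -> set Z) (r q : seq I) (e : R) :
  (forall i, fin (A i)) -> 0 < e ->
  exists N0, forall N, (N0 <= N)%N -> forall s, size s = N ->
    `|mean P (fun w => (\prod_(i <- q) phi (A i) w) * \prod_(i <- r) phi (A i `\` atom s) w) -
      mean P (fun w => (\prod_(i <- q) phi (A i) w) * \prod_(i <- r) phi (A i) w)| <= e.
Proof.
move=> fA; have mA i : has_moments P (phi (A i)) by exact: (phi_moments crm).
have fAs i s : fin (A i `&` atom s) by apply: fin_setsI.
have mAs i s : has_moments P (phi (A i `&` atom s)) by exact: (phi_moments crm).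
have fAD i s : fin (A i `\` atom s) by apply: fin_setsD.
have mAD i s : has_moments P (phi (A i `\` atom s)) by exact: (phi_moments crm).
elim: r q e => [|i r IH] q e e0.
  exists 0%N => N _ s _; under eq_fun do rewrite big_nil.
  by under [X in _ - mean P X]eq_fun do rewrite big_nil; rewrite subrr normr0 ltW.
(* The factor [i] is restored to its whole set and joins the untouched factors; the remaining error
   is the term in which it is replaced by its part inside the atom. *)
have [N1 hN1] := IH (rcons q i) (e / 2) (divr_gt0 e0 (ltr0n _ 2)).
pose W s w := (\prod_(j <- q) phi (A j) w) * \prod_(j <- r) phi (A j `\` atom s) w.
have mW s : has_moments P (W s) by apply: has_momentsM; apply: has_moments_prod.
have [C hC] : exists C : R, forall s, mean P (fun w => W s w ^+ 2) <= C.
  pose m := (size q + size r)%N.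
  (* [W s ^ 2] is a product of [m] squares, hence at most the sum of the [2m]-th powers;
     [moment_setD_le] makes the bound independent of [s], and the added 1 covers the empty
     product. *)
  exists (\sum_(j <- q ++ r) mean P (fun w => phi (A j) w ^+ m.*2) + 1) => s.
  pose y w (j : I * bool) := phi (if j.2 then A j.1 else A j.1 `\` atom s) w.
  pose l := [seq (j, true) | j <- q] ++ [seq (j, false) | j <- r].
  have sl : size l = m by rewrite size_cat !size_map.
  have WE w : W s w = \prod_(j <- l) y w j.
    by rewrite /W big_cat !big_map.
  have my j : has_moments P (y^~ j) by rewrite /y; case: (j.2).
  apply: (@le_trans _ _ (mean P (fun w => \sum_(j <- l) y w j ^+ m.*2 + 1))).
    apply: le_mean; first exact: has_momentsX.
      by apply: has_momentsD; [apply: has_moments_sum => j _; exact: has_momentsX|exact: has_moments_cst].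
    move=> w; rewrite WE -(real_normK (num_real _)) normr_prod.
    have [l0|l0] := posnP (size l).
      by rewrite (size0nil l0) !big_nil expr1n add0r.
    apply: (@le_trans _ _ (\sum_(j <- l) y w j ^+ m.*2)); last by rewrite lerDl.
    have := prodr_norm_le_sum (fun j => y w j ^+ 2) l0; rewrite sl.
    under eq_bigr do rewrite normrX; rewrite prodrXl => /le_trans; apply.
    apply: ler_sum => j _; rewrite -normrX -exprM mul2n ger0_norm//.
    by rewrite -mul2n exprM exprn_ge0// sqr_ge0.
  rewrite meanD; [|by apply: has_moments_sum => j _; exact: has_momentsX|exact: has_moments_cst].
  rewrite mean_cst mean_sum; last by move=> j _; exact: has_momentsX.
  rewrite lerD2r /l !big_cat/= !big_map /y/= lerD2l.
  case: (posnP m) => [m0|m0].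
    have /size0nil -> : size r = 0%N by move/eqP: m0; rewrite addn_eq0 => /andP[_ /eqP].
    by rewrite !big_nil.
  by apply: ler_sum => j _; exact: (moment_setD_le crm).
have C0 : 0 <= C by apply: le_trans (hC [::]); apply: mean_ge0 => w; exact: sqr_ge0.
(* With this [t] the second term of [mean_mul_le] is at most [e / 2]; the atoms are then taken so
   small that the first one, a measure divided by [t], is at most [e / 2] too. *)
pose t := e / 2 / (C + 1).
have C1 : 0 < C + 1 by rewrite ltr_wpDl.
have t0 : 0 < t by rewrite !divr_gt0.
have [N2 hN2] := nonatomic_small mU sepU nat_nu (fA i) (mulr_gt0 (divr_gt0 e0 (ltr0n _ 2)) t0).
exists (maxn N1 N2) => N; rewrite geq_max => /andP[N1N N2N] s sN.
have dis : (A i `\` atom s) `&` (A i `&` atom s) = set0.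
  by apply/seteqP; split => // x [[_ ns] [_ xs]].
have eA : (A i `\` atom s) `|` (A i `&` atom s) = A i by rewrite -setDDr setDv setD0.
have ae := phiU crm (fAD i s) (fAs i s) dis; rewrite eA in ae.
have {}hN1 := hN1 N N1N s sN.
have e1 : mean P (fun w => (\prod_(j <- q) phi (A j) w) * \prod_(j <- i :: r) phi (A j `\` atom s) w) =
   mean P (fun w => phi (A i) w * W s w) - mean P (fun w => phi (A i `&` atom s) w * W s w).
  rewrite -meanB; [|exact: has_momentsM..].
  apply: mean_ae_eq.
  - apply: has_moments_measurable; apply: has_momentsM; exact: has_moments_prod.
  - by apply: has_moments_measurable; apply: has_momentsB; exact: has_momentsM.
  - apply: filterS ae => w ->; rewrite big_cons /W; ring.
have e2 : mean P (fun w => (\prod_(j <- rcons q i) phi (A j) w) * \prod_(j <- r) phi (A j `\` atom s) w) =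
   mean P (fun w => phi (A i) w * W s w).
  congr mean; apply/funext => w; rewrite big_rcons/= /W; ring.
have e3 : mean P (fun w => (\prod_(j <- rcons q i) phi (A j) w) * \prod_(j <- r) phi (A j) w) =
   mean P (fun w => (\prod_(j <- q) phi (A j) w) * \prod_(j <- i :: r) phi (A j) w).
  congr mean; apply/funext => w; rewrite big_rcons/= big_cons; ring.
rewrite e2 e3 in hN1; rewrite e1 addrAC.
apply: (le_trans (ler_normB _ _)); rewrite [leRHS]splitr lerD//.
apply: (le_trans (mean_mul_le t0 (mAs i s) (mW s))).
rewrite (mean_phi2 crm)// ler_pdivrMr// divfK//.
have h1 : fine (nu (A i `&` atom s)) / t <= e / 2.
  by rewrite ler_pdivrMr// (hN2 N).
have h2 : t * mean P (fun w => W s w ^+ 2) <= e / 2.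
  apply: (@le_trans _ _ (t * C)); first by rewrite ler_wpM2l ?(ltW t0).
  by rewrite /t mulrAC ler_pdivrMr// ler_wpM2l ?divr_ge0 ?(ltW e0)// lerDl.
by rewrite [leRHS]splitr lerD.
Qed.

End perturbation.

(** * Recursion on the block of a fixed index *)

Section block_recursion.
Context {R : realType} {d : measure_display} {Z : measurableType d}
  {d' : measure_display} {Omega : measurableType d'}.
Variables (nu : {measure set Z -> \bar R}) (P : probability Omega R).
Variable phi : set Z -> Omega -> R.
Hypothesis crm : is_crm nu P phi.
Hypothesis good : good_crm nu P phi.
Variable U : nat -> set Z.
Hypothesis mU : forall k, measurable (U k).
Hypothesis sepU : forall x y, (forall k, U k x <-> U k y) -> x = y.
Hypothesis nat_nu : nonatomic measurable nu.

Local Notation fin := (fin_sets nu).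
Local Notation atom := (bit_atom U).
Let matom s := bit_atom_measurable mU s.

Variables (J : finType) (C : J -> set Z).
Hypothesis fC : forall t, fin (C t).
Hypothesis dC : forall t u, t != u -> C t `&` C u = set0.

(** The sets [C t], cut by [S], form a disjoint family indexed by [J * bool]. All three means factor
    over this family, and each of its members has exponent 0 in one of the two means on the
    right. *)
Lemma mean_prod_split (I : finType) (a : I -> J) (S : set Z) (D b : {set I}) :
  measurable S -> b \subset D ->
  mean P (fun w => (\prod_(i in b) phi (C (a i) `&` S) w) *
                   \prod_(i in D :\: b) phi (C (a i) `\` S) w) =
  mean P (fun w => \prod_(i in b) phi (C (a i) `&` S) w) *
  mean P (fun w => \prod_(i in D :\: b) phi (C (a i) `\` S) w).
Proof.
move=> mS bD.
pose E (u : J * bool) := if u.2 then C u.1 `&` S else C u.1 `\` S.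
pose h i := (a i, i \in b).
have fE u : fin (E u) by rewrite /E; case: ifP => _; [exact: fin_setsI|exact: fin_setsD].
have dE u v : u != v -> E u `&` E v = set0.
  move=> uv; have ES w : E w `<=` C w.1 by rewrite /E; case: ifP => _ x [].
  have [e1|n1] := eqVneq u.1 v.1; last first.
    by apply/seteqP; split => // x [/ES xu /ES xv]; have : (C u.1 `&` C v.1) x by []; rewrite dC.
  apply/seteqP; split => // x []; rewrite /E.
  have : u.2 != v.2 by apply: contra uv; case: u e1 => ? ?; case: v => ? ? /= -> /eqP ->.
  by case: u.2; case: v.2 => //= _ [_ ?] [_ ?].
have hb : forall w, \prod_(i in b) phi (C (a i) `&` S) w = \prod_(i in b) phi (E (h i)) w.
  by move=> w; apply: eq_bigr => i ib; rewrite /E /h /= ib.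
have hDb : forall w, \prod_(i in D :\: b) phi (C (a i) `\` S) w = \prod_(i in D :\: b) phi (E (h i)) w.
  by move=> w; apply: eq_bigr => i; rewrite inE /E /h /= => /andP[/negbTE ->].
under eq_fun do rewrite hb hDb.
under [in RHS]eq_fun do rewrite hb.
under [X in _ = _ * mean P X]eq_fun do rewrite hDb.
have hD : forall w, (\prod_(i in b) phi (E (h i)) w) * \prod_(i in D :\: b) phi (E (h i)) w =
    \prod_(i in D) phi (E (h i)) w.
  move=> w; rewrite [RHS](bigID (mem b))/=; congr (_ * _); apply: eq_bigl => i.
    by have := fintype.subsetP bD i; case: (i \in b) => [->//|_]; rewrite andbF.
  by rewrite inE andbC.
under eq_fun do rewrite hD.
rewrite !(mean_prod_disjoint crm _ _ fE dE) -big_split/=; apply: eq_bigr => -[t be] _.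
have one (Q : {pred I}) : (forall i, Q i = false) ->
    mean P (fun w => phi (E (t, be)) w ^+ #|Q| ) = 1.
  by move=> Q0; rewrite (eq_card0 Q0); under eq_fun do rewrite expr0; rewrite mean_cst.
case: be one => one.
  rewrite [X in _ * X]one ?mulr1; last first.
    by move=> i; rewrite /h inE/= inE; case: (i \in b); rewrite //= ?andbF// xpair_eqE/= !andbF.
  congr mean; apply/funext => w; congr (_ ^+ _); apply: eq_card => i.
  rewrite !inE /h xpair_eqE/=; case: (boolP (i \in b)); rewrite ?andbF// => ib.
  by rewrite (fintype.subsetP bD).
rewrite [X in X * _]one ?mul1r; last first.
  by move=> i; rewrite /h inE/= xpair_eqE; case: (i \in b); rewrite //= andbF.
congr mean; apply/funext => w; congr (_ ^+ _); apply: eq_card => i.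
rewrite !inE /h xpair_eqE/=.
by case: (i \in b); rewrite ?andbF.
Qed.

(** [a] labels the indices by sets, with repetitions allowed; the value is the factor that the block
    [b] contributes to [diag_tensor] on the rectangle with sides [C (a i)]. *)
Definition block_mean (I : finType) (a : I -> J) (b : {set I}) : R :=
  mean_St nu P phi (ptop #|b|) (rect (fun i : 'I_#|b| => C (a (enum_val i)))).

Definition prod_mean (I : finType) (a : I -> J) (D : {set I}) : R :=
  mean P (fun w => \prod_(i in D) phi (C (a i)) w).

(* Split [C (a i0)] into its pieces in the atoms, and in the term of [atom s] split every
   other [C (a i)] into its parts inside and outside [atom s]: if [b] is the set of indices
   inside, the two groups of factors are independent. As [N] grows, the sum over the atoms
   of the inner means tends to [block_mean a b] and the outer mean to [prod_mean]. *)
Lemma prod_mean_rec (I : finType) (a : I -> J) (D : {set I}) i0 : i0 \in D ->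
  prod_mean a D =
  \sum_(b : {set I} | (b \subset D) && (i0 \in b)) block_mean a b * prod_mean a (D :\: b).
Proof.
move=> i0D.
have fI t s : fin (C t `&` atom s) by apply: fin_setsI.
have fD t s : fin (C t `\` atom s) by apply: fin_setsD.
have mI t s : has_moments P (phi (C t `&` atom s)) by exact: (phi_moments crm).
have mD t s : has_moments P (phi (C t `\` atom s)) by exact: (phi_moments crm).
have mC t : has_moments P (phi (C t)) by exact: (phi_moments crm).
pose c (b : {set I}) N (s : N.-tuple bool) := mean P (fun w => \prod_(i in b) phi (C (a i) `&` atom s) w).
pose e (b : {set I}) N (s : N.-tuple bool) := mean P (fun w => \prod_(i in D :\: b) phi (C (a i) `\` atom s) w).
have key N : prod_mean a D = \sum_(b : {set I} | (b \subset D) && (i0 \in b))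
    \sum_(s : N.-tuple bool) c b N s * e b N s.
  rewrite exchange_big/=.
  have ae1 : {ae P, forall w, phi (C (a i0)) w = \sum_(s : N.-tuple bool) phi (C (a i0) `&` atom s) w}.
    have := phi_bigcup crm (s := index_enum (N.-tuple bool)) predT (fC (a i0)) (fun s => matom s).
    rewrite (bigsetU_bit_atom U N) setIT; apply.
    have := index_enum_uniq (N.-tuple bool); rewrite uniq_pairwise.
    by apply: sub_pairwise => s t /= st; apply/asboolP; rewrite bit_atom_disjoint// !size_tuple.
  have ae2 : {ae P, forall w, forall (i : I) (s : N.-tuple bool),
      phi (C (a i)) w = phi (C (a i) `&` atom s) w + phi (C (a i) `\` atom s) w}.
    apply: filter_forall => i; apply: filter_forall => s.
    have := phiU crm (fI (a i) s) (fD (a i) s); rewrite setUC -setDDr setDv setD0; apply.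
    by apply/seteqP; split => // x [[_ ?] []].
  transitivity (mean P (fun w => \sum_(s : N.-tuple bool)
      \sum_(b : {set I} | (b \subset D) && (i0 \in b))
       (\prod_(i in b) phi (C (a i) `&` atom s) w) * \prod_(i in D :\: b) phi (C (a i) `\` atom s) w)).
    apply: mean_ae_eq.
    - by apply: has_moments_measurable; exact: has_moments_prod.
    - apply: has_moments_measurable; apply: has_moments_sum => s _.
      by apply: has_moments_sum => b _; apply: has_momentsM; exact: has_moments_prod.
    - apply: filterS2 ae1 ae2 => w e1 e2.
      rewrite (big_setD1 i0)//= e1 big_distrl/=; apply: eq_bigr => s _.
      rewrite (eq_bigr (fun i => phi (C (a i) `&` atom s) w + phi (C (a i) `\` atom s) w)); last by move=> i _; exact: e2.
      rewrite prodrD_subset big_distrr/=.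
      (* The expansion runs over the indices other than [i0] that fall inside the atom; adjoining
         [i0], whose factor is always inside, gives the block. *)
      rewrite (reindex_onto (fun b => b :\ i0)%SET (fun b => i0 |: b)%SET)/=; last first.
        move=> b; rewrite subsetD1 => /andP[_ i0b].
        by rewrite setU1K.
      apply: eq_big => b.
        rewrite subsetD1 !inE eqxx/= andbT.
        have -> : ((i0 |: b :\ i0)%SET == b) = (i0 \in b).
          apply/eqP/idP => [<-|i0b]; [by rewrite !inE eqxx|exact: finset.setD1K].
        case: (boolP (i0 \in b)); rewrite ?andbF//= !andbT => i0b.
        apply/idP/idP => [h|/(fintype.subset_trans (subD1set _ _))//].
        by rewrite -(finset.setD1K i0b) finset.subUset finset.sub1set i0D.
      move=> /andP[_ /eqP h]; have i0b : i0 \in b by rewrite -h !inE eqxx.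
      rewrite [in RHS](big_setD1 i0)//= mulrA; congr (_ * _).
      apply: eq_bigl => i; rewrite !inE; case: (eqVneq i i0) => //= ->.
      by rewrite i0b.
  rewrite mean_sum; last first.
    by move=> s _; apply: has_moments_sum => b _; apply: has_momentsM; exact: has_moments_prod.
  apply: eq_bigr => s _; rewrite mean_sum; last first.
    by move=> b _; apply: has_momentsM; exact: has_moments_prod.
  by apply: eq_bigr => b /andP[bD _]; rewrite mean_prod_split.
have lim (b : {set I}) : i0 \in b -> \sum_(s : N.-tuple bool) c b N s * e b N s @[N --> \oo] -->
    block_mean a b * prod_mean a (D :\: b).
  move=> i0b; have b0 : (0 < #|b|)%N by rewrite card_gt0; apply/finset.set0Pn; exists i0.
  have fCb (i : 'I_#|b|) : fin (C (a (enum_val i))) by exact: fC.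
  have cE N s : c b N s = mean P (fun w => \prod_(i < #|b|) phi (C (a (enum_val i)) `&` atom s) w).
    by rewrite /c; congr mean; apply/funext => w; rewrite big_enum_val.
  have [B hB] := sum_moment_bounded crm good mU sepU b0 fCb.
  apply: (@cvg_sum_mul_near_cst _ (fun N => N.-tuple bool) (c b) (e b) _ _ B).
  - under eq_fun do (under eq_bigr do rewrite cE).
    exact: mean_St_lim.
  - by move=> N; under eq_bigr do rewrite cE; exact: hB.
  - move=> eps eps0.
    have [N0 hN0] := prod_setD_near crm mU sepU nat_nu (enum (D :\: b)%SET) [::] (fun i => fC (a i)) eps0.
    exists N0 => N N0N s; have := hN0 N N0N s (size_tuple s).
    under eq_fun do rewrite big_nil mul1r big_enum/=.
    by under [X in _ - mean P X]eq_fun do rewrite big_nil mul1r big_enum/=.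
have L : prod_mean a D @[N --> \oo] --> \sum_(b : {set I} | (b \subset D) && (i0 \in b))
    block_mean a b * prod_mean a (D :\: b).
  by rewrite (funext key); apply: cvg_sumr => b /andP[_]; exact: lim.
by move: L => /cvg_lim <-//; rewrite lim_cst.
Qed.

End block_recursion.

(** * Sums over set partitions *)

Local Notation disj A B := (fintype.disjoint (mem A) (mem B)).

Section partition_sums.
Context {R : comRingType} {I Q : finType}.
Variables (g : I -> Q) (w : {set I} -> R).
Implicit Types (s t : {set {set I}}) (S T : {set Q}).

Definition fiber S : {set I} := [set i | g i \in S]%SET.

(** In the graph that links [g i] and [g i'] when [i] and [i'] share a block, this says that [T] is
    a union of connected components. *)
Definition saturated s T : bool :=
  [forall b in s, forall i in b, forall i' in b, (g i \in T) == (g i' \in T)].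

(* The component of [j0] in the graph on [Q] that links the classes met by a same block. *)
Definition component j0 s T : bool :=
  finset.minset (fun T' : {set Q} => (j0 \in T') && saturated s T') T.

Definition part_sum (D : {set I}) : R :=
  \sum_(s : {set {set I}} | finset.partition s D) \prod_(b in s) w b.

(** Since [s] partitions the fiber of [T], the second condition says that [s] connects all the
    classes of [T]. *)
Definition conn_sum j0 T : R :=
  \sum_(s : {set {set I}} | finset.partition s (fiber T) && component j0 s T)
    \prod_(b in s) w b.

Lemma saturatedP s T : reflect (forall b i i', b \in s -> i \in b -> i' \in b ->
  (g i \in T) = (g i' \in T)) (saturated s T).
Proof.
apply: (iffP forall_inP) => [h b i i' bs ib i'b|h b bs].
  by have /forall_inP/(_ i ib)/forall_inP/(_ i' i'b)/eqP := h b bs.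
by apply/forall_inP => i ib; apply/forall_inP => i' i'b; apply/eqP; exact: h i'b.
Qed.

Lemma saturatedI s T T' : saturated s T -> saturated s T' -> saturated s (T :&: T')%SET.
Proof.
move=> /saturatedP h /saturatedP h'; apply/saturatedP => b i i' bs ib i'b.
by rewrite !inE (h b i i')// (h' b i i').
Qed.

Lemma saturatedU s t T : saturated (s :|: t)%SET T = saturated s T && saturated t T.
Proof.
apply/saturatedP/andP => [h|[/saturatedP h1 /saturatedP h2] b i i'].
  by split; apply/saturatedP => b i i' bs; apply: h; rewrite inE bs ?orbT.
by rewrite inE => /orP[]; [exact: h1|exact: h2].
Qed.

Lemma saturated_full s S T : finset.partition s (fiber S) -> S \subset T -> saturated s T.
Proof.
move=> ps ST; apply/saturatedP => b i i' bs ib i'b.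
have sub j : j \in b -> g j \in T.
  move=> jb; apply: (fintype.subsetP ST).
  have : j \in fiber S by rewrite -(finset.cover_partition ps); apply/finset.bigcupP; exists b.
  by rewrite inE.
by rewrite !sub.
Qed.

Lemma saturated_disjoint s S T : finset.partition s (fiber S) -> (disj S T) -> saturated s T.
Proof.
move=> ps ST; apply/saturatedP => b i i' bs ib i'b.
have sub j : j \in b -> g j \in T = false.
  move=> jb; apply: (disjointFr ST).
  have : j \in fiber S by rewrite -(finset.cover_partition ps); apply/finset.bigcupP; exists b.
  by rewrite inE.
by rewrite !sub.
Qed.

(** The intersection of two saturated sets is saturated, so there is only one minimal such set
    containing [j0]. *)
Lemma component_unique j0 s T T' : component j0 s T -> component j0 s T' -> T = T'.
Proof.
move=> /finset.minsetP[/andP[jT sT] mT] /finset.minsetP[/andP[jT' sT'] mT'].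
have h : (j0 \in (T :&: T')%SET) && saturated s (T :&: T')%SET.
  by rewrite inE jT jT' saturatedI.
by rewrite -(mT _ h (finset.subsetIl _ _)) -[RHS](mT' _ h (finset.subsetIr _ _)).
Qed.

Lemma component_exists j0 s S : j0 \in S -> finset.partition s (fiber S) ->
  exists2 T : {set Q}, T \subset S & component j0 s T.
Proof.
move=> jS ps.
have [|T mT TS] := @finset.minset_exists _ (fun T' : {set Q} => (j0 \in T') && saturated s T') S.
  by rewrite jS (saturated_full ps).
by exists T.
Qed.

Lemma saturated_block s S T b : finset.partition s (fiber S) -> saturated s T -> b \in s ->
  (b \subset fiber T) || (disj b (fiber T)).
Proof.
move=> ps /saturatedP h bs.
have b0 : b != finset.set0 by exact: (finset.partition_neq0 ps).
have /finset.set0Pn[i ib] := b0.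
case: (boolP (g i \in T)) => iT.
  by apply/orP; left; apply/fintype.subsetP => i' i'b; rewrite inE -(h b i).
apply/orP; right; rewrite fintype.disjoint_subset; apply/fintype.subsetP => i' i'b.
by rewrite !inE -(h b i).
Qed.

(** Let [T] be the component of [j0] in a partition. No block crosses the fiber of [T]: the blocks
    inside it connect [T], and those outside form an arbitrary partition of the rest. *)
Lemma part_sum_component j0 S : j0 \in S ->
  part_sum (fiber S) = \sum_(T : {set Q} | (T \subset S) && (j0 \in T))
    conn_sum j0 T * part_sum (fiber (S :\: T)).
Proof.
move=> jS.
transitivity (\sum_(s : {set {set I}} | finset.partition s (fiber S))
   \sum_(T : {set Q} | ((T \subset S) && (j0 \in T)) && component j0 s T) \prod_(b in s) w b).
  apply: eq_bigr => s ps; have [T TS cT] := component_exists jS ps.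
  have jT : j0 \in T by move: cT => /finset.minsetP[/andP[]].
  rewrite (bigD1 T)/=; last by rewrite TS jT cT.
  rewrite [X in _ = _ + X]big1 ?addr0// => T' /andP[/andP[_ cT'] /eqP]; case.
  exact: component_unique cT' cT.
rewrite (exchange_big_dep (fun T : {set Q} => (T \subset S) && (j0 \in T)))/=; last by move=> s T _ /andP[].
apply: eq_bigr => T /andP[TS jT].
rewrite /conn_sum /part_sum big_distrlr/= pair_big/=.
(* Gluing and cutting: the pairs of families of blocks that are recovered from their union are shown
   to be exactly the pairs of partitions of the two fibers. *)
pose h (p : {set {set I}} * {set {set I}}) := (p.1 :|: p.2)%SET.
pose h' s := ([set b in s | b \subset fiber T], [set b in s | ~~ (b \subset fiber T)])%SET.
rewrite (reindex_onto h h')/=; last first.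
  by move=> s _; apply/finset.setP => b; rewrite !inE -andb_orr orbN andbT.
have fU : (fiber T :|: fiber (S :\: T)%SET)%SET = fiber S.
  apply/finset.setP => i; rewrite !inE; case: (boolP (g i \in T)) => //= iT.
  by rewrite (fintype.subsetP TS).
have fD : (disj (fiber T) (fiber (S :\: T)%SET)).
  by rewrite fintype.disjoint_subset; apply/fintype.subsetP => i; rewrite !inE => ->.
have dST : (disj (S :\: T)%SET T).
  by rewrite fintype.disjoint_subset; apply/fintype.subsetP => j; rewrite !inE => /andP[].
apply: eq_big => [[s1 s2]|[s1 s2]] /=; last first.
  move=> /andP[/andP[ps _] /eqP[e1 e2]].
  rewrite /h /=.
  have m1 b : (b \in s1) = (b \in h (s1, s2)) && (b \subset fiber T).
    by rewrite -[in LHS]e1 inE.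
  have m2 b : (b \in s2) = (b \in h (s1, s2)) && ~~ (b \subset fiber T).
    by rewrite -[in LHS]e2 inE.
  have dj : disj s1 s2.
    rewrite fintype.disjoint_subset; apply/fintype.subsetP => b.
    by rewrite m1 => /andP[_ bT]; rewrite inE/= m2 bT andbF.
  by rewrite -bigU //=; apply: eq_bigl => b; rewrite !inE.
rewrite TS jT /=; apply/idP/idP.
  move=> /andP[/andP[ps cT] /eqP[e1 e2]].
  have sT : saturated (h (s1, s2)) T by move: cT => /finset.minsetP[/andP[]].
  have b0 b : b \in h (s1, s2) -> b != finset.set0 by exact: (finset.partition_neq0 ps).
  have tI : finset.trivIset (h (s1, s2)) by exact: (finset.partition_trivIset ps).
  have m1 b : (b \in s1) = (b \in h (s1, s2)) && (b \subset fiber T).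
    by rewrite -[in LHS]e1 inE.
  have m2 b : (b \in s2) = (b \in h (s1, s2)) && ~~ (b \subset fiber T).
    by rewrite -[in LHS]e2 inE.
  have p1 : finset.partition s1 (fiber T).
    apply/and3P; split.
    - rewrite finset.eqEsubset; apply/andP; split.
        by apply/finset.bigcupsP => b; rewrite m1 => /andP[].
      apply/fintype.subsetP => i iT.
      have : i \in finset.cover (h (s1, s2)) by rewrite (finset.cover_partition ps) -fU inE iT.
      move=> /finset.bigcupP[b bs ib]; apply/finset.bigcupP; exists b => //.
      have := saturated_block ps sT bs => /orP[bT|]; first by rewrite m1 bs.
      by move=> /disjointFr/(_ ib); rewrite iT.
    - by apply: (finset.trivIsetS _ tI); exact: finset.subsetUl.
    - by apply/negP => h0; have := b0 finset.set0; rewrite !inE h0 eqxx => /(_ isT).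
  have p2 : finset.partition s2 (fiber (S :\: T)%SET).
    apply/and3P; split.
    - rewrite finset.eqEsubset; apply/andP; split.
        apply/finset.bigcupsP => b; rewrite m2 => /andP[bs nb].
        have := saturated_block ps sT bs; rewrite (negbTE nb)/= => db.
        have bS : b \subset fiber S.
          by rewrite -(finset.cover_partition ps); exact: finset.bigcup_sup.
        apply/fintype.subsetP => i ib; have := fintype.subsetP bS _ ib; have := disjointFr db ib.
        by rewrite !inE => -> ->.
      apply/fintype.subsetP => i iT.
      have : i \in finset.cover (h (s1, s2)) by rewrite (finset.cover_partition ps) -fU inE iT orbT.
      move=> /finset.bigcupP[b bs ib]; apply/finset.bigcupP; exists b => //.
      rewrite m2 bs/=; apply/negP => /fintype.subsetP/(_ _ ib).
      by move: iT; rewrite !inE => /andP[/negbTE ->].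
    - by apply: (finset.trivIsetS _ tI); exact: finset.subsetUr.
    - by apply/negP => h0; have := b0 finset.set0; rewrite !inE h0 orbT eqxx => /(_ isT).
  rewrite p1 p2 andbT /=; apply/finset.minsetP; split.
    by rewrite jT (saturated_full p1).
  move=> B /andP[jB sB] BT; move: cT => /finset.minsetP[_ mT]; apply: mT => //.
  rewrite jB saturatedU sB/=; apply: (saturated_disjoint p2).
  exact: disjointWr BT dST.
move=> /andP[/andP[p1 cT] p2].
have n1 b : b \in s1 -> b \subset fiber T.
  by move=> bs; rewrite -(finset.cover_partition p1); exact: finset.bigcup_sup.
have n2 b : b \in s2 -> ~~ (b \subset fiber T).
  move=> bs; have /finset.set0Pn[i ib] := finset.partition_neq0 p2 bs.
  apply/negP => /fintype.subsetP/(_ _ ib) iT.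
  have : i \in fiber (S :\: T)%SET by rewrite -(finset.cover_partition p2); apply/finset.bigcupP; exists b.
  by rewrite (disjointFr fD iT).
apply/andP; split; [apply/andP; split|].
- rewrite /h/= -fU; apply/and3P; split.
  + by rewrite -(finset.cover_partition p1) -(finset.cover_partition p2) /finset.cover finset.bigcup_setU.
  + apply/finset.trivIsetP => b c; rewrite !inE.
    have dj b1 b2 : b1 \in s1 -> b2 \in s2 -> disj b1 b2.
      move=> bs1 bs2; apply: (disjointWl (n1 _ bs1)); apply: disjointWr fD.
      by rewrite -(finset.cover_partition p2); exact: finset.bigcup_sup.
    move=> /orP[b1|b2] /orP[c1|c2] bc.
    * by move: (finset.partition_trivIset p1) => /finset.trivIsetP; apply.
    * exact: dj.
    * by rewrite fintype.disjoint_sym; exact: dj.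
    * by move: (finset.partition_trivIset p2) => /finset.trivIsetP; apply.
  + by rewrite !inE negb_or; move: p1 p2 => /and3P[_ _ ->] /and3P[_ _ ->].
- apply/finset.minsetP; split.
    by rewrite jT saturatedU (saturated_full p1)// (saturated_disjoint p2).
  move=> B /andP[jB]; rewrite saturatedU => /andP[sB _] BT.
  by move: cT => /finset.minsetP[_ mT]; apply: mT => //; rewrite jB.
- apply/eqP; congr (_, _); apply/finset.setP => b; rewrite !inE.
    case: (boolP (b \in s1)) => [/n1 ->//|_].
    by case: (boolP (b \in s2)) => //= /n2/negbTE.
  case: (boolP (b \in s2)) => [/n2 ->|_]; first by rewrite orbT.
  by case: (boolP (b \in s1)) => //= /n1 ->.
Qed.

Lemma part_sum_set0 : part_sum finset.set0 = 1.
Proof.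
rewrite /part_sum (bigD1 finset.set0)/=; last first.
  apply/and3P; split; rewrite ?inE//; first by rewrite /finset.cover big_set0.
  by apply/finset.trivIsetP => A B; rewrite inE.
rewrite finset.big_set0 big1 ?addr0// => s /andP[ps /eqP s0]; case: s0.
apply/finset.setP => b; rewrite inE; apply/negP => bs.
have /finset.set0Pn[i ib] := finset.partition_neq0 ps bs.
have : i \in finset.cover s by apply/finset.bigcupP; exists b.
by rewrite (finset.cover_partition ps) inE.
Qed.

End partition_sums.

(** When every index is its own class, the component of [i0] is its block, and the only partition
    connecting [T] is [T] itself as a single block. *)
Lemma part_sum_block {R : comRingType} {I : finType} (w : {set I} -> R) (D : {set I}) i0 :
  i0 \in D -> part_sum w D =
    \sum_(b : {set I} | (b \subset D) && (i0 \in b)) w b * part_sum w (D :\: b)%SET.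
Proof.
move=> iD; have fE (S : {set I}) : fiber id S = S by apply/finset.setP => i; rewrite inE.
rewrite -{1}(fE D) (part_sum_component _ _ iD); apply: eq_bigr => T /andP[TD iT].
rewrite fE; congr (_ * _); rewrite /conn_sum fE.
have T0 : T != finset.set0 by apply/finset.set0Pn; exists i0.
have pT : finset.partition [set T]%SET T.
  apply/and3P; split; rewrite ?inE 1?eq_sym//; first by rewrite /finset.cover big_set1.
  by apply/finset.trivIsetP => A B; rewrite !inE => /eqP -> /eqP ->; rewrite eqxx.
rewrite (big_pred1 [set T]%SET) => [|s]; first by rewrite finset.big_set1.
apply/andP/eqP => [[ps cT]|->].
  have iTc : i0 \in finset.cover s by rewrite (finset.cover_partition ps).
  have bs : finset.pblock s i0 \in s by exact: finset.pblock_mem.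
  have bT : finset.pblock s i0 = T.
    move: cT => /finset.minsetP[_]; apply.
      rewrite finset.mem_pblock iTc/=; apply/saturatedP => c i i' cs ic i'c.
      have tI := finset.partition_trivIset ps.
      by rewrite /= -!(finset.eq_pblock _ tI iTc) (finset.def_pblock tI cs ic) (finset.def_pblock tI cs i'c).
    by rewrite -(finset.cover_partition ps); move: bs; move: (finset.pblock s i0) => b bs; exact: finset.bigcup_sup.
  rewrite bT in bs; apply/finset.setP => c; rewrite inE; apply/idP/eqP => [cs|->//].
  apply/eqP; apply: contraT => cT'.
  have := finset.partition_trivIset ps => /finset.trivIsetP/(_ _ _ cs bs cT').
  have /finset.set0Pn[i ic] := finset.partition_neq0 ps cs.
  move=> /disjointFr/(_ ic); rewrite -(finset.cover_partition ps) => /negP; case.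
  by apply/finset.bigcupP; exists c.
split=> //; apply/finset.minsetP; split.
  by rewrite iT (saturated_full (S := T))// fE.
move=> B /andP[iB /saturatedP sB] BT; apply/eqP; rewrite finset.eqEsubset BT/=.
by apply/fintype.subsetP => i iT'; rewrite -(sB T i0 i) ?inE.
Qed.

Lemma sum_ffun_upd {R : nmodType} (I J : finType) (i : I) (j0 : J) (G : {ffun I -> J} -> R) :
  \sum_a G a = \sum_(a : {ffun I -> J} | a i == j0) \sum_j G [ffun k => if k == i then j else a k].
Proof.
rewrite pair_big/=.
pose h (p : {ffun I -> J} * J) : {ffun I -> J} := [ffun k => if k == i then p.2 else p.1 k].
pose h' (a : {ffun I -> J}) : {ffun I -> J} * J := ([ffun k => if k == i then j0 else a k], a i).
rewrite (reindex_onto h h')/=; last first.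
  by move=> a _; apply/ffunP => k; rewrite !ffunE/=; case: eqP => // ->.
apply: eq_bigl => -[a j]; rewrite /h' xpair_eqE [h _ i]ffunE /= !eqxx !andbT.
apply/eqP/eqP => [<-|e]; first by rewrite ffunE eqxx.
by apply/ffunP => k; rewrite !ffunE/=; case: eqP => // ->.
Qed.

(** * Linear extensions *)

Section congruence.
Context {R : realType} {V : lmodType R}.
(* Set functions need only be additive modulo [N], such as the almost surely null variables. *)
Variable N : V -> Prop.
Hypothesis N0 : N 0.
Hypothesis ND : forall u v, N u -> N v -> N (u + v).
Hypothesis NZ : forall c u, N u -> N (c *: u).

Lemma null_oppr u : N u -> N (- u).
Proof. by move=> /(NZ (-1)); rewrite scaleN1r. Qed.

Lemma null_sym u v : N (u - v) -> N (v - u).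
Proof. by move=> /null_oppr; rewrite opprB. Qed.

Lemma null_trans v u w : N (u - v) -> N (v - w) -> N (u - w).
Proof. by move=> h1 h2; rewrite -(subrKA v); exact: ND. Qed.

Lemma null_sum (I : Type) (r : seq I) (Q : pred I) (F G : I -> V) :
  (forall i, Q i -> N (F i - G i)) ->
  N (\sum_(i <- r | Q i) F i - \sum_(i <- r | Q i) G i).
Proof.
move=> h; rewrite -sumrB; elim: r => [|i r IH]; first by rewrite big_nil.
by rewrite big_cons; case: ifP => // Qi; apply: ND => //; exact: h.
Qed.

Context {d : measure_display} {Z : measurableType d}.
Variable nu : {measure set Z -> \bar R}.
Local Notation fin := (fin_sets nu).

Definition update n (A : 'I_n -> set Z) i X : 'I_n -> set Z :=
  fun j => if j == i then X else A j.

Definition multiadditive n (M : ('I_n -> set Z) -> V) : Prop :=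
  forall (A : 'I_n -> set Z) i X Y, (forall j, fin (A j)) -> fin X -> fin Y ->
  X `&` Y = set0 -> N (M (update A i (X `|` Y)) - (M (update A i X) + M (update A i Y))).

Variables (n : nat) (M : ('I_n -> set Z) -> V).
Hypothesis MM : multiadditive M.

Lemma multiadditive_set0 A i : (forall j, fin (A j)) -> N (M (update A i set0)).
Proof.
move=> fA; have := MM i fA (fin_sets0 nu) (fin_sets0 nu) (setI0 _).
by rewrite setU0 opprD addNKr => /null_oppr; rewrite opprK.
Qed.

Lemma multiadditive_empty A i : (forall j, fin (A j)) -> A i = set0 -> N (M A).
Proof.
move=> fA A0; rewrite (_ : A = update A i set0); first exact: multiadditive_set0.
by apply/funext => j; rewrite /update; case: eqP => // ->.
Qed.

Variables (J : finType) (C : J -> set Z).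
Hypothesis fC : forall s, fin (C s).
Hypothesis dC : forall s t, s != t -> C s `&` C t = set0.

Definition cells_union (S : {set J}) : set Z := \big[setU/set0]_(s in S) C s.

Lemma cells_unionP (S : {set J}) x : cells_union S x <-> exists2 s, s \in S & C s x.
Proof.
rewrite /cells_union -bigcup_seq_cond; split => [[s /andP[_ sS] xs]|[s sS xs]].
  by exists s.
by exists s => //=; rewrite mem_index_enum.
Qed.

Lemma fin_cells_union (S : {set J}) : fin (cells_union S).
Proof. exact: fin_sets_bigcup. Qed.

Lemma multiadditive_cells A i (S : {set J}) : (forall j, fin (A j)) ->
  N (M (update A i (cells_union S)) - \sum_(s in S) M (update A i (C s))).
Proof.
move=> fA; rewrite /cells_union -!big_enum; have := enum_uniq S.
elim: (enum S) => [_|s r IH /= /andP[sr ur]].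
  by rewrite !big_nil subr0; exact: multiadditive_set0.
rewrite !big_cons; set X := \big[setU/set0]_(j <- r) C j.
have fX : fin X by apply: big_ind => //; [exact: fin_sets0|exact: fin_setsU].
have sX : C s `&` X = set0.
  apply/seteqP; split => // x [xs]; rewrite /X -bigcup_seq => -[t /= tr xt].
  have : (C s `&` C t) x by []; rewrite dC//.
  by apply: contraNneq sr => ->.
apply: null_trans (MM i fA (fC s) fX sX) _.
by rewrite opprD addrACA subrr add0r; exact: IH.
Qed.

(** The sides are expanded into cells one coordinate at a time. *)
Lemma multiadditive_expand A (S : 'I_n -> {set J}) : (forall i, A i = cells_union (S i)) ->
  N (M A - \sum_(a : {ffun 'I_n -> J} | [forall i, a i \in S i]) M (C \o a)).
Proof.
move=> AE; have fA i : fin (A i) by rewrite AE; exact: fin_cells_union.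
(* Without cells there is no default label: then either some side is empty and both terms are null,
   or [n = 0] and the sum has one term. *)
have [j0 _|J0] := pickP {: J}; last first.
  have [i _|n0] := pickP {: 'I_n}.
    rewrite big1 ?subr0; last by move=> a _; have := J0 (a i).
    apply: (multiadditive_empty (i := i)) => //; rewrite AE.
    by apply/seteqP; split => // x /cells_unionP[s]; have := J0 s.
  pose a0 : {ffun 'I_n -> J} := finfun (fun i => match notF (esym (n0 i)) with end).
  rewrite (big_pred1 a0).
    rewrite (_ : C \o a0 = A) ?subrr//.
    by apply/funext => i; have := n0 i.
  by move=> a /=; apply/forallP/eqP => [_|_ i]; [apply/ffunP => i|]; have := n0 i.
(* [r] lists the coordinates already expanded; at the others the label is fixed to [j0], so that
   every partial choice is counted once. *)
pose B (r : seq 'I_n) (a : {ffun 'I_n -> J}) i := if i \in r then C (a i) else A i.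
have fB r a i : fin (B r a i) by rewrite /B; case: ifP.
pose Q (r : seq 'I_n) (a : {ffun 'I_n -> J}) :=
  [forall i, if i \in r then a i \in S i else a i == j0].
suff H r : uniq r -> N (M A - \sum_(a | Q r a) M (B r a)).
  have := H (enum 'I_n) (enum_uniq _); congr (N (_ - _)); apply: eq_big => a.
    by rewrite /Q; apply: eq_forallb => i; rewrite mem_enum.
  by move=> _; congr M; apply/funext => i; rewrite /B mem_enum.
elim: r => [_|i r IH /= /andP[ir ur]].
  rewrite (big_pred1 [ffun=> j0]); first by rewrite (_ : B [::] _ = A) ?subrr.
  by move=> a; apply/forallP/eqP => [h|-> k]; [apply/ffunP => k; rewrite ffunE (eqP (h k))|rewrite ffunE].
apply: null_trans (IH ur) _.
have -> : \sum_(a | Q (i :: r) a) M (B (i :: r) a) =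
    \sum_(a | Q r a) \sum_(s in S i) M (update (B r a) i (C s)).
  rewrite big_mkcond (sum_ffun_upd i j0) [RHS]big_mkcond/= [RHS](bigID (fun a : {ffun 'I_n -> J} => a i == j0))/=.
  rewrite [X in _ = _ + X]big1 ?addr0; last first.
    move=> a ai; case: ifP => // /forallP/(_ i); rewrite (negbTE ir).
    by rewrite (negbTE ai).
  apply: eq_bigr => a ai; rewrite -big_mkcond/=.
  have E (s : J) : Q (i :: r) [ffun k => if k == i then s else a k] = Q r a && (s \in S i).
    apply/forallP/andP => [h|[/forallP h sS] k].
      split; last by have := h i; rewrite ffunE eqxx inE eqxx.
      apply/forallP => k; have := h k; rewrite ffunE inE.
      by case: (eqVneq k i) => [->|]; rewrite ?(negbTE ir).
    rewrite ffunE inE; case: (eqVneq k i) => [->//|ki] /=; exact: h.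
  case: ifP => Qa; last by rewrite big1// => s; rewrite E Qa.
  apply: eq_big => s; first by rewrite E Qa.
  move=> _; congr M; apply/funext => k; rewrite /B /update ffunE inE.
  by case: (eqVneq k i).
apply: null_sum => a Qa.
have e : update (B r a) i (cells_union (S i)) = B r a.
  by apply/funext => k; rewrite /update /B; case: (eqVneq k i) => // ->; rewrite (negbTE ir) AE.
by rewrite -[X in M X - _]e; exact: multiadditive_cells.
Qed.

Variable z : J -> Z.
Hypothesis zC : forall s x, C s x -> C s (z s).

(** After refinement the coefficient of a product of cells is the value of [f] at any of its points,
    whatever the decomposition. *)
Lemma elementary_cells m (c : 'I_m -> R) (A : 'I_m -> 'I_n -> set Z) (f : n.-tuple Z -> R)
   (S : 'I_m -> 'I_n -> {set J}) :
  elementary nu f c A -> (forall l i, A l i = cells_union (S l i)) ->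
  N (\sum_(l < m) c l *: M (A l) -
     \sum_(a : {ffun 'I_n -> J}) f [tuple z (a i) | i < n] *: M (C \o a)).
Proof.
move=> [fA fE] AE.
apply: (@null_trans (\sum_(l < m) c l *:
    \sum_(a : {ffun 'I_n -> J} | [forall i, a i \in S l i]) M (C \o a))).
  apply: null_sum => l _; rewrite -scalerBr; apply: NZ.
  exact: multiadditive_expand.
have -> : \sum_(l < m) c l *: \sum_(a : {ffun 'I_n -> J} | [forall i, a i \in S l i]) M (C \o a) =
    \sum_(a : {ffun 'I_n -> J}) (\sum_(l < m) c l * [forall i, a i \in S l i]%:R) *: M (C \o a).
  under eq_bigr => l _.
    rewrite scaler_sumr big_mkcond/=.
    under eq_bigr => a _.
      rewrite (_ : (if _ then _ else _) = (c l * [forall i, a i \in S l i]%:R) *: M (C \o a)); last first.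
        by case: ifP; rewrite ?mulr1// mulr0 scale0r.
      over.
    over.
  by rewrite exchange_big/=; apply: eq_bigr => a _; rewrite scaler_suml.
apply: null_sum => a _; rewrite -scalerBl.
(* An empty cell contains no point at which to compare the coefficients, but its term is null. *)
have [[i Ci0]|/forallNP Cn0] := pselect (exists i, C (a i) = set0).
  by apply: NZ; apply: (multiadditive_empty (i := i)) => // j; exact: fC.
rewrite (_ : _ - _ = 0) ?scale0r//; apply/eqP; rewrite subr_eq0 fE; apply/eqP.
apply: eq_bigr => l _; congr (_ * _); rewrite indicE; congr (_%:R).
have zz i : C (a i) (z (a i)).
  by have /eqP/set0P[x] := Cn0 i; exact: zC.
congr nat_of_bool; apply/forallP/idP => [h|/set_mem h i].
  by apply/mem_set => i; rewrite tnth_mktuple AE; apply/cells_unionP; exists (a i).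
have := h i; rewrite tnth_mktuple AE => /cells_unionP[s sS zs].
have [<-//|sa] := eqVneq s (a i).
by have : (C s `&` C (a i)) (z (a i)) by []; rewrite dC.
Qed.

End congruence.

Section cells.
Context {R : realType} {d : measure_display} {Z : measurableType d}.
Variable nu : {measure set Z -> \bar R}.
Variables (I : finType) (E : I -> set Z).
Hypothesis fE : forall i, fin_sets nu (E i).

(* The atoms of the algebra generated by the [E i] within their union: the outer atom,
   indexed by the empty set and possibly of infinite measure, is replaced by [set0]. *)
Definition cell (s : {set I}) : set Z :=
  [set x | s != finset.set0 /\ forall i, E i x <-> i \in s].

Lemma fin_cell s : fin_sets nu (cell s).
Proof.
have [s0|/finset.set0Pn[i0 is0]] := eqVneq s finset.set0.
  rewrite (_ : cell s = set0); first exact: fin_sets0.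
  by apply/seteqP; split => // x []; rewrite s0 eqxx.
have e : cell s = \bigcap_(i in [set: I]) (if i \in s then E i else ~` E i).
  apply/seteqP; split => x /=.
    by move=> [_ h] i _; have := h i; case: (i \in s) => -[h1 h2] //=; [exact: h2|move/h1].
  move=> h; split; first by apply/finset.set0Pn; exists i0.
  move=> i; have := h i Logic.I; case: (i \in s) => //= h1; split => //.
apply: (fin_sets_sub (fE i0)).
  rewrite e; apply: fin_bigcap_measurable => // i _.
  by case: ifP => _; [|apply: measurableC]; case: (fE i).
by move=> x [_ h]; apply/h.
Qed.

Lemma cell_disjoint s t : s != t -> cell s `&` cell t = set0.
Proof.
move=> /eqP st; apply/seteqP; split => // x [[_ hs] [_ ht]]; apply: st.
by apply/finset.setP => i; apply/idP/idP => [/hs/ht|/ht/hs].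
Qed.

Lemma cells_unionE i : E i = cells_union cell [set s : {set I} | i \in s]%SET.
Proof.
apply/seteqP; split => x.
  move=> xi; apply/cells_unionP.
  exists [set j | `[< E j x >]]%SET; first by rewrite !finset.in_set; exact/asboolP.
  split; first by apply/finset.set0Pn; exists i; rewrite inE; exact/asboolP.
  by move=> j; rewrite inE; split => [h|/asboolP//]; exact/asboolP.
by move=> /cells_unionP[s]; rewrite inE => si [_ h]; apply/h.
Qed.

Variable z0 : Z.

Definition cell_point (s : {set I}) : Z := xget z0 (cell s).

Lemma cell_pointP s x : cell s x -> cell s (cell_point s).
Proof. by move=> sx; apply: xgetPex; exists x. Qed.

(** A substitute for an explicit decomposition along the sets [E i], which is easily transported to
    a larger family and to tensor products. *)
Definition respects n (f : n.-tuple Z -> R) : Prop :=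
  (forall x y, (forall j i, E i (tnth x j) <-> E i (tnth y j)) -> f x = f y) /\
  (forall x j, (forall i, ~ E i (tnth x j)) -> f x = 0).

Lemma respects_cells n (f : n.-tuple Z -> R) : respects f ->
  f = (fun x => \sum_(a : {ffun 'I_n -> {set I}})
    f [tuple cell_point (a i) | i < n] * \1_(rect (cell \o a)) x).
Proof.
move=> [f1 f2]; apply/funext => x.
have [[j xj]|/forallNP xj] := pselect (exists j, forall i, ~ E i (tnth x j)).
  rewrite (f2 x j)// big1// => a _; rewrite indicE memNset ?mulr0// => /(_ j) [s0 h].
  by move/finset.set0Pn : s0 => [i ia]; apply: (xj i); apply/h.
pose a : {ffun 'I_n -> {set I}} := [ffun j => [set i | `[< E i (tnth x j) >]]%SET].
have xa : rect (cell \o a) x.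
  move=> j; split; last by move=> i; rewrite ffunE inE; split => [h|/asboolP//]; exact/asboolP.
  have /existsNP[i /contrapT xi] := xj j.
  by apply/finset.set0Pn; exists i; rewrite ffunE inE; exact/asboolP.
rewrite (bigD1 a)//= big1 ?addr0.
  rewrite indicE mem_set ?mulr1//; apply: f1 => j i; rewrite tnth_mktuple.
  have [_ h1] := xa j; have [_ h2] := cell_pointP (xa j).
  by rewrite h1 h2.
move=> b /eqP ba; rewrite indicE memNset ?mulr0// => xb; apply: ba.
apply/ffunP => j; apply/eqP; apply: contraT => ab.
have : (cell (b j) `&` cell (a j)) (tnth x j) by split; [exact: xb|exact: xa].
by rewrite cell_disjoint.
Qed.

End cells.

Section linear_ext.
Context {R : realType} {V : lmodType R}.
Variable N : V -> Prop.
Hypothesis N0 : N 0.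
Hypothesis ND : forall u v, N u -> N v -> N (u + v).
Hypothesis NZ : forall c u, N u -> N (c *: u).
Context {d : measure_display} {Z : measurableType d}.
Variable nu : {measure set Z -> \bar R}.
Variable z0 : Z.

(** Both decompositions are refined to the cells cut out by all their sides together, where the
    value depends on [f] alone. *)
Lemma elementary_unique n (M : ('I_n -> set Z) -> V) (f : n.-tuple Z -> R)
    m (c : 'I_m -> R) A m' (c' : 'I_m' -> R) A' :
  multiadditive N nu M -> elementary nu f c A -> elementary nu f c' A' ->
  N (\sum_(l < m) c l *: M (A l) - \sum_(l < m') c' l *: M (A' l)).
Proof.
move=> MM e1 e2.
pose E (u : 'I_m * 'I_n + 'I_m' * 'I_n) := match u with inl p => A p.1 p.2 | inr p => A' p.1 p.2 end.
have fE u : fin_sets nu (E u) by case: u => p /=; [case: e1|case: e2].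
pose val := \sum_(a : {ffun 'I_n -> {set ('I_m * 'I_n + 'I_m' * 'I_n)%type}})
  f [tuple cell_point E z0 (a i) | i < n] *: M (cell E \o a).
have fc := fin_cell fE; have dc := @cell_disjoint _ _ _ E; have pc := @cell_pointP _ _ _ E z0.
apply: (@null_trans _ _ _ ND val).
  apply: (elementary_cells N0 ND NZ MM fc dc pc e1) => l i.
  exact: (cells_unionE E (inl (l, i))).
apply: null_sym => //.
apply: (elementary_cells N0 ND NZ MM fc dc pc e2) => l i.
exact: (cells_unionE E (inr (l, i))).
Qed.

Lemma linear_extP n (M : ('I_n -> set Z) -> V) (f : n.-tuple Z -> R) m (c : 'I_m -> R) A :
  multiadditive N nu M -> elementary nu f c A ->
  N (linear_ext nu M f - \sum_(l < m) c l *: M (A l)).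
Proof.
move=> MM e1; rewrite /linear_ext.
set Q := (X in xget _ X).
have : Q (xget 0 Q) by apply: xgetPex; exists (\sum_(l < m) c l *: M (A l)), m, c, A.
by move=> [m' [c' [A' [e2 ->]]]]; exact: (elementary_unique MM e2 e1).
Qed.

Lemma linear_ext_respects n (M : ('I_n -> set Z) -> V) (f : n.-tuple Z -> R)
    (I : finType) (E : I -> set Z) :
  multiadditive N nu M -> (forall i, fin_sets nu (E i)) -> respects E f ->
  N (linear_ext nu M f - \sum_(a : {ffun 'I_n -> {set I}})
     f [tuple cell_point E z0 (a i) | i < n] *: M (cell E \o a)).
Proof.
move=> MM fE rf.
pose c (l : 'I_#|{ffun 'I_n -> {set I}}|) := f [tuple cell_point E z0 (enum_val l i) | i < n].
pose A (l : 'I_#|{ffun 'I_n -> {set I}}|) := cell E \o enum_val l.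
have e1 : elementary nu f c A.
  split; first by move=> l i; exact: fin_cell.
  rewrite {1}(respects_cells z0 rf); apply/funext => x.
  by rewrite (reindex (@enum_val _ (mem {: {ffun 'I_n -> {set I}}})))//; exact/onW_bij/enum_val_bij.
have := linear_extP MM e1; congr (N (_ - _)).
by rewrite [RHS](reindex (@enum_val _ (mem {: {ffun 'I_n -> {set I}}})))//; exact/onW_bij/enum_val_bij.
Qed.

End linear_ext.

(** * Cumulants and derivatives of the characteristic function *)

Section complex_derivative.
Context {R : realType}.
Local Notation C := R[i].
Local Notation Re := complex.Re.
Local Notation Im := complex.Im.
Implicit Types (F G : R -> C).

Lemma cReM (x y : C) : @complex.Re R (x * y) = Re x * Re y - Im x * Im y.
Proof. by case: x; case: y. Qed.

Lemma cImM (x y : C) : @complex.Im R (x * y) = Re x * Im y + Im x * Re y.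
Proof. by case: x => a b; case: y => c d /=; ring. Qed.

Lemma cReD (x y : C) : @complex.Re R (x + y) = Re x + Re y.
Proof. by case: x; case: y. Qed.

Lemma cImD (x y : C) : @complex.Im R (x + y) = Im x + Im y.
Proof. by case: x; case: y. Qed.

Lemma cReN (x : C) : @complex.Re R (- x) = - Re x. Proof. by case: x. Qed.

Lemma cImN (x : C) : @complex.Im R (- x) = - Im x. Proof. by case: x. Qed.

(** The derivative is taken at 0 only, since partial derivatives are derivatives along a line
    parametrized to start at the given point. *)
Definition cderiv F (l : C) : Prop :=
  is_derive (0 : R) 1 (fun h => Re (F h)) (Re l) /\
  is_derive (0 : R) 1 (fun h => Im (F h)) (Im l).

Lemma is_derive_eqfun (f g : R -> R) (x df dg : R) : is_derive x 1 f df -> f = g -> df = dg ->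
  is_derive x 1 g dg.
Proof. by move=> h <- <-. Qed.

Lemma cderivD F G l m : cderiv F l -> cderiv G m -> cderiv (fun h => F h + G h) (l + m).
Proof.
move=> [f1 f2] [g1 g2]; split.
  apply: (is_derive_eqfun (is_deriveD f1 g1)); last by case: (l); case: (m).
  by apply/funext => h; rewrite cReD.
apply: (is_derive_eqfun (is_deriveD f2 g2)); last by case: (l); case: (m).
by apply/funext => h; rewrite cImD.
Qed.

Lemma cderiv_cst c : cderiv (fun=> c) 0.
Proof. by split; exact: is_derive_cst. Qed.

Lemma cderivM F G l m : cderiv F l -> cderiv G m ->
  cderiv (fun h => F h * G h) (l * G 0 + F 0 * m).
Proof.
move=> [f1 f2] [g1 g2]; split.
  apply: (is_derive_eqfun (is_deriveB (is_deriveM f1 g1) (is_deriveM f2 g2))).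
    by apply/funext => h; rewrite cReM.
  by rewrite cReD !cReM /GRing.scale/=; ring.
apply: (is_derive_eqfun (is_deriveD (is_deriveM f1 g2) (is_deriveM f2 g1))).
  by apply/funext => h; rewrite cImM.
by rewrite cImD !cImM /GRing.scale/=; ring.
Qed.

Lemma is_derive_comp1 (f g : R -> R) (a b : R) : is_derive (g 0) 1 f a ->
  is_derive (0 : R) 1 g b -> is_derive (0 : R) 1 (fun h => f (g h)) (a * b).
Proof. exact: is_derive1_comp. Qed.

Lemma is_derive_inv1 (f : R -> R) (a : R) : f 0 != 0 -> is_derive (0 : R) 1 f a ->
  is_derive (0 : R) 1 (fun h => (f h)^-1) (- a / f 0 ^+ 2).
Proof.
move=> f0 fa; apply: (is_derive_eqfun (is_deriveV f0 fa)) => //.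
by rewrite /GRing.scale/=; field.
Qed.

Lemma is_derive_near1 (f g : R -> R) (a : R) : (\forall h \near (0 : R), f h = g h) ->
  is_derive (0 : R) 1 f a -> is_derive (0 : R) 1 g a.
Proof. exact: near_eq_is_derive. Qed.

Lemma cderiv_near F G l : (\forall h \near (0 : R), F h = G h) -> cderiv F l -> cderiv G l.
Proof.
move=> FG [f1 f2]; split.
  by apply: is_derive_near1 f1; apply: filterS FG => h ->.
by apply: is_derive_near1 f2; apply: filterS FG => h ->.
Qed.

Lemma is_derive_continuous1 (f : R -> R) (a : R) : is_derive (0 : R) 1 f a -> {for 0, continuous f}.
Proof. by move=> [df _]; apply/differentiable_continuous/derivable1_diffP. Qed.

Lemma normc2_gt0 (w : C) : w != 0 -> 0 < Re w ^+ 2 + Im w ^+ 2.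
Proof.
case: w => a b; rewrite eq_complex /= negb_and => /orP[a0|b0].
  by rewrite ltr_pwDl ?sqr_ge0// lt_neqAle sqr_ge0 andbT eq_sym sqrf_eq0.
by rewrite ltr_wpDl ?sqr_ge0// lt_neqAle sqr_ge0 andbT eq_sym sqrf_eq0.
Qed.

Lemma cinvE (w : C) : w^-1 = Complex (Re w / (Re w ^+ 2 + Im w ^+ 2)) (- (Im w / (Re w ^+ 2 + Im w ^+ 2))).
Proof. by case: w. Qed.

Lemma is_derive_normc2 F l : cderiv F l ->
  is_derive (0 : R) 1 (fun h => Re (F h) ^+ 2 + Im (F h) ^+ 2)
    (2 * (Re (F 0) * Re l + Im (F 0) * Im l)).
Proof.
move=> [f1 f2].
apply: (is_derive_eqfun (is_deriveD (is_deriveM f1 f1) (is_deriveM f2 f2))).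
  by apply/funext => h; rewrite !expr2.
by rewrite /GRing.scale/=; ring.
Qed.

Lemma cderivV F l : F 0 != 0 -> cderiv F l -> cderiv (fun h => (F h)^-1) (- l / F 0 ^+ 2).
Proof.
move=> F0 dF; have n0 := normc2_gt0 F0; have [f1 f2] := dF.
have n0' : Re (F 0) ^+ 2 + Im (F 0) ^+ 2 != 0 by rewrite gt_eqF.
have dn := is_derive_inv1 n0' (is_derive_normc2 dF).
have e : - l / F 0 ^+ 2 = - l * (F 0)^-1 * (F 0)^-1 by rewrite -mulrA -exprVn expr2.
split.
  apply: (is_derive_eqfun (is_deriveM f1 dn)).
    by apply/funext => h; rewrite [in RHS]cinvE.
  by rewrite e !cReM !cImM ?cReN ?cImN !cinvE /= /GRing.scale/=; field.
apply: (is_derive_eqfun (is_deriveN (is_deriveM f2 dn))).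
  by apply/funext => h; rewrite [in RHS]cinvE.
by rewrite e !cImM !cReM ?cReN ?cImN !cinvE /= /GRing.scale/=; field.
Qed.

(** In the right half-plane the cosine of the argument is positive, so the argument lies between
    [-pi/2] and [pi/2], where [atan] inverts [tan]. *)
Lemma carg_atan (w : C) : 0 < Re w -> carg w = atan (Im w / Re w).
Proof.
move=> w0; have wn0 : w != 0.
  by apply: contraTneq w0 => ->; rewrite /= ltxx.
have [/andP[c1 c2] cR cI] := cargP wn0.
have m0 : 0 < cmod w by rewrite sqrtr_gt0 normc2_gt0.
have cc : 0 < cos (carg w) by rewrite -(pmulr_rgt0 _ m0) cR.
have p0 : 0 < (pi : R) := pi_gt0 R.
have bnd x : 0 <= x -> x <= pi -> 0 < cos x -> x < pi / 2 :> R.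
  move=> x0 xpi cx; rewrite -ltr_cos ?cos_pihalf// in_itv/= ?x0 ?xpi//.
  by apply/andP; split; lra.
have hb : - (pi / 2) < carg w < pi / 2.
  have [c0|c0] := leP 0 (carg w).
    by rewrite bnd// andbT (lt_le_trans _ c0)// oppr_lt0 divr_gt0.
  rewrite (lt_trans c0) ?divr_gt0// andbT -ltrNl bnd ?cosN//; lra.
rewrite -[LHS]tanK ?in_itv//=; congr atan.
by rewrite /tan -cR -cI -mulf_div divff ?mul1r// gt_eqF.
Qed.

Lemma cderiv_log F l : 0 < Re (F 0) -> cderiv F l -> cderiv (fun h => clog (F h)) (l / F 0).
Proof.
move=> F0 dF; have [f1 f2] := dF.
have Fn0 : F 0 != 0 by apply: contraTneq F0 => ->; rewrite /= ltxx.
have n0 := normc2_gt0 Fn0.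
have nearF : \forall h \near (0 : R), 0 < Re (F h).
  exact: (cvgr_gt _ (is_derive_continuous1 f1)).
(* Near 0 the function stays in the right half-plane, where its logarithm has this expression, free
   of square roots and case distinctions. *)
apply: (@cderiv_near (fun h => Complex (2^-1 * ln (Re (F h) ^+ 2 + Im (F h) ^+ 2))
    (atan (Im (F h) / Re (F h))))).
  apply: filterS nearF => h Fh; rewrite /clog carg_atan//; congr Complex.
  rewrite /cmod -{1}(sqr_sqrtr (a := Re (F h) ^+ 2 + Im (F h) ^+ 2)) ?addr_ge0 ?sqr_ge0//.
  have s0 : 0 < Num.sqrt (Re (F h) ^+ 2 + Im (F h) ^+ 2).
    by rewrite sqrtr_gt0 normc2_gt0//; apply: contraTneq Fh => ->; rewrite /= ltxx.
  by rewrite lnXn//; move: (ln _) => t; lra.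
have R0 : Re (F 0) != 0 by rewrite gt_eqF.
split => /=.
  apply: (is_derive_eqfun (is_deriveM (is_derive_cst (2^-1 : R) (0 : R) (1 : R))
    (is_derive_comp1 (is_derive1_ln n0) (is_derive_normc2 dF)))) => //.
  by rewrite cReM !cinvE /= /GRing.scale/=; field; rewrite gt_eqF.
have d2 : is_derive (0 : R) 1 (fun h => Im (F h) / Re (F h))
    ((Im l * Re (F 0) - Im (F 0) * Re l) / Re (F 0) ^+ 2).
  apply: (is_derive_eqfun (is_deriveM f2 (is_derive_inv1 R0 f1))) => //.
  by rewrite /GRing.scale/=; field.
apply: (is_derive_eqfun (is_derive_comp1 (is_derive1_atan _) d2)) => //.
rewrite cImM !cinvE /=.
have n0' : Re (F 0) ^+ 2 + Im (F 0) ^+ 2 != 0 by rewrite gt_eqF.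
by field; rewrite R0 n0'.
Qed.

End complex_derivative.

(** * Iterated partial derivatives and Leibniz' rule *)

Section partial_derivatives.
Context {R : realType} (k : nat).
Local Notation C := R[i].
Local Notation Re := complex.Re.
Local Notation Im := complex.Im.
Implicit Types (F G : 'rV[R]_k -> C) (z : 'rV[R]_k).

Definition has_partial (j : 'I_k) F z (l : C) : Prop :=
  cderiv (fun h : R => F (h *: delta_mx 0 j + z)) l.

Lemma is_derive_line (f : 'rV[R]_k -> R) (z v : 'rV[R]_k) (l : R) :
  is_derive (0 : R) 1 (fun h : R => f (h *: v + z)) l -> is_derive z v f l.
Proof.
move=> [df <-]; apply: DeriveDef; first exact/derivable1P.
rewrite /derive; congr (lim _).
suff -> : (fun h : R => h^-1 *: ((f \o shift z) (h *: v) - f z)) =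
  (fun h : R => h^-1 *: (((fun h : R => f (h *: v + z)) \o shift 0) (h *: 1) -
                     f (0 *: v + z))) by [].
by apply/funext => h /=; rewrite addr0 scale0r add0r [_%:A]mulr1.
Qed.

Lemma has_partialE j F z l : has_partial j F z l -> partialC j F z = l.
Proof.
move=> [h1 h2]; rewrite /partialC.
have [_ e1] := is_derive_line (f := fun y => Re (F y)) h1.
have [_ e2] := is_derive_line (f := fun y => Im (F y)) h2.
by rewrite [X in Complex X _]e1 [X in Complex _ X]e2; case: (l).
Qed.

Lemma has_partialD j F G z l m : has_partial j F z l -> has_partial j G z m ->
  has_partial j (fun y => F y + G y) z (l + m).
Proof. exact: cderivD. Qed.

Lemma has_partialM j F G z l m : has_partial j F z l -> has_partial j G z m ->
  has_partial j (fun y => F y * G y) z (l * G z + F z * m).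
Proof. by move=> h1 h2; have := cderivM h1 h2; rewrite scale0r add0r. Qed.

Lemma has_partialV j F z l : F z != 0 -> has_partial j F z l ->
  has_partial j (fun y => (F y)^-1) z (- l / F z ^+ 2).
Proof.
move=> F0 h1; rewrite -[z in - l / F z ^+ 2]add0r -(scale0r (delta_mx 0 j)).
by apply: cderivV h1; rewrite scale0r add0r.
Qed.

Lemma has_partial_log j F z l : 0 < Re (F z) -> has_partial j F z l ->
  has_partial j (fun y => clog (F y)) z (l / F z).
Proof.
move=> F0 h1; rewrite -[z in l / F z]add0r -(scale0r (delta_mx 0 j)).
by apply: cderiv_log h1; rewrite scale0r add0r.
Qed.

Lemma has_partial_cst j (c : C) z : has_partial j (fun=> c) z 0.
Proof. exact: cderiv_cst. Qed.

Variable W : set 'rV[R]_k.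
(* Openness along the coordinate lines is all that iterated partial derivatives require. *)
Hypothesis openW : forall z (j : 'I_k), W z -> \forall h \near (0 : R), W (h *: delta_mx 0 j + z).

Lemma has_partial_eqon j F G z l : W z -> (forall y, W y -> F y = G y) ->
  has_partial j F z l -> has_partial j G z l.
Proof.
move=> Wz FG; apply: cderiv_near; apply: filterS (openW j Wz) => h; exact: FG.
Qed.

(** Existence of iterated partial derivatives on [W]. They are always taken in the order of a list,
    so that the symmetry of mixed derivatives never comes up. *)
Fixpoint smooth_upto (m : nat) F : Prop :=
  if m is m'.+1 then exists G : 'I_k -> 'rV[R]_k -> C,
    (forall j z, W z -> has_partial j F z (G j z)) /\ (forall j, smooth_upto m' (G j))
  else True.

Definition smooth F := forall m, smooth_upto m F.

Lemma smooth_upto_eqon m F G : (forall y, W y -> F y = G y) -> smooth_upto m F -> smooth_upto m G.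
Proof.
case: m => //= m FG [D [h1 h2]]; exists D; split => // j z Wz.
exact: (has_partial_eqon Wz FG (h1 j z Wz)).
Qed.

Lemma smooth_uptoS m F : smooth_upto m.+1 F -> smooth_upto m F.
Proof.
elim: m F => [//|m IH] F [D [h1 h2]]; exists D; split => // j.
exact: IH (h2 j).
Qed.

Lemma smooth_uptoD m F G : smooth_upto m F -> smooth_upto m G ->
  smooth_upto m (fun y => F y + G y).
Proof.
elim: m F G => [//|m IH] F G [D [h1 h2]] [E [g1 g2]].
exists (fun j y => D j y + E j y); split=> [j z Wz|j]; last by apply: IH; [exact: h2|exact: g2].
by apply: has_partialD; [exact: h1|exact: g1].
Qed.

Lemma smooth_uptoM m F G : smooth_upto m F -> smooth_upto m G ->
  smooth_upto m (fun y => F y * G y).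
Proof.
elim: m F G => [//|m IH] F G sF sG; have sF' := smooth_uptoS sF; have sG' := smooth_uptoS sG.
move: sF sG => [D [h1 h2]] [E [g1 g2]].
exists (fun j y => D j y * G y + F y * E j y); split=> [j z Wz|j].
  by apply: has_partialM; [exact: h1|exact: g1].
by apply: smooth_uptoD; apply: IH => //; [exact: h2|exact: g2].
Qed.

Lemma smooth_upto_cst m c : smooth_upto m (fun=> c).
Proof.
elim: m c => [//|m IH] c; exists (fun _ _ => 0); split => // j z _.
exact: has_partial_cst.
Qed.

(** The partial derivatives of [1/F] are products of those of [F] with two factors [1/F], which are
    smooth to the previous order by induction. *)
Lemma smooth_uptoV m F : (forall y, W y -> F y != 0) -> smooth_upto m F ->
  smooth_upto m (fun y => (F y)^-1).
Proof.
move=> F0; elim: m => [//|m IH] sF; have sV := IH (smooth_uptoS sF).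
move: sF => [D [h1 h2]].
exists (fun j y => (-1 * D j y) * ((F y)^-1 * (F y)^-1)); split=> [j z Wz|j].
  have := has_partialV (F0 z Wz) (h1 j z Wz).
  by rewrite mulN1r -exprVn expr2.
by apply: smooth_uptoM; apply: smooth_uptoM => //; [exact: smooth_upto_cst|exact: h2].
Qed.

Lemma smooth_partial j F : smooth F ->
  (forall z, W z -> has_partial j F z (partialC j F z)) /\ smooth (partialC j F).
Proof.
move=> sF; split.
  by move=> z Wz; have [D [h1 _]] := sF 1%N; rewrite (has_partialE (h1 j z Wz)); exact: h1.
move=> m; have [D [h1 h2]] := sF m.+1.
by apply: smooth_upto_eqon (h2 j) => y Wy; rewrite (has_partialE (h1 j y Wy)).
Qed.

Local Notation D l F := (foldr (@partialC R k) F l).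

Lemma smoothM F G : smooth F -> smooth G -> smooth (fun y => F y * G y).
Proof. by move=> sF sG m; exact: smooth_uptoM. Qed.

Lemma smoothD F G : smooth F -> smooth G -> smooth (fun y => F y + G y).
Proof. by move=> sF sG m; exact: smooth_uptoD. Qed.

Lemma smoothV F : (forall y, W y -> F y != 0) -> smooth F -> smooth (fun y => (F y)^-1).
Proof. by move=> F0 sF m; exact: smooth_uptoV. Qed.

Lemma smooth_D l F : smooth F -> smooth (D l F).
Proof. by move=> sF; elim: l => [//|j l IH] /=; have [] := smooth_partial j IH. Qed.

Lemma partialC_eqon j F G z : smooth F -> (forall y, W y -> F y = G y) -> W z ->
  partialC j F z = partialC j G z.
Proof.
move=> sF FG Wz; have [h _] := smooth_partial j sF.
by rewrite (has_partialE (has_partial_eqon Wz FG (h z Wz))).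
Qed.

Lemma D_eqon l F G : smooth F -> (forall y, W y -> F y = G y) ->
  forall z, W z -> D l F z = D l G z.
Proof.
move=> sF FG; elim: l => [|j l IH] /= z Wz; first exact: FG.
by apply: partialC_eqon => //; exact: smooth_D.
Qed.

Lemma D_add l F G : smooth F -> smooth G -> forall z, W z ->
  D l (fun y => F y + G y) z = D l F z + D l G z.
Proof.
move=> sF sG; elim: l => [//|j l IH] z Wz /=.
have sFG : smooth (D l (fun y => F y + G y)) by apply: smooth_D; exact: smoothD.
rewrite (partialC_eqon j sFG IH Wz); apply: has_partialE.
have [hf _] := smooth_partial j (smooth_D l sF).
have [hg _] := smooth_partial j (smooth_D l sG).
by apply: has_partialD; [exact: hf|exact: hg].
Qed.

Lemma D_scale l c F : smooth F -> forall z, W z -> D l (fun y => c * F y) z = c * D l F z.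
Proof.
move=> sF; elim: l => [//|j l IH] z Wz /=.
have sc : smooth (D l (fun y => c * F y)).
  by apply: smooth_D; apply: smoothM => // m; exact: smooth_upto_cst.
rewrite (partialC_eqon j sc IH Wz); apply: has_partialE.
rewrite -[c * _]add0r -[X in X + _](mul0r (D l F z)).
apply: has_partialM; first exact: has_partial_cst.
by have [h _] := smooth_partial j (smooth_D l sF); apply: h.
Qed.

Lemma D_rcons l j F : D (rcons l j) F = D l (partialC j F).
Proof. by rewrite foldr_rcons. Qed.

(** Induction on the last variable, which is differentiated first: the product rule applies to [F]
    and [G] themselves, and the two resulting terms correspond to the sets [T] with and without that
    variable. *)
Lemma D_leibniz l F G z : uniq l -> smooth F -> smooth G -> W z ->
  D l (fun y => F y * G y) z =
  \sum_(T : {set 'I_k} | T \subset l) D [seq j <- l | j \in T] F z * D [seq j <- l | j \notin T] G z.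
Proof.
elim/last_ind: l F G z => [|l j IH] F G z ul sF sG Wz.
  rewrite (big_pred1 finset.set0)//= => T; apply/fintype.subsetP/eqP => [h|->].
    by apply/finset.setP => i; rewrite inE; apply/negP => /h.
  by move=> i; rewrite inE.
move: ul; rewrite rcons_uniq => /andP[jl ul].
have [hF sF'] := smooth_partial j sF; have [hG sG'] := smooth_partial j sG.
rewrite D_rcons.
have sFG := smoothM sF sG.
have [hFG sFG'] := smooth_partial j sFG.
rewrite (@D_eqon l _ (fun y => partialC j F y * G y + F y * partialC j G y))//; last first.
  by move=> y Wy; apply: has_partialE; apply: has_partialM; [exact: hF|exact: hG].
rewrite D_add//; [|exact: smoothM..].
rewrite !IH// [RHS](bigID (fun T : {set 'I_k} => j \in T))/=; congr (_ + _).
  rewrite [RHS](reindex_onto (fun T => j |: T)%SET (fun T => T :\ j)%SET)/=; last first.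
    by move=> T /andP[_ jT]; exact: finset.setD1K.
  apply: eq_big => T.
    rewrite !inE eqxx/= andbT.
    apply/fintype.subsetP/andP => [h|[/fintype.subsetP h /eqP e] i iT].
      split.
        apply/fintype.subsetP => i; rewrite !inE mem_rcons inE => /orP[->//|/h ->].
        by rewrite orbT.
      by rewrite setU1K//; apply: contra jl => /h.
    have ij : i != j by move: iT; rewrite -e !inE => /andP[].
    have := h i; rewrite !inE iT orbT => /(_ isT); rewrite mem_rcons inE (negbTE ij).
    exact.
  move=> /fintype.subsetP Tl.
  rewrite !filter_rcons !inE eqxx/= D_rcons; congr (D _ _ z * D _ _ z).
    by apply: eq_in_filter => i il; rewrite !inE; case: eqP jl => // <-; rewrite il.
  by apply: eq_in_filter => i il; rewrite !inE; case: eqP jl => // <-; rewrite il.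
apply: eq_big => T.
  apply/fintype.subsetP/andP => [h|[/fintype.subsetP h jT] i iT].
    split; last by apply: contra jl => /h.
    by apply/fintype.subsetP => i iT; rewrite mem_rcons inE h ?orbT.
  have := h i iT; rewrite mem_rcons inE => /predU1P[e|//].
  by move: jT; rewrite -e iT.
move=> /fintype.subsetP Tl.
have jT : j \notin T by apply: contra jl => /Tl.
by rewrite !filter_rcons jT (negbTE jT) D_rcons.
Qed.

End partial_derivatives.

Section charfun_derivatives.
Context {R : realType} {d : measure_display} {Omega : measurableType d}.
Variable P : probability Omega R.
Local Notation C := R[i].
Local Notation Re := complex.Re.
Local Notation Im := complex.Im.
Local Notation Ci := (Complex (0 : R) 1).

(** Differentiation under the integral sign, with [|Y A|] dominating the derivatives in [h]; it is
    applied to the cosine and the sine. *)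
Lemma is_derive_mean (c c' : R -> R) (Y A T : Omega -> R) :
  (forall x : R, is_derive (x : R) 1 c (c' x)) -> (forall x, `|c x| <= 1) -> (forall x, `|c' x| <= 1) ->
  has_moments P Y -> has_moments P A -> measurable_fun setT T ->
  is_derive (0 : R) 1 (fun h : R => mean P (fun w => Y w * c (h * A w + T w)))
    (mean P (fun w => Y w * A w * c' (T w))).
Proof.
move=> dc c1 c'1 mY mA mT.
pose f (h : R) w := Y w * c (h * A w + T w).
have mc : measurable_fun setT c.
  apply: continuous_measurable_fun => x; apply/differentiable_continuous/derivable1_diffP.
  by case: (dc x).
have mf h : has_moments P (f h).
  apply: has_momentsM => //; apply: (@has_moments_bounded _ _ _ _ _ 1) => //.
  apply: measurableT_comp => //; apply: measurable_funD => //.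
  by apply: measurable_funM => //; case: mA.
have df w (x : R) : is_derive (x : R) 1 (f ^~ w) (Y w * A w * c' (x * A w + T w)).
  have d1 : is_derive (x : R) 1 (fun h : R => h * A w + T w) (A w).
    have := is_deriveD (is_deriveM (is_derive_id x (1:R)) (is_derive_cst (A w) x (1:R))) (is_derive_cst (T w) x (1 : R)).
    move/is_derive_eqfun; apply => //.
    by rewrite /GRing.scale/= mulr0 add0r mulr1 addr0.
  have := is_deriveM (is_derive_cst (Y w) x (1:R)) (@is_derive1_comp _ c (fun h => h * A w + T w) x _ _ (dc _) d1).
  move/is_derive_eqfun; apply => //.
  by rewrite /GRing.scale/= mulr0 addr0; ring.
have I0 : `]-1, 1[%classic (0 : R) by rewrite /= in_itv/= oppr_lt0 ltr01.
have ub x w : `]-1, 1[%classic x -> setT w -> `|partial1of2 f x w| <= `|Y w * A w|.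
  move=> _ _; rewrite partial1of2E; have [_ ->] := df w x.
  by rewrite normrM ler_piMr.
have intf x : `]-1, 1[%classic x -> P.-integrable setT (EFin \o f x).
  by move=> _; exact: has_moments_integrable.
have derf x w : `]-1, 1[%classic x -> setT w -> derivable (f ^~ w) x 1.
  by move=> _ _; case: (df w x).
have iG : P.-integrable setT (EFin \o (fun w => `|Y w * A w|)).
  by apply: has_moments_integrable; apply: has_moments_norm; exact: has_momentsM.
have h1 := derivable_under_integral measurableT I0 intf derf (fun w => normr_ge0 _) iG ub.
have h2 := differentiation_under_integral measurableT I0 intf derf (fun w => normr_ge0 _) iG ub.
have fE : (fun h : R => mean P (fun w => Y w * c (h * A w + T w))) = (fun h => \int[P]_w f h w).
  by apply/funext => h; rewrite meanE.
rewrite fE; apply: DeriveDef => //; rewrite -derive1E h2 meanE.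
apply: eq_Rintegral => w _; rewrite partial1of2E; have [_ ->] := df w 0.
by rewrite mul0r add0r.
Qed.

Variables (k : nat) (X : 'I_k -> Omega -> R).
Hypothesis mX : forall j, has_moments P (X j).

Definition phase (z : 'rV[R]_k) w := \sum_(l < k) z 0 l * X l w.

(** This is [E[Y exp(i sum_l z_l X_l)]]. The weight [Y] makes the family stable: the [j]-th partial
    derivative multiplies [Y] by [i X_j]. *)
Definition wcharfun (Y : Omega -> R) (z : 'rV[R]_k) : C :=
  Complex (mean P (fun w => Y w * cos (phase z w))) (mean P (fun w => Y w * sin (phase z w))).

Lemma measurable_phase z : measurable_fun setT (phase z).
Proof.
by apply: has_moments_measurable; apply: has_moments_sum => l _; exact: has_momentsZ.
Qed.

Lemma charfunE : charfun P X = wcharfun (fun=> 1).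
Proof.
apply/funext => z; rewrite /charfun /expectationC /wcharfun; congr Complex.
  by congr mean; apply/funext => w; rewrite mul1r.
by congr mean; apply/funext => w; rewrite mul1r.
Qed.

Lemma phase_line z j h w : phase (h *: delta_mx 0 j + z) w = h * X j w + phase z w.
Proof.
rewrite /phase.
under eq_bigr do rewrite !mxE eqxx/= mulrDl.
rewrite big_split/= (bigD1 j)//= eqxx mulr1 big1 ?addr0// => l lj.
by rewrite (negbTE lj) mulr0 mul0r.
Qed.

Lemma has_partial_wcharfun Y j z : has_moments P Y ->
  has_partial j (wcharfun Y) z (Ci * wcharfun (fun w => Y w * X j w) z).
Proof.
move=> mY; have c1 (x : R) : `|cos x| <= 1 by rewrite ler_norml cos_geN1 cos_le1.
have s1 (x : R) : `|sin x| <= 1 by rewrite ler_norml sin_geN1 sin_le1.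
have ns1 (x : R) : `|- sin x| <= 1 by rewrite normrN.
split.
  have := is_derive_mean (c := cos) (c' := fun x => - sin x) (@is_derive_cos R) c1 ns1 mY (mX j) (measurable_phase z).
  move/is_derive_eqfun; apply.
    by apply/funext => h /=; congr mean; apply/funext => w; rewrite phase_line.
  rewrite cReM /= mul0r mul1r sub0r -mulN1r -meanZ.
    by congr mean; apply/funext => w; rewrite mulrN mulN1r.
  apply: has_momentsM; first exact: has_momentsM.
  apply: (@has_moments_bounded _ _ _ _ _ 1) => //.
  apply: measurableT_comp; last exact: measurable_phase.
  by apply: continuous_measurable_fun; exact: continuous_sin.
have := is_derive_mean (c := sin) (c' := cos) (@is_derive_sin R) s1 c1 mY (mX j) (measurable_phase z).
move/is_derive_eqfun; apply.
  by apply/funext => h /=; congr mean; apply/funext => w; rewrite phase_line.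
by rewrite cImM /= mul0r mul1r add0r.
Qed.

Lemma wcharfun0 Y : wcharfun Y 0 = Complex (mean P Y) 0.
Proof.
have p0 w : phase 0 w = 0 by rewrite /phase big1// => l _; rewrite mxE mul0r.
rewrite /wcharfun; congr Complex.
  by congr mean; apply/funext => w; rewrite p0 cos0 mulr1.
by rewrite -[RHS](mean_cst P 0); congr mean; apply/funext => w; rewrite p0 sin0 mulr0.
Qed.

(** A set containing 0 on which the characteristic function does not vanish and its principal
    logarithm has partial derivatives. *)
Definition dom : set 'rV[R]_k := [set z | 0 < Re (wcharfun (fun=> 1) z)].

Lemma dom0 : dom 0.
Proof. by rewrite /dom /mkset wcharfun0 /= mean_cst. Qed.

Lemma dom_open z (j : 'I_k) : dom z -> \forall h \near (0 : R), dom (h *: delta_mx 0 j + z).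
Proof.
move=> Dz; have [h1 _] := has_partial_wcharfun j z (has_moments_cst P 1).
apply: (cvgr_gt _ (is_derive_continuous1 h1)).
by rewrite scale0r add0r.
Qed.

Lemma dom_neq0 z : dom z -> wcharfun (fun=> 1) z != 0.
Proof. by rewrite /dom /mkset; apply: contraTneq => ->; rewrite ltxx. Qed.

Lemma smooth_wcharfun Y : has_moments P Y -> smooth dom (wcharfun Y).
Proof.
move=> mY m; elim: m Y mY => [//|m IH] Y mY.
exists (fun j z => Ci * wcharfun (fun w => Y w * X j w) z); split.
  by move=> j z _; exact: has_partial_wcharfun.
move=> j; apply: smooth_uptoM; first exact: smooth_upto_cst.
by apply: IH; exact: has_momentsM.
Qed.

Local Notation D l F := (foldr (@partialC R k) F l).

Lemma D_wcharfun l Y : has_moments P Y -> forall z, dom z ->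
  D l (wcharfun Y) z = Ci ^+ size l * wcharfun (fun w => Y w * \prod_(j <- l) X j w) z.
Proof.
move=> mY; elim: l => [|j l IH] z Wz /=.
  by rewrite expr0 mul1r; congr (wcharfun _ z); apply/funext => w; rewrite big_nil mulr1.
rewrite (partialC_eqon dom_open j (smooth_D dom_open _ (smooth_wcharfun mY)) IH Wz).
apply: has_partialE.
have mYl : has_moments P (fun w => Y w * \prod_(j <- l) X j w).
  by apply: has_momentsM => //; exact: has_moments_prod.
have := has_partialM (has_partial_cst j (Ci ^+ size l) z) (has_partial_wcharfun j z mYl).
rewrite mul0r add0r mulrA -exprSr.
congr (has_partial _ _ _ (_ * _)).
congr (wcharfun _ z); apply/funext => w; rewrite big_cons; ring.
Qed.

End charfun_derivatives.

Section cumulant_recursion.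
Context {R : realType} {d : measure_display} {Omega : measurableType d}.
Variable P : probability Omega R.
Local Notation C := R[i].
Local Notation Ci := (Complex (0 : R) 1).

Lemma Ci2 : Complex (0 : R) (-1) * Ci = 1 :> C.
Proof. by apply/eqP; rewrite eq_complex /= !mul0r mulN1r !opprK add0r mulr0 addr0 !eqxx. Qed.

(* With [psi] the characteristic function and [Q] the last partial derivative of [log psi],
   Leibniz' rule applied to [Q psi] at [0] gives the recursion satisfied by [kap]. *)
Lemma cumulant_unique k (X : 'I_k.+1 -> Omega -> R) (kap : {set 'I_k.+1} -> R) :
  (forall j, has_moments P (X j)) ->
  (forall S : {set 'I_k.+1}, ord_max \in S -> mean P (fun w => \prod_(j in S) X j w) =
     \sum_(T : {set 'I_k.+1} | (T \subset S) && (ord_max \in T))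
        kap T * mean P (fun w => \prod_(j in S :\: T) X j w)) ->
  cumulant P X = real_complex R (kap [set: 'I_k.+1]%SET).
Proof.
move=> mX rec.
pose j0 : 'I_k.+1 := ord_max.
pose W := dom P X.
have oW := dom_open mX.
pose psi := wcharfun P X (fun=> 1).
pose psi1 := fun z => Ci * wcharfun P X (X j0) z.
have m1 := has_moments_cst P (1 : R).
have s0 : smooth W psi by exact: smooth_wcharfun.
have s1 : smooth W psi1.
  by apply: smoothM => [m|]; [exact: smooth_upto_cst|exact: smooth_wcharfun].
pose Q z := psi1 z / psi z.
have sQ : smooth W Q.
  apply: smoothM => //; apply: smoothV => // y; exact: dom_neq0.
have W0 : W 0 := dom0 P X.
(* All the indices but the last, in the order in which [mixed_partial] lists them. *)
pose l := [seq widen_ord (leqnSn k) i | i <- enum 'I_k].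
have enumE : enum 'I_k.+1 = rcons l j0 by rewrite enum_ordSr.
have ul : uniq l.
  by have := enum_uniq 'I_k.+1; rewrite enumE rcons_uniq => /andP[].
have jl : j0 \notin l.
  by have := enum_uniq 'I_k.+1; rewrite enumE rcons_uniq => /andP[].
have ml i : i != j0 -> i \in l.
  by have := mem_enum 'I_k.+1 i; rewrite enumE mem_rcons inE => /orP[->//|].
pose D (l : seq 'I_k.+1) F := foldr (@partialC R k.+1) F l.
pose mS (S : {set 'I_k.+1}) := mean P (fun w => \prod_(j in S) X j w).
(* For [T] containing [j0] this is the joint cumulant of the [X j] with [j] in [T]: the derivative
   in [j0] is already in [Q]. *)
pose kp (T : {set 'I_k.+1}) : C := Complex (0 : R) (-1) ^+ #|T| * D [seq j <- l | j \in T] Q 0.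
have Cin n : Complex (0 : R) (-1) ^+ n * Ci ^+ n = 1 :> C by rewrite -exprMn Ci2 expr1n.
have seqE (A : {set 'I_k.+1}) (r : seq 'I_k.+1) : uniq r -> (forall j, (j \in r) = (j \in A)) ->
    forall w, \prod_(j <- r) X j w = \prod_(j in A) X j w.
  by move=> ur rA w; rewrite big_uniq//=; apply: eq_bigl => j; rewrite rA.
have sizeE (A : {set 'I_k.+1}) (r : seq 'I_k.+1) : uniq r -> (forall j, (j \in r) = (j \in A)) ->
    size r = #|A|.
  by move=> ur rA; rewrite -(card_uniqP ur); apply: eq_card => j; rewrite rA.
have main (S : {set 'I_k.+1}) : j0 \in S -> real_complex R (mS S) =
    \sum_(T : {set 'I_k.+1} | (T \subset S) && (j0 \in T)) kp T * real_complex R (mS (S :\: T)%SET).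
  move=> jS; pose lS := [seq j <- l | j \in S].
  have ulS : uniq lS by exact: filter_uniq.
  have mlS j : (j \in lS) = (j \in (S :\ j0)%SET).
    rewrite mem_filter !inE andbC; case: (eqVneq j j0) => [->|/ml ->//].
    by rewrite (negbTE jl).
  have sS : #|S| = (size lS).+1 by rewrite (sizeE _ _ ulS mlS) [LHS](finset.cardsD1 j0) jS.
  have e1 : D lS (fun y => Q y * psi y) 0 = D lS psi1 0.
    apply: (D_eqon oW _ (smoothM sQ s0)) W0 => y Wy.
    by rewrite /Q divfK// dom_neq0.
  have e2 : D lS psi1 0 = Ci ^+ #|S| * real_complex R (mS S).
    rewrite /D (D_scale oW _ _ (smooth_wcharfun mX (mX j0)) W0) (D_wcharfun mX lS (mX j0) W0).
    rewrite mulrA -exprS -sS wcharfun0; congr (_ * Complex _ _); congr mean; apply/funext => w.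
    by rewrite (seqE _ _ ulS mlS) [RHS](big_setD1 j0).
  have e3 := D_leibniz oW ulS sQ s0 W0.
  rewrite -[LHS]mul1r -(Cin #|S|) -mulrA -e2 -e1 /D e3 big_distrr/=.
  rewrite [RHS](reindex_onto (fun T => j0 |: T)%SET (fun T => T :\ j0)%SET)/=; last first.
    by move=> T /andP[_ jT]; exact: finset.setD1K.
  apply: eq_big => T.
    rewrite !inE eqxx/= andbT finset.subUset finset.sub1set jS/=.
    apply/fintype.subsetP/andP => [h|[/fintype.subsetP h /eqP e] i iT].
      split; first by apply/fintype.subsetP => i /h; rewrite mlS !inE => /andP[].
      by rewrite setU1K//; apply/negP => /h; rewrite mlS !inE eqxx.
    by rewrite mlS !inE h// andbT; move: iT; rewrite -e !inE => /andP[].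
  move=> /fintype.subsetP Tl.
  have jT : j0 \notin T by apply/negP => /Tl; rewrite mlS !inE eqxx.
  have f1 : [seq j <- lS | j \in T] = [seq j <- l | j \in (j0 |: T)%SET].
    rewrite /lS -filter_predI; apply: eq_in_filter => j jl'; rewrite /= !inE.
    have -> : (j == j0) = false by apply/negP => /eqP e; move: jl; rewrite -e jl'.
    by case: (boolP (j \in T)) => //= /Tl; rewrite mlS !inE => /andP[].
  have uf2 : uniq [seq j <- lS | j \notin T] by exact: filter_uniq.
  have mf2 j : (j \in [seq j <- lS | j \notin T]) = (j \in (S :\: (j0 |: T))%SET).
    by rewrite mem_filter mlS !inE negb_or andbA; congr (_ && _); rewrite andbC.
  rewrite f1 (D_wcharfun mX _ m1 W0) wcharfun0 (sizeE _ _ uf2 mf2) /kp /D.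
  have -> : mean P (fun w => 1 * \prod_(j <- [seq j <- lS | j \notin T]) X j w) = mS (S :\: (j0 |: T))%SET.
    by congr mean; apply/funext => w; rewrite mul1r (seqE _ _ uf2 mf2).
  have cS : #|S| = (#|(j0 |: T)%SET| + #|(S :\: (j0 |: T))%SET|)%N.
    have sub : (j0 |: T)%SET \subset S.
      rewrite finset.subUset finset.sub1set jS/=.
      by apply/fintype.subsetP => i /Tl; rewrite mlS !inE => /andP[].
    by rewrite -[LHS](finset.cardsID (j0 |: T)%SET) (finset.setIidPr sub).
  rewrite cS exprD -!mulrA; congr (_ * _); rewrite mulrCA; congr (_ * _).
  by rewrite mulrA Cin mul1r.
(* [kp] and [kap] satisfy the same recursion, in which the term [T = S] has coefficient 1 and the
   others involve smaller sets. *)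
have kpE n (S : {set 'I_k.+1}) : (#|S| < n)%N -> j0 \in S -> kp S = real_complex R (kap S).
  elim: n S => [//|n IH] S Sn jS.
  have := main S jS; rewrite /mS (rec S jS) rmorph_sum/=.
  rewrite (bigD1 S)/=; last by rewrite fintype.subxx.
  rewrite [in X in _ = X -> _](bigD1 S)/=; last by rewrite fintype.subxx.
  have -> : mean P (fun w => \prod_(j in (S :\: S)%SET) X j w) = 1.
    by under eq_fun do rewrite finset.setDv finset.big_set0; rewrite mean_cst.
  rewrite mulr1 rmorph1 mulr1.
  rewrite [X in _ = _ + X](eq_bigr (fun T : {set 'I_k.+1} =>
    real_complex R (kap T * mean P (fun w => \prod_(j in (S :\: T)%SET) X j w)))).
    by move=> /addIr.
  move=> T /andP[/andP[TS jT] TnS]; rewrite rmorphM/= IH//.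
  rewrite -ltnS (leq_trans _ Sn)// ltnS; apply: proper_card.
  by rewrite finset.properEneq TnS.
rewrite -(kpE #|[set: 'I_k.+1]|%SET.+1)// ?inE// /cumulant /kp finset.cardsT card_ord.
congr (_ * _); rewrite /mixed_partial enumE foldr_rcons /D.
rewrite (_ : [seq j <- l | j \in _] = l); last by apply/all_filterP/allP => j _; rewrite inE.
(* On [W] the partial derivative of [log psi] in [j0] is [Q], so the remaining derivatives of the
   two agree at 0. *)
symmetry; apply: (D_eqon oW l sQ) W0 => y Wy.
rewrite charfunE; symmetry; apply: has_partialE.
have := has_partial_log (j := j0) (F := psi) Wy (l := Ci * wcharfun P X (fun w => 1 * X j0 w) y).
rewrite /Q /psi1 (_ : (fun w => 1 * X j0 w) = X j0); last by apply/funext => w; rewrite mul1r.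
apply; have := has_partial_wcharfun mX j0 y m1.
by rewrite (_ : (fun w => 1 * X j0 w) = X j0)//; apply/funext => w; rewrite mul1r.
Qed.

End cumulant_recursion.

(** * Products of multiple integrals *)

(** Balls of radii [1/(m+1)] around the points of a countable dense set: such a ball containing [x],
    with radius less than half the distance from [x] to [y], misses [y]. *)
Lemma polish_separating (R : realType) (Z : ptopologicalType) : polish R Z ->
  exists U : nat -> set (borel Z), (forall k, measurable (U k)) /\
    forall x y : borel Z, (forall k, U k x <-> U k y) -> x = y.
Proof.
move=> [[D [cD dD]] [dist [[d0 dE dS dT] dN _]]].
have [g ginj] : exists g : Z -> nat, {in D &, injective g}.
  by have /countable_injP[g gi] := cD; exists g.
pose ball (x : Z) (e : R) : set Z := [set y | dist x y < e].
have oball x e : open (ball x e).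
  rewrite openE => y yx; apply/dN; exists (e - dist x y); first by rewrite subr_gt0.
  by move=> u /= yu; rewrite /ball /= (le_lt_trans (dT x y u))// -ltrBrDl.
(* [g] is injective on [D], so the union has at most one center; codes of no pair give the empty
   set. *)
pose U k : set (borel Z) := if @unpickle (nat * nat)%type k is Some (q, m) then
  \bigcup_(x in [set x | D x /\ g x = q]) ball x m.+1%:R^-1 else set0.
exists U; split.
  move=> k; rewrite /U; case: unpickle => [[q m]|]; last exact: measurable0.
  by apply: sub_sigma_algebra; apply: bigcup_open => x _; exact: oball.
move=> x y xy; apply: contrapT => nxy.
have dpos : 0 < dist x y.
  by rewrite lt_neqAle d0 andbT eq_sym; apply/eqP => /dE.
pose e := dist x y / 2.
have e0 : 0 < e by rewrite divr_gt0.
have [m me] : exists m : nat, m.+1%:R^-1 < e.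
  exists (Num.trunc e^-1); rewrite invf_plt ?posrE//.
  by rewrite truncnS_gt.
have m0 : 0 < m.+1%:R^-1 :> R by rewrite invr_gt0.
have [u [xu Du]] : ball x m.+1%:R^-1 `&` D !=set0.
  apply: dD; last exact: oball.
  by exists x; rewrite /ball /=; have -> : dist x x = 0 by apply/dE.
have := xy (pickle (g u, m)); rewrite /U pickleK => -[h _].
have /h[v [Dv gv] vy] : (\bigcup_(v in [set v | D v /\ g v = g u]) ball v m.+1%:R^-1) x.
  by exists u => //; rewrite /ball /= dS.
have vu : v = u by apply: ginj; rewrite ?inE.
rewrite vu in vy; have := dT x u y; rewrite leNgt => /negP; apply.
have -> : dist x y = e + e by rewrite /e; field.
by apply: ltrD; [exact: lt_trans xu me|exact: lt_trans vy me].
Qed.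

Section tensor_measures.
Context {R : realType} {d : measure_display} {Z : measurableType d}
  {d' : measure_display} {Omega : measurableType d'}.
Variables (nu : {measure set Z -> \bar R}) (P : probability Omega R).
Variable phi : set Z -> Omega -> R.
Hypothesis crm : is_crm nu P phi.
Hypothesis good : good_crm nu P phi.
Variable U : nat -> set Z.
Hypothesis mU : forall k, measurable (U k).
Hypothesis sepU : forall x y, (forall k, U k x <-> U k y) -> x = y.

Local Notation fin := (fin_sets nu).

(** Two coordinates are equal when they agree on membership in each of the countably many [U k]. *)
Lemma measurable_diag n p : measurable (diag p : set (n.-tuple Z)).
Proof.
have mE (i j : 'I_n) : measurable [set z : n.-tuple Z | tnth z i = tnth z j].
  have mT k (l : 'I_n) : measurable [set z : n.-tuple Z | U k (tnth z l)].
    by rewrite -[X in measurable X]setTI; apply: measurable_tnth.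
  have -> : [set z : n.-tuple Z | tnth z i = tnth z j] = \bigcap_k
    (([set z | U k (tnth z i)] `&` [set z | U k (tnth z j)]) `|`
     (~` [set z | U k (tnth z i)] `&` ~` [set z | U k (tnth z j)])).
    apply/seteqP; split => z /=.
      by move=> e k _; have [h|h] := pselect (U k (tnth z j)); [left|right]; split; rewrite /= ?e.
    move=> h; apply: sepU => k.
    by have [[h1 h2]|[h1 h2]] := h k I; split.
  apply: bigcap_measurableType => k _.
  by apply: measurableU; apply: measurableI => //; exact: measurableC.
have -> : diag p = \bigcap_(i in [set: 'I_n]) \bigcap_(j in [set: 'I_n])
    (if same_block p i j then [set z : n.-tuple Z | tnth z i = tnth z j]
     else ~` [set z | tnth z i = tnth z j]).
  apply/seteqP; split => z h.
    move=> i _ j _; have := h i j; case: ifP => // sb [h1 h2]; first exact: h2.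
    by move/h1.
  move=> i j; have := h i I j I; case: (same_block p i j) => //= h1; split => //.
apply: fin_bigcap_measurable => // i _; apply: fin_bigcap_measurable => // j _.
by case: ifP => // _; exact: measurableC.
Qed.

Lemma rect_update_setU n (A : 'I_n -> set Z) i X Y :
  rect (update A i (X `|` Y)) = rect (update A i X) `|` rect (update A i Y).
Proof.
apply/seteqP; split => z.
  move=> h; have := h i; rewrite /update eqxx => -[zX|zY]; [left|right] => j.
    by have := h j; rewrite /update; case: eqP => // ->.
  by have := h j; rewrite /update; case: eqP => // ->.
by move=> [h|h] j; have := h j; rewrite /update; case: eqP => // _; [left|right].
Qed.

Lemma rect_update_disjoint n (A : 'I_n -> set Z) i X Y : X `&` Y = set0 ->
  rect (update A i X) `&` rect (update A i Y) = set0.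
Proof.
move=> XY; apply/seteqP; split => // z [/(_ i) h1 /(_ i)]; move: h1.
by rewrite /update eqxx => zX zY; have : (X `&` Y) (tnth z i) by []; rewrite XY.
Qed.

Lemma fin_update n (A : 'I_n -> set Z) i X : (forall j, fin (A j)) -> fin X ->
  forall j, fin (update A i X j).
Proof. by move=> fA fX j; rewrite /update; case: ifP. Qed.

Lemma bounded_rect_diag n (A : 'I_n -> set Z) p : (forall j, fin (A j)) ->
  bounded_sets nu (rect A `&` diag p).
Proof.
move=> fA; have [mA _] := bounded_rect fA.
apply: (bounded_sub (bounded_rect fA)) => //.
by apply: measurableI => //; exact: measurable_diag.
Qed.

Definition ae_null (v : Omega -> R^o) : Prop := {ae P, forall w, v w = 0}.

Lemma ae_null0 : ae_null 0. Proof. exact: aeW. Qed.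

Lemma ae_nullD u v : ae_null u -> ae_null v -> ae_null (u + v).
Proof.
move=> hu hv; apply: filterS2 hu hv => w uw vw.
by rewrite -[LHS]/(u w + v w) uw vw addr0.
Qed.

Lemma ae_nullZ c u : ae_null u -> ae_null (c *: u).
Proof.
move=> hu; apply: filterS hu => w uw.
by rewrite -[LHS]/(c * u w) uw mulr0.
Qed.

Lemma St_multiadditive n p : (0 < n)%N ->
  multiadditive ae_null nu (fun A : 'I_n -> set Z => St nu P phi p (rect A)).
Proof.
move=> n0 A i X Y fA fX fY XY.
have fU := fin_update i fA (fin_setsU fX fY).
have h := powerU crm good n0 (C := rect (update A i X) `&` diag p) (C' := rect (update A i Y) `&` diag p).
rewrite -setIUl -rect_update_setU in h.
have {}h := h (bounded_rect_diag p fU) _ _ _.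
have [m1 _] := bounded_rect_diag p (fin_update i fA fX).
have [m2 _] := bounded_rect_diag p (fin_update i fA fY).
have := h m1 m2; rewrite setIACA rect_update_disjoint// set0I => /(_ erefl).
by apply: filterS => w e; rewrite -[LHS]/(St nu P phi p _ w - (St nu P phi p _ w + St nu P phi p _ w)) /St e subrr.
Qed.

Lemma respects_elementary (I : finType) (E : I -> set Z) (z0 : Z) n (f : n.-tuple Z -> R) :
  (forall i, fin (E i)) -> respects E f -> exists m (c : 'I_m -> R) A, elementary nu f c A.
Proof.
move=> fE rf.
exists #|{ffun 'I_n -> {set I}}|,
  (fun l : 'I_#|{ffun 'I_n -> {set I}}| => f [tuple cell_point E z0 (enum_val l i) | i < n]),
  (fun l : 'I_#|{ffun 'I_n -> {set I}}| => cell E \o enum_val l).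
split; first by move=> l i; exact: fin_cell.
rewrite {1}(respects_cells z0 rf); apply/funext => x.
by rewrite (reindex (@enum_val _ (mem {: {ffun 'I_n -> {set I}}})))//; exact/onW_bij/enum_val_bij.
Qed.

(** Almost sure equality with a measurable variable does not give measurability, so it is read off
    the decomposition selected by [linear_ext]. *)
Lemma wiener_ito_measurable n (f : n.-tuple Z -> R) m (c : 'I_m -> R) A : (0 < n)%N ->
  elementary nu f c A -> measurable_fun setT (wiener_ito nu P phi f).
Proof.
move=> n0 e1; rewrite /wiener_ito /linear_ext.
set Q := (X in xget _ X).
have : Q (xget 0 Q).
  by apply: xgetPex; exists (\sum_(l < m) c l *: (St nu P phi (pbot n) (rect (A l)) : Omega -> R^o)), m, c, A.
move=> [m' [c' [A' [[fA' _] ->]]]].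
rewrite (_ : (\sum_(l < m') _) = (fun w => \sum_(l < m') c' l * St nu P phi (pbot n) (rect (A' l)) w)).
  apply: measurable_sum => l; apply: measurable_funM => //.
  by apply: (power_measurable crm good n0); exact: bounded_rect_diag.
by apply/funext => w; rewrite fct_sumE.
Qed.

Lemma pbot_part n : is_part (pbot n).
Proof.
apply/and3P; split.
- rewrite finset.eqEsubset finset.subsetT; apply/fintype.subsetP => i _.
  by apply/finset.bigcupP; exists [set i]%SET; rewrite ?inE//; apply/imsetP; exists i.
- apply/finset.trivIsetP => B B' /imsetP[i _ ->] /imsetP[j _ ->] ij.
  rewrite fintype.disjoint_subset; apply/fintype.subsetP => x; rewrite !inE => /eqP ->.
  by apply: contra ij => /eqP ->.
- apply/negP => /imsetP[i _ /finset.setP/(_ i)]; by rewrite !inE eqxx.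
Qed.

Lemma same_block_pbot n i j : same_block (pbot n) i j = (i == j).
Proof.
have bi : [set i]%SET \in pbot n by apply/imsetP; exists i.
by rewrite -(in_part j (pbot_part n) bi) ?inE// eq_sym.
Qed.

(** Where the kernel does not vanish the cells are pairwise distinct, so their product avoids the
    diagonals and intersecting it with [diag (pbot n)] changes nothing. *)
Lemma wiener_ito_ae (I : finType) (E : I -> set Z) (z0 : Z) n (f : n.-tuple Z -> R) : (0 < n)%N ->
  (forall i, fin (E i)) -> respects E f ->
  (forall x i j, i != j -> tnth x i = tnth x j -> f x = 0) ->
  {ae P, forall w, wiener_ito nu P phi f w =
    \sum_(a : {ffun 'I_n -> {set I}}) f [tuple cell_point E z0 (a i) | i < n] *
      \prod_(i < n) phi (cell E (a i)) w}.
Proof.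
move=> n0 fE rf fdiag.
have h := linear_ext_respects ae_null0 ae_nullD ae_nullZ z0 (St_multiadditive (pbot n) n0) fE rf.
have fc a i : fin ((cell E \o a : 'I_n -> set Z) i) by exact: fin_cell.
have hp : {ae P, forall w (a : {ffun 'I_n -> {set I}}),
    power nu P phi (rect (cell E \o a)) w = \prod_(i < n) phi (cell E (a i)) w}.
  by apply: filter_forall => a; exact: (power_rectE good n0).
apply: filterS2 h hp => w e1 e2.
have {e1} : linear_ext nu (V := Omega -> R^o) (fun A => St nu P phi (pbot n) (rect A)) f w -
  (\sum_(a : {ffun 'I_n -> {set I}}) f [tuple cell_point E z0 (a i) | i < n] *:
     (St nu P phi (pbot n) (rect (cell E \o a)) : Omega -> R^o)) w = 0 by [].
move=> /eqP; rewrite subr_eq0 => /eqP; rewrite /wiener_ito => ->.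
rewrite fct_sumE; apply: eq_bigr => a _.
rewrite -[LHS]/(f [tuple cell_point E z0 (a i) | i < n] * St nu P phi (pbot n) (rect (cell E \o a)) w).
have [->|fa] := eqVneq (f [tuple cell_point E z0 (a i) | i < n]) 0; first by rewrite !mul0r.
congr (_ * _); rewrite -e2 /St; congr (power _ _ _ _ w).
apply: setIidl => x xa i j; rewrite same_block_pbot; split => [xij|/eqP ->//].
apply: contraT => ij; move/eqP: fa; case; apply: (fdiag _ i j ij).
rewrite !tnth_mktuple; congr (cell_point E z0 _); apply/eqP; apply: contraT => aij.
have : (cell E (a i) `&` cell E (a j)) (tnth x i) by split; [exact: xa|rewrite xij; exact: xa].
by rewrite cell_disjoint.
Qed.

Lemma mean_St_multiadditive n (A : 'I_n -> set Z) i X Y : (0 < n)%N -> (forall j, fin (A j)) ->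
  fin X -> fin Y -> X `&` Y = set0 ->
  mean_St nu P phi (ptop n) (rect (update A i (X `|` Y))) =
  mean_St nu P phi (ptop n) (rect (update A i X)) + mean_St nu P phi (ptop n) (rect (update A i Y)).
Proof.
move=> n0 fA fX fY XY; have fU := fin_update i fA (fin_setsU fX fY).
have [m1 _] := bounded_rect_diag (ptop n) (fin_update i fA fX).
have [m2 _] := bounded_rect_diag (ptop n) (fin_update i fA fY).
have h := mean_powerU crm good n0 _ m1 m2; rewrite -setIUl -rect_update_setU in h.
apply: h; first exact: bounded_rect_diag.
by rewrite setIACA rect_update_disjoint// set0I.
Qed.

Definition real_null (v : R^o) : Prop := v = 0.

(** Updating the side [i] affects only the factor of the block containing [i], and that factor is
    additive. *)
Lemma diag_tensor_multiadditive n (s : {set {set 'I_n}}) : is_part s ->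
  multiadditive real_null nu (fun A : 'I_n -> set Z => (\prod_(b in s)
     mean_St nu P phi (ptop #|b|) (rect (fun i : 'I_#|b| => A (enum_val i))) : R^o)).
Proof.
move=> ps A i X Y fA fX fY XY.
have ib : i \in finset.pblock s i by rewrite finset.mem_pblock part_cover.
have bs : finset.pblock s i \in s by apply: finset.pblock_mem; exact: part_cover.
have b0 : (0 < #|finset.pblock s i|)%N by rewrite card_gt0; apply/finset.set0Pn; exists i.
pose G X (b : {set 'I_n}) := mean_St nu P phi (ptop #|b|) (rect (fun i' : 'I_#|b| => update A i X (enum_val i'))).
have Gne T b : b \in s -> b != finset.pblock s i ->
    G T b = mean_St nu P phi (ptop #|b|) (rect (fun i' : 'I_#|b| => A (enum_val i'))).
  move=> b1 b2; rewrite /G; congr (mean_St _ _ _ _ (rect _)); apply/funext => j.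
  rewrite /update; case: eqP => // e; move/eqP: b2; case.
  have ie : i \in b by rewrite -e enum_valP.
  by rewrite (finset.def_pblock _ b1 ie)//; case/and3P: ps.
have Gi T : G T (finset.pblock s i) = mean_St nu P phi (ptop #|finset.pblock s i|)
    (rect (update (fun i' => A (enum_val i')) (enum_rank_in ib i) T)).
  rewrite /G; congr (mean_St _ _ _ _ (rect _)); apply/funext => j; rewrite /update.
  have -> // : (enum_val j == i) = (j == enum_rank_in ib i).
  apply/eqP/eqP => [e|->]; last exact: enum_rankK_in.
  by apply: enum_val_inj; rewrite enum_rankK_in.
rewrite /real_null; apply/eqP; rewrite subr_eq0; apply/eqP.
rewrite -[LHS]/(\prod_(b in s) G (X `|` Y) b).
rewrite -[RHS]/(\prod_(b in s) G X b + \prod_(b in s) G Y b).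
rewrite !(bigD1 _ bs)/= !Gi mean_St_multiadditive//.
have e T : \prod_(b in s | b != finset.pblock s i) G T b =
    \prod_(b in s | b != finset.pblock s i)
      mean_St nu P phi (ptop #|b|) (rect (fun i' : 'I_#|b| => A (enum_val i'))).
  by apply: eq_bigr => b /andP[]; exact: Gne.
by rewrite !e mulrDl.
Qed.

Lemma diag_tensorE (I : finType) (E : I -> set Z) (z0 : Z) n (f : n.-tuple Z -> R) s :
  is_part s -> (forall i, fin (E i)) -> respects E f ->
  diag_tensor nu P phi s f = \sum_(a : {ffun 'I_n -> {set I}})
     f [tuple cell_point E z0 (a i) | i < n] * \prod_(b in s) block_mean nu P phi (cell E) a b.
Proof.
move=> ps fE rf.
have := linear_ext_respects (V := R^o) (N := real_null) (erefl _) _ _ z0 (diag_tensor_multiadditive ps) fE rf.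
move=> h; apply/eqP; rewrite -subr_eq0; apply/eqP; apply: h.
  by move=> u v; rewrite /real_null => -> ->; rewrite addr0.
by move=> c u; rewrite /real_null => ->; rewrite scaler0.
Qed.

(** A point with all coordinates equal cannot have two of them in disjoint sets. *)
Lemma block_mean_eq0 (J I : finType) (C : J -> set Z) (a : I -> J) (b : {set I}) i j :
  (forall s, fin (C s)) -> i \in b -> j \in b -> C (a i) `&` C (a j) = set0 ->
  block_mean nu P phi C a b = 0.
Proof.
move=> fC ib jb Cij; have b0 : (0 < #|b|)%N by rewrite card_gt0; apply/finset.set0Pn; exists i.
rewrite /block_mean /mean_St /St.
rewrite (_ : _ `&` _ = set0); first exact: mean_power_set0.
apply/seteqP; split => // z [zr zd].
have e : tnth z (enum_rank_in ib i) = tnth z (enum_rank_in ib j).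
  apply/zd; have tI : finset.trivIset (ptop #|b|).
    by apply/finset.trivIsetP => B C'; rewrite !inE => /eqP -> /eqP ->; rewrite eqxx.
  by rewrite /same_block (finset.def_pblock tI (B := [set: 'I_#|b|]%SET)) ?inE.
have h1 := zr (enum_rank_in ib i); have h2 := zr (enum_rank_in ib j).
rewrite /= enum_rankK_in// in h1; rewrite /= enum_rankK_in// -e in h2.
by have : (C (a i) `&` C (a j)) (tnth z (enum_rank_in ib i)) by []; rewrite Cij.
Qed.

Hypothesis nat_nu : nonatomic measurable nu.

(** [prod_mean_rec] and [part_sum_block] are the same recursion, with the same value 1 on the empty
    set. *)
Lemma prod_mean_part_sum (J I : finType) (C : J -> set Z) (a : I -> J) (D : {set I}) :
  (forall s, fin (C s)) -> (forall s t, s != t -> C s `&` C t = set0) ->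
  prod_mean P phi C a D = part_sum (block_mean nu P phi C a) D.
Proof.
move=> fC dC; have [n] := ubnP #|D|; elim: n D => [//|n IH] D Dn.
have [->|/finset.set0Pn[i0 iD]] := eqVneq D finset.set0.
  rewrite part_sum_set0 /prod_mean.
  by under eq_fun do rewrite finset.big_set0; rewrite mean_cst.
rewrite (prod_mean_rec crm good mU sepU nat_nu fC dC a iD) (part_sum_block _ iD).
apply: eq_bigr => b /andP[bD ib]; congr (_ * _); apply: IH.
rewrite -ltnS (leq_trans _ Dn)// ltnS; apply: proper_card.
apply/properP; split; first exact: finset.subsetDl.
by exists i0; rewrite // inE ib.
Qed.

End tensor_measures.

(** * Products of sums over functions on disjoint sets of indices *)

Section pinned_sums.
Context {R : comRingType} {I J : finType}.
Variable s0 : J.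
Implicit Types (D : {set I}) (a : {ffun I -> J}).

(* Functions on [D] are represented by the functions on [I] equal to [s0] outside [D]. *)
Definition pinned D a : bool := [forall i, (i \notin D) ==> (a i == s0)].

Definition depends_on D (G : {ffun I -> J} -> R) : Prop :=
  forall a a', (forall i, i \in D -> a i = a' i) -> G a = G a'.

Definition restrict D a : {ffun I -> J} := [ffun i => if i \in D then a i else s0].

Lemma pinnedP D a : reflect (forall i, i \notin D -> a i = s0) (pinned D a).
Proof.
apply: (iffP forallP) => h i; first by move=> iD; have /implyP/(_ iD)/eqP := h i.
by apply/implyP => /h ->.
Qed.

Lemma pinned_restrict D a : pinned D (restrict D a).
Proof. by apply/pinnedP => i iD; rewrite ffunE (negbTE iD). Qed.

Lemma sum_pinned_mul D1 D2 G H : disj D1 D2 -> depends_on D1 G -> depends_on D2 H ->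
  (\sum_(a | pinned D1 a) G a) * (\sum_(a | pinned D2 a) H a) =
  \sum_(a | pinned (D1 :|: D2)%SET a) G a * H a.
Proof.
move=> dD dG dH; rewrite big_distrlr/= pair_big/=.
pose h a := (restrict D1 a, restrict D2 a).
pose h' (p : {ffun I -> J} * {ffun I -> J}) : {ffun I -> J} :=
  [ffun i => if i \in D1 then p.1 i else p.2 i].
rewrite (reindex_onto h h')/=; last first.
  move=> [a1 a2] /andP[/= /pinnedP p1 /pinnedP p2]; congr pair; apply/ffunP => i; rewrite !ffunE/=.
    by case: (boolP (i \in D1)) => // /p1.
  case: (boolP (i \in D2)) => [i2|/p2->//].
  by case: (boolP (i \in D1)) => // i1; rewrite (disjointFr dD i1) in i2.
apply: eq_big => a.
  rewrite !pinned_restrict/=; apply/eqP/pinnedP => [<- i|p].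
    by rewrite !inE negb_or => /andP[/negbTE i1 /negbTE i2]; rewrite !ffunE i1/= ?ffunE i2.
  apply/ffunP => i; rewrite !ffunE/=; case: (boolP (i \in D1)) => i1; first by rewrite ?ffunE ?i1.
  rewrite ?ffunE; case: (boolP (i \in D2)) => i2 //.
  by rewrite p// inE negb_or i1 i2.
move=> _; congr (_ * _); [apply: dG|apply: dH] => i iD; by rewrite ffunE iD.
Qed.

Lemma sum_pinned0 (G : {ffun I -> J} -> R) : \sum_(a | pinned finset.set0 a) G a = G [ffun=> s0].
Proof.
rewrite (big_pred1 [ffun=> s0])// => a; apply/pinnedP/eqP => [h|-> i _]; last by rewrite ffunE.
by apply/ffunP => i; rewrite ffunE h// inE.
Qed.

Lemma pinnedT a : pinned [set: I]%SET a.
Proof. by apply/pinnedP => i; rewrite inE. Qed.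

Lemma depends_onS D D' G : D \subset D' -> depends_on D G -> depends_on D' G.
Proof. by move=> DD dG a a' h; apply: dG => i iD; apply: h; exact: (fintype.subsetP DD). Qed.

Lemma depends_onM D G H : depends_on D G -> depends_on D H -> depends_on D (fun a => G a * H a).
Proof. by move=> dG dH a a' h; rewrite (dG a a' h) (dH a a' h). Qed.

Lemma depends_on_prod (Q : Type) (r : seq Q) (p : pred Q) D (G : Q -> {ffun I -> J} -> R) :
  (forall j, p j -> depends_on D (G j)) -> depends_on D (fun a => \prod_(j <- r | p j) G j a).
Proof. by move=> dG a a' h; apply: eq_bigr => j pj; exact: dG. Qed.

Lemma prod_sum_pinned (Q : finType) (g : I -> Q) (G : Q -> {ffun I -> J} -> R) (S : {set Q}) :
  (forall j, depends_on (fiber g [set j]%SET) (G j)) ->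
  \prod_(j in S) \sum_(a | pinned (fiber g [set j]%SET) a) G j a =
  \sum_(a | pinned (fiber g S) a) \prod_(j in S) G j a.
Proof.
move=> dG; have [n] := ubnP #|S|; elim: n S => [//|n IH] S Sn.
have [->|/finset.set0Pn[j jS]] := eqVneq S finset.set0.
  rewrite finset.big_set0 (_ : fiber g finset.set0 = finset.set0); last first.
    by apply/finset.setP => i; rewrite !inE.
  by rewrite sum_pinned0 finset.big_set0.
rewrite (big_setD1 j)//= IH; last first.
  by move: Sn; rewrite (finset.cardsD1 j) jS.
have fE : fiber g S = (fiber g [set j]%SET :|: fiber g (S :\ j))%SET.
  apply/finset.setP => i; rewrite !inE; case: (eqVneq (g i) j) => //= ->.
  by rewrite jS.
rewrite sum_pinned_mul//.
- by rewrite -fE; apply: eq_bigr => a _; rewrite [RHS](big_setD1 j).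
- rewrite fintype.disjoint_subset; apply/fintype.subsetP => i; rewrite !inE => /eqP ->.
  by rewrite eqxx.
- apply: depends_on_prod => j' /[!inE] /andP[jj' jS']; apply: depends_onS (dG j').
  by apply/fintype.subsetP => i; rewrite !inE => /eqP ->; rewrite jj'.
Qed.

Lemma sum_pinned_reindex m (e : 'I_m -> I) (G : {ffun 'I_m -> J} -> R) : injective e ->
  \sum_(b : {ffun 'I_m -> J}) G b =
  \sum_(a | pinned [set e i | i : 'I_m]%SET a) G [ffun i => a (e i)].
Proof.
move=> ei.
pose h a : {ffun 'I_m -> J} := [ffun i => a (e i)].
pose h' (b : {ffun 'I_m -> J}) : {ffun I -> J} :=
  [ffun x => if [pick i | e i == x] is Some i then b i else s0].
rewrite (reindex_onto h h')/=; last first.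
  move=> b _; apply/ffunP => i; rewrite !ffunE; case: pickP => [i' /eqP/ei -> //|/(_ i)].
  by rewrite eqxx.
apply: eq_bigl => a; apply/eqP/pinnedP => [<- x xe|p].
  rewrite ffunE; case: pickP => // i /eqP e1.
  by move/negP: xe; case; apply/imsetP; exists i.
apply/ffunP => x; rewrite ffunE; case: pickP => [i /eqP <-|ne]; first by rewrite ffunE.
rewrite p//; apply/negP => /imsetP[i _ xe]; have := ne i; by rewrite xe eqxx.
Qed.

End pinned_sums.

(** * Arguments of the tensor product and the partition into kernels *)

Section block_structure.
Variables (k : nat) (n_ : 'I_k -> nat).
Hypothesis n0 : forall j, (0 < n_ j)%N.
Local Notation n := (\sum_j n_ j)%N.
Implicit Types (s : {set {set 'I_n}}).

(** The kernel that receives the [i]-th argument of the tensor product. *)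
Definition block_index (i : 'I_n) : 'I_k := tagnat.sig1 i.
Local Notation g := block_index.

Lemma block_index_Rank j (i : 'I_(n_ j)) : g (tagnat.Rank j i) = j.
Proof. exact: tagnat.Rank1K. Qed.

Lemma Rank_injective j : injective (@tagnat.Rank k n_ j).
Proof. by move=> i i' /(@tagnat.rank_inj _ _) /eqP; rewrite eq_Tagged => /eqP. Qed.

Lemma fiber_block_index j :
  fiber g [set j]%SET = [set tagnat.Rank j i | i : 'I_(n_ j)]%SET.
Proof.
apply/finset.setP => i; rewrite !inE; apply/eqP/imsetP => [<-|[i' _ ->]]; last exact: block_index_Rank.
by exists (tagnat.sig2 i) => //; rewrite tagnat.sig2K.
Qed.

Lemma pistar_fiber b : (b \in pistar n_) = [exists j, b == fiber g [set j]%SET].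
Proof.
have e j : [set tagnat.Rank j i | i in [set: 'I_(n_ j)]]%SET = fiber g [set j]%SET.
  rewrite fiber_block_index; apply/finset.setP => x.
  by apply/imsetP/imsetP => -[i _ ->]; exists i; rewrite ?inE.
apply/imsetP/existsP => [[j _ ->]|[j /eqP ->]]; exists j; rewrite ?inE// e//.
Qed.

Lemma pistar_part : is_part (pistar n_).
Proof.
apply/and3P; split.
- rewrite finset.eqEsubset finset.subsetT; apply/fintype.subsetP => i _.
  apply/finset.bigcupP; exists (fiber g [set g i]%SET); last by rewrite !inE.
  by rewrite pistar_fiber; apply/existsP; exists (g i).
- apply/finset.trivIsetP => b b'; rewrite !pistar_fiber => /existsP[j /eqP ->] /existsP[j' /eqP ->] jj'.
  rewrite fintype.disjoint_subset; apply/fintype.subsetP => i; rewrite !inE => /eqP ->.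
  by apply: contra jj' => /eqP ->.
- rewrite pistar_fiber; apply/negP => /existsP[j /eqP/finset.setP/(_ (tagnat.Rank j (Ordinal (n0 j))))].
  by rewrite !inE block_index_Rank eqxx.
Qed.

Lemma same_block_pistar i i' : same_block (pistar n_) i i' = (g i == g i').
Proof.
have bi : fiber g [set g i]%SET \in pistar n_ by rewrite pistar_fiber; apply/existsP; exists (g i).
by rewrite -(in_part i' pistar_part bi) ?inE// eq_sym.
Qed.

Lemma part_eq_pbot m (s : {set {set 'I_m}}) : is_part s ->
  (forall i j, same_block s i j -> i = j) -> s = pbot m.
Proof.
move=> ps h; have pb i : finset.pblock s i = [set i]%SET.
  apply/finset.setP => j; rewrite inE; apply/idP/eqP => [/h ->//|->].
  by rewrite finset.mem_pblock part_cover.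
apply/finset.setP => b; apply/idP/imsetP => [bs|[i _ ->]].
  have /finset.set0Pn[i ib] := finset.partition_neq0 ps bs; exists i => //.
  by rewrite -pb (finset.def_pblock _ bs ib)//; case/and3P: ps.
by rewrite -pb; apply: finset.pblock_mem; exact: part_cover.
Qed.

Lemma part_eq_ptop m (s : {set {set 'I_m}}) : (0 < m)%N -> is_part s ->
  (s == ptop m) = [forall i, forall j, same_block s i j].
Proof.
move=> m0 ps; apply/eqP/forallP => [-> i|h].
  apply/forallP => j.
  have tI : finset.trivIset (ptop m).
    by apply/finset.trivIsetP => B C; rewrite !inE => /eqP -> /eqP ->; rewrite eqxx.
  by rewrite /same_block (finset.def_pblock tI (B := [set: 'I_m]%SET)) ?inE.
have full b : b \in s -> b = [set: 'I_m]%SET.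
  move=> bs; have /finset.set0Pn[i ib] := finset.partition_neq0 ps bs.
  apply/finset.setP => j; rewrite inE (in_part j ps bs ib).
  by have /forallP := h i; apply.
apply/finset.setP => b; rewrite inE; apply/idP/eqP => [/full//|->].
rewrite -(full (finset.pblock s (Ordinal m0))); apply: finset.pblock_mem; exact: part_cover.
Qed.

Lemma pmeet_pistar_neq s : is_part s -> pmeet s (pistar n_) != pbot n ->
  exists i i', [/\ i != i', same_block s i i' & g i = g i'].
Proof.
move=> ps; apply: contra_neqP => /forallNP h; apply: part_eq_pbot.
  by apply: pmeet_part => //; exact: pistar_part.
move=> i j; rewrite same_block_pmeet//; last exact: pistar_part.
rewrite same_block_pistar => /andP[sij /eqP gij]; apply/eqP; apply: contraT => ij.
by case: (h i); exists j.
Qed.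

(** Both sides express connectedness, of the graph on kernels on the left and on arguments on the
    right, where the arguments of one kernel are linked by [pistar]. *)
Lemma component_pjoin s j0 : is_part s ->
  component g j0 s [set: 'I_k]%SET = (pjoin s (pistar n_) == ptop n).
Proof.
move=> ps; have pp := pistar_part.
pose i0 := tagnat.Rank j0 (Ordinal (n0 j0)).
have npos : (0 < n)%N by exact: leq_ltn_trans (ltn_ord i0).
rewrite part_eq_ptop//; last exact: pjoin_part.
pose e i j := same_block s i j || same_block (pistar n_) i j.
have gi0 : g i0 = j0 by exact: block_index_Rank.
apply/finset.minsetP/forallP => [[_ mini] i|h].
  have con : forall i', connect e i0 i'.
    (* The kernels all of whose arguments can be reached from [i0]; this set contains [j0] and is
       saturated, so by minimality it is everything. *)
    pose T := [set j | [forall i' : 'I_n, (g i' == j) ==> connect e i0 i']]%SET.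
    have TP i' : g i' \in T -> connect e i0 i'.
      by rewrite inE => /forallP/(_ i')/implyP; apply.
    have T1 i' : connect e i0 i' -> g i' \in T.
      move=> c; rewrite inE; apply/forallP => i''; apply/implyP => /eqP gg.
      by apply: (connect_trans c); apply: connect1; rewrite /e same_block_pistar gg eqxx orbT.
    suff TT : T = [set: 'I_k]%SET by move=> i'; apply: TP; rewrite TT inE.
    apply: mini; last exact: finset.subsetT.
    rewrite -{1}gi0 T1 ?connect0//=; apply/saturatedP => b i1 i2 bs b1 b2.
    have step x y : x \in b -> y \in b -> g x \in T -> g y \in T.
      move=> xb yb /TP c; apply: T1; apply: (connect_trans c); apply: connect1.
      by rewrite /e -(in_part y ps bs xb) yb.
    by apply/idP/idP; exact: step.
  have cs : connect_sym e.
    apply: sym_connect_sym => i1 i2; rewrite /e !(same_blockE _ _ ps) !(same_blockE _ _ pp).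
    by rewrite (eq_sym (finset.pblock s i1)) (eq_sym (finset.pblock (pistar n_) i1)).
  apply/forallP => j; rewrite same_block_pjoin// -/e.
  by apply: connect_trans (con j); rewrite cs.
split.
  by rewrite inE; apply/saturatedP => *; rewrite !inE.
move=> B /andP[jB /saturatedP sB] _; apply/finset.setP => j; rewrite inE.
pose i := tagnat.Rank j (Ordinal (n0 j)).
have /forallP/(_ i) := h i0; rewrite same_block_pjoin// => /connectP[w pw].
rewrite -(block_index_Rank (Ordinal (n0 j))) -/i => ->.
have : g i0 \in B by rewrite gi0.
elim: w (i0) pw => [//|x w IH] y /= /andP[yx xw] yB; apply: (IH x xw).
case/orP: yx => [yx|]; last by rewrite same_block_pistar => /eqP <-.
have bs : finset.pblock s y \in s by apply: finset.pblock_mem; exact: part_cover.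
rewrite -(sB _ y x bs)//; rewrite finset.mem_pblock part_cover//.
Qed.

End block_structure.

Section respecting_kernels.
Context {R : realType} {d : measure_display} {Z : measurableType d}.
Variable nu : {measure set Z -> \bar R}.

Definition diagonal_free n (f : n.-tuple Z -> R) : Prop :=
  forall x i j, i != j -> tnth x i = tnth x j -> f x = 0.

(** Each family of sets is packed with its size, so that one can be chosen for every kernel and all
    of them merged. *)
Lemma sym_elementary_respects n (f : n.-tuple Z -> R) : sym_elementary nu f ->
  diagonal_free f /\ exists p : {m : nat & 'I_m -> set Z},
    (forall i, fin_sets nu (projT2 p i)) /\ respects (projT2 p) f.
Proof.
move=> [m [c [C [fC dC ->]]]]; split.
  move=> x i j ij xij; apply: big1 => l _; rewrite indicE memNset ?mulr0// => -[w _ xw].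
  have : (C l (w i) `&` C l (w j)) (tnth x i) by split; [exact: xw|rewrite xij; exact: xw].
  by rewrite dC// (inj_eq perm_inj).
pose E (u : 'I_#|{: 'I_m * 'I_n}|) := C (enum_val u).1 (enum_val u).2.
have EC l i : C l i = E (enum_rank (l, i)) by rewrite /E enum_rankK.
exists (existT _ _ E); split=> [u|]; first exact: fC.
split=> [x y xy|x j xj] /=.
  apply: eq_bigr => l _; congr (_ * _); rewrite !indicE; congr (_%:R); congr nat_of_bool.
  by apply/idP/idP => /set_mem [w _ h]; apply/mem_set; exists w => // i; have := h i;
    rewrite EC => /xy.
apply: big1 => l _; rewrite indicE memNset ?mulr0// => -[w _ h].
by apply: (xj (enum_rank (l, w j))); rewrite /= -EC; exact: h.
Qed.

Lemma respects_reindex (I I' : finType) (E : I -> set Z) (E' : I' -> set Z) (h : I -> I')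
  n (f : n.-tuple Z -> R) : (forall i, E i = E' (h i)) -> respects E f -> respects E' f.
Proof.
move=> EE [f1 f2]; split=> [x y xy|x j xj]; first by apply: f1 => j i; rewrite EE.
by apply: (f2 x j) => i; rewrite EE.
Qed.

Lemma tensor_respects (I : finType) (E : I -> set Z) k (n_ : 'I_k -> nat)
    (f : forall j, (n_ j).-tuple Z -> R) :
  (forall j, respects E (f j)) -> respects E (tensor f).
Proof.
move=> rf; split=> [x y xy|x i xi].
  apply: eq_bigr => j _; apply: (rf j).1 => i l.
  by rewrite !tnth_mktuple.
rewrite /tensor (bigD1 (tagnat.sig1 i))//= ((rf _).2 _ (tagnat.sig2 i)) ?mul0r// => l.
by rewrite tnth_mktuple tagnat.sig2K.
Qed.

End respecting_kernels.

(** * Moments and cumulants of the integrals as sums over labelings by cells *)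

Section moments_and_cumulants.
Context {R : realType} {d : measure_display} {Z : measurableType d}
  {d' : measure_display} {Omega : measurableType d'}.
Variables (nu : {measure set Z -> \bar R}) (P : probability Omega R).
Variable phi : set Z -> Omega -> R.
Hypothesis crm : is_crm nu P phi.
Hypothesis good : good_crm nu P phi.
Variable U : nat -> set Z.
Hypothesis mU : forall k, measurable (U k).
Hypothesis sepU : forall x y, (forall k, U k x <-> U k y) -> x = y.
Hypothesis nat_nu : nonatomic measurable nu.
Variables (I : finType) (E : I -> set Z) (z0 : Z).
Hypothesis fE : forall i, fin_sets nu (E i).
Variables (k : nat) (n_ : 'I_k -> nat) (f : forall j, (n_ j).-tuple Z -> R).
Arguments f : clear implicits.
Hypothesis n0 : forall j, (0 < n_ j)%N.
Hypothesis rf : forall j, respects E (f j).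
Hypothesis df : forall j, diagonal_free (f j).

Local Notation J := {set I}.
Local Notation n := (\sum_j n_ j)%N.
Local Notation g := (@block_index k n_).
Local Notation ffn := {ffun 'I_n -> J}.
Local Notation s0 := (finset.set0 : J).
Local Notation bm a := (block_mean nu P phi (cell E) a).

Let fcell := fin_cell fE.
Let dcell s s' := @cell_disjoint d Z I E s s'.

Definition kernel_value (a : ffn) j : R :=
  f j [tuple cell_point E z0 (a (tagnat.Rank j i)) | i < n_ j].

Definition weight (S : {set 'I_k}) (a : ffn) : R := \prod_(j in S) kernel_value a j.

(** An explicit version of the integral of [f j]: a polynomial in the values of [phi] on cells,
    hence with all moments. *)
Definition chaos j w : R := \sum_(b : {ffun 'I_(n_ j) -> J})
  f j [tuple cell_point E z0 (b i) | i < n_ j] * \prod_(i < n_ j) phi (cell E (b i)) w.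

Lemma chaos_moments j : has_moments P (chaos j).
Proof.
apply: has_moments_sum => b _; apply: has_momentsZ; apply: has_moments_prod => i _.
exact: (phi_moments crm).
Qed.

Lemma prod_fiber (F : 'I_n -> R) (S : {set 'I_k}) :
  \prod_(j in S) \prod_(i in fiber g [set j]%SET) F i = \prod_(i in fiber g S) F i.
Proof.
rewrite [RHS](partition_big g (mem S))/=; last by move=> i; rewrite inE.
apply: eq_bigr => j jS; apply: eq_bigl => i; rewrite !inE.
by case: eqP => [->|]; rewrite ?andbF// jS.
Qed.

Lemma depends_kernel_value j : depends_on (fiber g [set j]%SET) (fun a => kernel_value a j).
Proof.
move=> a a' h; rewrite /kernel_value; congr (f _ _); apply: eq_from_tnth => i.
by rewrite !tnth_mktuple h// inE block_index_Rank inE.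
Qed.

(** The labels of the arguments of one kernel are seen as labels of all [n] arguments, trivial
    elsewhere, so that the labelings of different kernels can be glued in a product. *)
Lemma chaosE j w : chaos j w = \sum_(a : ffn | pinned s0 (fiber g [set j]%SET) a)
  kernel_value a j * \prod_(i in fiber g [set j]%SET) phi (cell E (a i)) w.
Proof.
rewrite /chaos (sum_pinned_reindex s0 _ (@Rank_injective k n_ j)) fiber_block_index.
apply: eq_bigr => a _; congr (_ * _).
  rewrite /kernel_value; congr (f _ _); apply: eq_from_tnth => i.
  by rewrite !tnth_mktuple ffunE.
rewrite big_imset/=; last by move=> i i' _ _; exact: Rank_injective.
by apply: eq_bigr => i _; rewrite ffunE.
Qed.

Lemma mean_prod_chaos (S : {set 'I_k}) :
  mean P (fun w => \prod_(j in S) chaos j w) =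
  \sum_(a : ffn | pinned s0 (fiber g S) a) weight S a * part_sum (bm a) (fiber g S).
Proof.
have e w : \prod_(j in S) chaos j w = \sum_(a : ffn | pinned s0 (fiber g S) a)
    weight S a * \prod_(i in fiber g S) phi (cell E (a i)) w.
  under eq_bigr do rewrite chaosE.
  rewrite prod_sum_pinned; last first.
    move=> j; apply: depends_onM; first exact: depends_kernel_value.
    by move=> a a' h; apply: eq_bigr => i ij; rewrite h.
  by apply: eq_bigr => a _; rewrite big_split/= prod_fiber.
have mp a : has_moments P (fun w => \prod_(i in fiber g S) phi (cell E (a i)) w).
  by apply: has_moments_prod => i _; exact: (phi_moments crm).
under eq_fun do rewrite e.
rewrite mean_sum; last by move=> a _; exact: has_momentsZ.
apply: eq_bigr => a _; rewrite meanZ//; congr (_ * _).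
exact: (prod_mean_part_sum crm good mU sepU nat_nu a (fiber g S) fcell dcell).
Qed.

Definition joint_kappa j0 (T : {set 'I_k}) : R :=
  \sum_(a : ffn | pinned s0 (fiber g T) a) weight T a * conn_sum g (bm a) j0 T.

Lemma block_mean_local (a a' : ffn) (b : {set 'I_n}) : (forall i, i \in b -> a i = a' i) ->
  bm a b = bm a' b.
Proof.
move=> h; rewrite /block_mean; congr (mean_St _ _ _ _ (rect _)); apply/funext => i.
by rewrite h// enum_valP.
Qed.

Lemma prod_block_mean_local (a a' : ffn) (s : {set {set 'I_n}}) D :
  finset.partition s D -> (forall i, i \in D -> a i = a' i) ->
  \prod_(b in s) bm a b = \prod_(b in s) bm a' b.
Proof.
move=> ps h; apply: eq_bigr => b bs; apply: block_mean_local => i ib; apply: h.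
by rewrite -(finset.cover_partition ps); apply/finset.bigcupP; exists b.
Qed.

Lemma depends_weight S : depends_on (fiber g S) (weight S).
Proof.
apply: depends_on_prod => j jS; apply: depends_onS (depends_kernel_value (j := j)).
by apply/fintype.subsetP => i; rewrite !inE => /eqP ->.
Qed.

(** The partitions are grouped by the component [T] of [j0]. The factors of [T] and of its
    complement depend on the labels of disjoint sets of arguments, so the sum over labelings factors
    as well. *)
Lemma mean_prod_chaos_rec j0 (S : {set 'I_k}) : j0 \in S ->
  mean P (fun w => \prod_(j in S) chaos j w) =
  \sum_(T : {set 'I_k} | (T \subset S) && (j0 \in T))
    joint_kappa j0 T * mean P (fun w => \prod_(j in S :\: T) chaos j w).
Proof.
move=> jS; rewrite mean_prod_chaos.
under [LHS]eq_bigr => a _ do rewrite (part_sum_component g (bm a) jS) mulr_sumr.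
rewrite exchange_big/=; apply: eq_bigr => T /andP[TS jT].
rewrite mean_prod_chaos /joint_kappa sum_pinned_mul; last first.
- apply: depends_onM; first exact: depends_weight.
  by move=> a a' h; apply: eq_bigr => s ps; exact: prod_block_mean_local ps h.
- apply: depends_onM; first exact: depends_weight.
  by move=> a a' h; apply: eq_bigr => s /andP[ps _]; exact: prod_block_mean_local ps h.
- rewrite fintype.disjoint_subset; apply/fintype.subsetP => i; rewrite !inE => ->.
  by [].
have fU : (fiber g T :|: fiber g (S :\: T)%SET)%SET = fiber g S.
  apply/finset.setP => i; rewrite !inE; case: (boolP (g i \in T)) => //= iT.
  by rewrite (fintype.subsetP TS).
rewrite fU; apply: eq_bigr => a _.
have -> : weight S a = weight T a * weight (S :\: T)%SET a.
  rewrite /weight (bigID (mem T))/=; congr (_ * _); apply: eq_bigl => j; rewrite ?inE.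
    by case: (boolP (j \in T)) => [/(fintype.subsetP TS)->//|_]; rewrite andbF.
  by rewrite andbC.
ring.
Qed.

Lemma tensor_weight (a : ffn) :
  tensor f [tuple cell_point E z0 (a i) | i < n] = weight [set: 'I_k]%SET a.
Proof.
rewrite /tensor /weight; apply: eq_big => [j|j _]; first by rewrite inE.
rewrite /kernel_value; congr (f _ _); apply: eq_from_tnth => i.
by rewrite !tnth_mktuple.
Qed.

(* A partition joining two arguments of the same kernel does not contribute: the kernels
   vanish on the diagonals. *)
Lemma sum_diag_tensor (Q : pred {set {set 'I_n}}) :
  \sum_(s : {set {set 'I_n}} | [&& is_part s, pmeet s (pistar n_) == pbot n & Q s])
     diag_tensor nu P phi s (tensor f) =
  \sum_(a : ffn) weight [set: 'I_k]%SET a *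
    \sum_(s : {set {set 'I_n}} | is_part s && Q s) \prod_(b in s) bm a b.
Proof.
transitivity (\sum_(s : {set {set 'I_n}} | [&& is_part s, pmeet s (pistar n_) == pbot n & Q s])
    \sum_(a : ffn) weight [set: 'I_k]%SET a * \prod_(b in s) bm a b).
  apply: eq_bigr => s /and3P[ps _ _].
  rewrite (diag_tensorE crm good mU sepU z0 ps fE (tensor_respects rf)).
  by apply: eq_bigr => a _; rewrite tensor_weight.
rewrite exchange_big/=; apply: eq_bigr => a _; rewrite -big_distrr/=.
have [->|wa] := eqVneq (weight [set: 'I_k]%SET a) 0; first by rewrite !mul0r.
congr (_ * _); rewrite [RHS](bigID (fun s => pmeet s (pistar n_) == pbot n))/=.
rewrite [X in _ = _ + X]big1 ?addr0; first by apply: eq_bigl => s; rewrite andbAC andbA.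
(* As the weight is nonzero, two arguments of the same kernel have distinct labels; their cells are
   disjoint, and a block containing both has mean 0. *)
move=> s /andP[/andP[ps _] np].
have [i [i' [ii' sb gg]]] := pmeet_pistar_neq n0 ps np.
have bs : finset.pblock s i \in s by apply: finset.pblock_mem; exact: part_cover.
rewrite (bigD1 _ bs)/= (block_mean_eq0 crm good (i := i) (j := i') fcell) ?mul0r//.
- by rewrite finset.mem_pblock part_cover.
- apply: dcell; apply: contra wa => /eqP aii; rewrite /weight (bigD1 (g i)) ?inE//=.
  have /imsetP[l _ il] : i \in [set tagnat.Rank (g i) l | l : 'I_(n_ (g i))]%SET.
    by rewrite -fiber_block_index !inE.
  have /imsetP[l' _ il'] : i' \in [set tagnat.Rank (g i) l | l : 'I_(n_ (g i))]%SET.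
    by rewrite -fiber_block_index !inE gg.
  rewrite /kernel_value (@df (g i) _ l l') ?mul0r//.
    by apply: contra ii' => /eqP e; rewrite il il' e.
  by rewrite !tnth_mktuple -il -il' aii.
Qed.

Lemma mean_prod_chaos_tensor :
  mean P (fun w => \prod_(j < k) chaos j w) =
  \sum_(s : {set {set 'I_n}} | is_part s && (pmeet s (pistar n_) == pbot n))
     diag_tensor nu P phi s (tensor f).
Proof.
have fT : fiber g [set: 'I_k]%SET = [set: 'I_n]%SET by apply/finset.setP => i; rewrite !inE.
transitivity (mean P (fun w => \prod_(j in [set: 'I_k]%SET) chaos j w)).
  by congr mean; apply/funext => w; apply: eq_bigl => j; rewrite inE.
rewrite mean_prod_chaos fT; transitivity (\sum_(s : {set {set 'I_n}} |
    [&& is_part s, pmeet s (pistar n_) == pbot n & true]) diag_tensor nu P phi s (tensor f)).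
  rewrite (sum_diag_tensor predT); apply: eq_big => [a|a _]; first exact: pinnedT.
  by congr (_ * _); apply: eq_bigl => s; rewrite andbT.
by apply: eq_bigl => s; rewrite andbT.
Qed.

Lemma joint_kappa_tensor j0 :
  joint_kappa j0 [set: 'I_k]%SET =
  \sum_(s : {set {set 'I_n}} | [&& is_part s, pmeet s (pistar n_) == pbot n &
      pjoin s (pistar n_) == ptop n]) diag_tensor nu P phi s (tensor f).
Proof.
rewrite sum_diag_tensor /joint_kappa.
have fT : fiber g [set: 'I_k]%SET = [set: 'I_n]%SET by apply/finset.setP => i; rewrite !inE.
apply: eq_big => [a|a _]; first by rewrite fT; exact: pinnedT.
congr (_ * _); apply: eq_bigl => s; rewrite fT.
by apply: andb_id2l => ps; rewrite component_pjoin.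
Qed.

Lemma wiener_ito_chaos j : {ae P, forall w, wiener_ito nu P phi (f j) w = chaos j w}.
Proof. exact: (wiener_ito_ae crm good mU sepU z0 (n0 j) fE (rf j) (df (j := j))). Qed.

End moments_and_cumulants.

Lemma cumulant_ae_eq {R : realType} {d : measure_display} {Omega : measurableType d}
  (P : probability Omega R) k (X Y : 'I_k -> Omega -> R) :
  (forall j, measurable_fun setT (X j)) -> (forall j, measurable_fun setT (Y j)) ->
  (forall j, {ae P, forall w, X j w = Y j w}) -> cumulant P X = cumulant P Y.
Proof.
move=> mX mY XY; rewrite /cumulant; suff -> : charfun P X = charfun P Y by [].
apply/funext => z.
have mp (T : 'I_k -> Omega -> R) : (forall j, measurable_fun setT (T j)) ->
    measurable_fun setT (fun w => \sum_(l < k) z 0 l * T l w).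
  by move=> mT; apply: measurable_sum => l; exact: measurable_funM.
have ae : {ae P, forall w, forall j, X j w = Y j w} by exact: filter_forall.
rewrite /charfun /expectationC; congr Complex; congr fine; apply: expectation_ae_eq.
- by apply: measurableT_comp; [apply: continuous_measurable_fun; exact: continuous_cos|exact: mp].
- by apply: measurableT_comp; [apply: continuous_measurable_fun; exact: continuous_cos|exact: mp].
- by apply: filterS ae => w e /=; under eq_bigr do rewrite e.
- by apply: measurableT_comp; [apply: continuous_measurable_fun; exact: continuous_sin|exact: mp].
- by apply: measurableT_comp; [apply: continuous_measurable_fun; exact: continuous_sin|exact: mp].
- by apply: filterS ae => w e /=; under eq_bigr do rewrite e.
Qed.

Theorem theorem7p1 (R : realType) (Z : ptopologicalType)
    (d : measure_display) (Omega : measurableType d) (P : probability Omega R)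
    (nu : {measure set (borel Z) -> \bar R})
    (phi : set (borel Z) -> Omega -> R)
    (k : nat) (n_ : 'I_k -> nat)
    (f : forall j : 'I_k, (n_ j).-tuple (borel Z) -> R) :
  polish R Z ->
  sigma_finite [set: borel Z] nu ->
  nonatomic measurable nu ->
  is_crm nu P phi ->
  good_crm nu P phi ->
  multiplicative_crm nu P phi ->
  (0 < k)%N ->
  (forall j, 0 < n_ j)%N ->
  (forall j, sym_elementary nu (f j)) ->
  ('E_P[fun w => (\prod_(j < k) wiener_ito nu P phi (f j) w)%R] =
     (\sum_(s : {set {set 'I_(\sum_j n_ j)}} |
            is_part s && (pmeet s (pistar n_) == pbot (\sum_j n_ j)))
        diag_tensor nu P phi s (tensor f))%:E)%E
  /\
  cumulant P (fun j => wiener_ito nu P phi (f j)) =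
    real_complex R
     (\sum_(s : {set {set 'I_(\sum_j n_ j)}} |
            [&& is_part s, pmeet s (pistar n_) == pbot (\sum_j n_ j) &
                pjoin s (pistar n_) == ptop (\sum_j n_ j)])
        diag_tensor nu P phi s (tensor f)).
Proof.
case: k n_ f => [|k] n_ f pZ _ nat_nu crm good _ // _ n0 sf.
have [U [mU sepU]] := polish_separating pZ.
have df j : diagonal_free (f j) by have [] := sym_elementary_respects (sf j).
have /choice[p hp] : forall j, exists p : {m : nat & 'I_m -> set (borel Z)},
    (forall i, fin_sets nu (projT2 p i)) /\ respects (projT2 p) (f j).
  by move=> j; have [] := sym_elementary_respects (sf j).
(* The sets of all the kernels are put into one family, so that a single system of cells serves
   every kernel. *)
pose I := {j : 'I_k.+1 & 'I_(projT1 (p j))}.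
pose E (u : I) := projT2 (p (tag u)) (tagged u).
have fE u : fin_sets nu (E u) by exact: (hp (tag u)).1.
have rf j : respects E (f j).
  exact: (respects_reindex (h := fun i => Tagged (fun j => 'I_(projT1 (p j))) i) _ (hp j).2).
pose z0 : borel Z := (point : Z).
pose Y j := chaos phi E z0 f j.
have mY j : has_moments P (Y j) by exact: (chaos_moments crm).
have WY j : {ae P, forall w, wiener_ito nu P phi (f j) w = Y j w}.
  exact: (wiener_ito_chaos crm good mU sepU z0 fE n0 rf df).
have mW j : measurable_fun setT (wiener_ito nu P phi (f j)).
  have [m [c [A e]]] := respects_elementary z0 fE (rf j).
  exact: (wiener_ito_measurable crm good mU sepU (n0 j) e).
split.
  rewrite -(mean_prod_chaos_tensor crm good mU sepU nat_nu z0 fE n0 rf df).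
  have mp : has_moments P (fun w => \prod_(j < k.+1) Y j w) by exact: has_moments_prod.
  rewrite -(mean_fineK mp); apply: expectation_ae_eq.
  - by apply: measurable_prod => j _; exact: mW.
  - by case: mp.
  - have ae : {ae P, forall w, forall j, wiener_ito nu P phi (f j) w = Y j w} by exact: filter_forall.
    by apply: filterS ae => w e; apply: eq_bigr => j _; exact: e.
rewrite (cumulant_ae_eq mW (fun j => (mY j).1) WY).
(* The full sum over connecting partitions is the same for every base kernel; [ord_max] is the one
   singled out in [cumulant_unique]. *)
rewrite -(joint_kappa_tensor crm good mU sepU z0 fE n0 rf df ord_max).
apply: cumulant_unique => // S jS.
exact: (mean_prod_chaos_rec crm good mU sepU nat_nu z0 fE f jS).
Qed.
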